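(* Let $\alpha>-1$, $y\geq0$, $I\in\mathbb{S}$, and let $\omega$ be a positive measurable function on $(0,1)$ such that $\omega(t)\,dt$ is a finite measure. Assume that $$\int_{\mathbb{B}_I}R_{|q|^2}^\alpha(y,y)\,\omega(|q|^2)\,du\,dv<+\infty,\qquad q=u+Iv.$$ Set ${^cA}^{2,\omega}_{slice}:=S^\alpha_y\left(L^{2,\alpha}_{\mathbb{H}}(\mathbb{R}^+)\right)$ and $N_y^\alpha=\{n\in\mathbb{Z}_{\ge0}:L_n^{(\alpha)}(y)=0\}$. Then ${^cA}^{2,\omega}_{slice}\subset A^{2,\omega}_{slice}$, and $\{e_n(q)=q^n:\ n\notin N_y^\alpha\}$ is a complete orthogonal system in ${^cA}^{2,\omega}_{slice}$.
   Context: $\mathbb{H}$ denotes the quaternions, $\mathbb{B}$ the open unit ball of $\mathbb{H}$, $\mathbb{S}=\{q\in\mathbb{H}:q^2=-1\}$, $\mathbb{C}_I=\mathbb{R}+I\mathbb{R}$, $\mathbb{B}_I=\mathbb{B}\cap\mathbb{C}_I$. A (real differentiable) function $f:\mathbb{B}\to\mathbb{H}$ is (left) slice regular, $f\in\mathcal{SR}(\mathbb{B})$, if $\frac12\left(\frac{\partial}{\partial x}+J\frac{\partial}{\partial y}\right)f|_{\mathbb{C}_J}(x+Jy)=0$ for every $J\in\mathbb{S}$. $A^{2,\omega}_{slice}$ is the space of all $f\in\mathcal{SR}(\mathbb{B})$ whose restriction to $\mathbb{B}_I$ is in $L^2(\mathbb{B}_I,\omega(|q|^2)\,dx\,dy)$,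 with inner product $\langle f,g\rangle_\omega=\int_{\mathbb{B}_I}\overline{f(x+Iy)}g(x+Iy)\omega(x^2+y^2)\,dx\,dy$. Equivalently it consists of the series $\sum_nq^nc_n$, $c_n\in\mathbb{H}$, convergent on $\mathbb{B}$ with $\sum_n\gamma_n|c_n|^2<\infty$, $\gamma_n=\int_0^1t^n\omega(t)\,dt$. The subspace ${^cA}^{2,\omega}_{slice}$ carries the inner product $\langle\cdot,\cdot\rangle_\omega$. $L^{2,\alpha}_{\mathbb{H}}(\mathbb{R}^+)=L^2_{\mathbb{H}}(\mathbb{R}^+,x^\alpha e^{-x}dx)$ is the right quaternionic Hilbert space of $\mathbb{H}$-valued functions on $(0,+\infty)$ square integrable for $x^\alpha e^{-x}dx$. $L_n^{(\alpha)}$ are the generalized Laguerre polynomials and $\varphi_n^\alpha=\left(\frac{n!}{\Gamma(\alpha+n+1)}\right)^{1/2}L_n^{(\alpha)}$. For $q\in\mathbb{B}$ and $x,y\ge0$, $$R_q^\alpha(x,y)=\frac{1}{(1-q)\sqrt{qxy}^{\,\alpha}}\exp\left(-\frac{q(x+y)}{1-q}\right)I_\alpha\left(\frac{2\sqrt{qxy}}{1-q}\right),\qquad I_\alpha(\xi)=\sum_{n=0}^\infty\frac{1}{n!\,\Gamma(\alpha+n+1)}\left(\frac{\xi}{2}\right)^{2n+\alpha},$$ understood (without any choice of square root, and also for $y=0$) as $$R_q^\alpha(x,y)=(1-q)^{-\alpha-1}\exp\left(-\frac{q(x+y)}{1-q}\right)\sum_{n=0}^\infty\frac{(qxy)^n(1-q)^{-2n}}{n!\,\Gamma(\alpha+n+1)},$$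 with the principal branch of the power on the slice containing $q$. (Equivalently $R_q^\alpha(x,y)=\sum_{n\ge0}q^n\varphi_n^\alpha(x)\varphi_n^\alpha(y)$.) The operator $S^\alpha_y$ is $$S^\alpha_y\varphi(q)=\int_0^\infty R_q^\alpha(x,y)\,\varphi(x)\,x^\alpha e^{-x}\,dx,\qquad q\in\mathbb{B}.$$ *)

(* Defs.v *)
From HB Require Import structures.
From mathcomp Require Import all_boot all_order all_algebra.
From mathcomp Require Import all_classical all_reals all_analysis.
From mathcomp Require Import ring lra.

Set Implicit Arguments.
Unset Strict Implicit.
Unset Printing Implicit Defensive.

Import Order.TTheory GRing.Theory Num.Theory.
Import numFieldNormedType.Exports.

Local Open Scope classical_set_scope.
Local Open Scope ring_scope.

(* The quaternion a + bi + cj + dk is the row (a, b, c, d).  The topology and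
   the real vector space structure are those of 'rV[R]_4; the library norm on
   'rV[R]_4 is the sup norm, so the quaternionic modulus is [qnorm], NOT `|q|
   (the two norms are equivalent, hence limits and derivatives agree). *)
Definition quat (R : realType) : Type := 'rV[R]_4.

HB.instance Definition _ (R : realType) :=
  NormedModule.on (quat R).
HB.instance Definition _ (R : realType) := Complete.on (quat R).

Section Quaternions.
Variable R : realType.
Implicit Types p q r : quat R.

Definition mkquat (a b c d : R) : quat R :=
  \row_(i < 4) nth 0 [:: a; b; c; d] i.

Definition q0 q : R := (q : 'rV[R]_4) 0 (inord 0).
Definition q1 q : R := (q : 'rV[R]_4) 0 (inord 1).
Definition q2 q : R := (q : 'rV[R]_4) 0 (inord 2).
Definition q3 q : R := (q : 'rV[R]_4) 0 (inord 3).

Definition qmul p q : quat R :=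
  mkquat (q0 p * q0 q - q1 p * q1 q - q2 p * q2 q - q3 p * q3 q)
         (q0 p * q1 q + q1 p * q0 q + q2 p * q3 q - q3 p * q2 q)
         (q0 p * q2 q - q1 p * q3 q + q2 p * q0 q + q3 p * q1 q)
         (q0 p * q3 q + q1 p * q2 q - q2 p * q1 q + q3 p * q0 q).

Definition qconj q : quat R := mkquat (q0 q) (- q1 q) (- q2 q) (- q3 q).

Definition qnorm q : R :=
  Num.sqrt (q0 q ^+ 2 + q1 q ^+ 2 + q2 q ^+ 2 + q3 q ^+ 2).

Definition qinv q : quat R := (qnorm q ^- 2) *: qconj q.

Lemma quatP p q :
  q0 p = q0 q -> q1 p = q1 q -> q2 p = q2 q -> q3 p = q3 q -> p = q.
Proof.
rewrite /q0 /q1 /q2 /q3 => h0 h1 h2 h3; apply/rowP => i.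
have -> : i = inord (val i) by apply: val_inj; rewrite /= inordK.
by case: i => [[|[|[|[|//]]]] ?].
Qed.

Lemma mkquatE a b c d : (q0 (mkquat a b c d) = a) * (q1 (mkquat a b c d) = b) *
  (q2 (mkquat a b c d) = c) * (q3 (mkquat a b c d) = d).
Proof. by rewrite /q0 /q1 /q2 /q3 /mkquat !mxE !inordK. Qed.

Lemma quatDE p q : (q0 (p + q) = q0 p + q0 q) * (q1 (p + q) = q1 p + q1 q) *
  (q2 (p + q) = q2 p + q2 q) * (q3 (p + q) = q3 p + q3 q).
Proof. by rewrite /q0 /q1 /q2 /q3 !mxE. Qed.

Lemma quatZE a q : (q0 (a *: q) = a * q0 q) * (q1 (a *: q) = a * q1 q) *
  (q2 (a *: q) = a * q2 q) * (q3 (a *: q) = a * q3 q).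
Proof. by rewrite /q0 /q1 /q2 /q3 !mxE. Qed.

Lemma quat0E : (q0 0 = 0) * (q1 0 = 0) * (q2 0 = 0) * (q3 0 = 0).
Proof. by rewrite /q0 /q1 /q2 /q3 !mxE. Qed.

Definition quatE := (mkquatE, quatDE, quatZE, quat0E).

Lemma qmulA : associative qmul.
Proof. by move=> p q r; apply: quatP; rewrite /qmul !quatE; ring. Qed.

Lemma qmul1l : left_id (mkquat 1 0 0 0) qmul.
Proof. by move=> q; apply: quatP; rewrite /qmul !quatE; ring. Qed.

Lemma qmul1r : right_id (mkquat 1 0 0 0) qmul.
Proof. by move=> q; apply: quatP; rewrite /qmul !quatE; ring. Qed.

Lemma qmulDl : left_distributive qmul +%R.
Proof. by move=> p q r; apply: quatP; rewrite /qmul !quatE; ring. Qed.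

Lemma qmulDr : right_distributive qmul +%R.
Proof. by move=> p q r; apply: quatP; rewrite /qmul !quatE; ring. Qed.

Lemma quat1_neq0 : mkquat 1 0 0 0 != 0.
Proof.
apply/eqP => /(congr1 q0); rewrite !quatE; apply/eqP; exact: oner_neq0.
Qed.

HB.instance Definition _ := GRing.Zmodule_isNzRing.Build (quat R)
  qmulA qmul1l qmul1r qmulDl qmulDr quat1_neq0.

Lemma qscaleAl (a : R) p q : a *: (p * q) = (a *: p) * q.
Proof.
by rewrite /GRing.mul /=; apply: quatP; rewrite /qmul !quatE; ring.
Qed.

Lemma qscaleAr (a : R) p q : a *: (p * q) = p * (a *: q).
Proof.
by rewrite /GRing.mul /=; apply: quatP; rewrite /qmul !quatE; ring.
Qed.

HB.instance Definition _ := GRing.Lmodule_isLalgebra.Build R (quat R) qscaleAl.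
HB.instance Definition _ := GRing.Lalgebra_isAlgebra.Build R (quat R) qscaleAr.

Lemma qnorm_sqr q :
  qnorm q ^+ 2 = q0 q ^+ 2 + q1 q ^+ 2 + q2 q ^+ 2 + q3 q ^+ 2.
Proof. by rewrite sqr_sqrtr // !addr_ge0 ?sqr_ge0. Qed.

Lemma qnorm_sqr_neq0 q : q != 0 -> qnorm q ^+ 2 != 0.
Proof.
apply: contra_neq; rewrite qnorm_sqr => h.
by apply: quatP; rewrite !quatE; nra.
Qed.

Lemma qmulVq : {in [pred q : quat R | q != 0], left_inverse 1 qinv *%R}.
Proof.
move=> q /qnorm_sqr_neq0 h; rewrite /qinv -qscaleAl.
apply: (scalerI h); rewrite scalerA mulfV // scale1r qnorm_sqr.
by rewrite /GRing.mul /GRing.one /=; apply: quatP;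
  rewrite /qmul /qconj !quatE /=; ring.
Qed.

Lemma qmulqV : {in [pred q : quat R | q != 0], right_inverse 1 qinv *%R}.
Proof.
move=> q /qnorm_sqr_neq0 h; rewrite /qinv -qscaleAr.
apply: (scalerI h); rewrite scalerA mulfV // scale1r qnorm_sqr.
by rewrite /GRing.mul /GRing.one /=; apply: quatP;
  rewrite /qmul /qconj !quatE /=; ring.
Qed.

Lemma qunitP p q : q * p = 1 /\ p * q = 1 -> p != 0.
Proof.
by case=> _ h; apply/eqP => p0; move/eqP: h; rewrite p0 mul0r eq_sym oner_eq0.
Qed.

Lemma qinv_out : {in [predC [pred q : quat R | q != 0]], qinv =1 id}.
Proof.
move=> q; rewrite !inE negbK => /eqP ->.
by apply: quatP; rewrite /qinv /qconj !quatE ?oppr0 mulr0.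
Qed.

HB.instance Definition _ := GRing.NzRing_hasMulInverse.Build (quat R)
  qmulVq qmulqV qunitP qinv_out.

End Quaternions.

Arguments q0 {R}. Arguments q1 {R}. Arguments q2 {R}. Arguments q3 {R}.

Section SliceAnalysis.
Variable R : realType.
Implicit Types (p q J I : quat R) (f g phi : quat R -> quat R).

Definition qball : set (quat R) := [set q | qnorm q < 1].

Definition qsphere : set (quat R) := [set q | q ^+ 2 = -1].

Definition slice_pt I (x y : R) : quat R := x%:A + y *: I.

(* [qim q] is the vector part of q; [qdir q] is the J in S with
   q = x + J y, y > 0, and 0 (an irrelevant value) when q is real. *)
Definition qim q : quat R := q - (q0 q)%:A.
Definition qdir q : quat R := (qnorm (qim q))^-1 *: qim q.

(* exp (x + J y) = e^x (cos y + J sin y) *)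
Definition qexp q : quat R :=
  expR (q0 q) *:
    ((cos (qnorm (qim q)))%:A + sin (qnorm (qim q)) *: qdir q).

(* Principal power p^s = |p|^s (cos (s th) + J sin (s th)) in the slice C_J of
   p, where th = arg p in [0, pi[ for the choice of J with y >= 0; this is the
   principal branch for p off the half-line ]-oo, 0]. *)
Definition qpow p (s : R) : quat R :=
  let th := acos (q0 p / qnorm p) in
  (qnorm p `^ s) *: ((cos (s * th))%:A + sin (s * th) *: qdir p).

Definition slice_regular f : Prop :=
  (forall q, qball q -> differentiable f q) /\
  (forall J x y, qsphere J -> qball (slice_pt J x y) ->
    (2^-1 : R) *: (derive1 (fun s : R => f (slice_pt J s y)) x
                   + J * derive1 (fun t : R => f (slice_pt J x t)) y) = 0).

Definition qmeasurable d (T : measurableType d) (D : set T)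
    (h : T -> quat R) : Prop :=
  [/\ measurable_fun D (q0 \o h), measurable_fun D (q1 \o h),
      measurable_fun D (q2 \o h) & measurable_fun D (q3 \o h)].

Definition qintegral d (T : measurableType d)
    (mu : {measure set T -> \bar R}) (D : set T) (h : T -> quat R) : quat R :=
  mkquat (\int[mu]_(z in D) q0 (h z)) (\int[mu]_(z in D) q1 (h z))
         (\int[mu]_(z in D) q2 (h z)) (\int[mu]_(z in D) q3 (h z)).

Definition leb : {measure set (measurableTypeR R) -> \bar R} := @lebesgue_measure R.
Definition leb2 :
    {measure set (measurableTypeR R * measurableTypeR R) -> \bar R} :=
  (@lebesgue_measure R \x @lebesgue_measure R)%E.

(* Coordinates (x, y) of the points x + I y of the disc B_I. *)
Definition disc : set (R * R) := [set z | z.1 ^+ 2 + z.2 ^+ 2 < 1].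

Definition slice_ip (omega : R -> R) I f g : quat R :=
  qintegral leb2 disc (fun z =>
    omega (z.1 ^+ 2 + z.2 ^+ 2) *:
      (qconj (f (slice_pt I z.1 z.2)) * g (slice_pt I z.1 z.2))).

Definition slice_Bergman (omega : R -> R) I : set (quat R -> quat R) :=
  [set f | [/\ slice_regular f,
     qmeasurable disc (fun z => f (slice_pt I z.1 z.2)) &
     (\int[leb2]_(z in disc)
        (qnorm (f (slice_pt I z.1 z.2)) ^+ 2
           * omega (z.1 ^+ 2 + z.2 ^+ 2))%:E < +oo)%E]].

Definition Gamma (s : R) : R :=
  \int[leb]_(t in `]0, +oo[) (t `^ (s - 1) * expR (- t)).

Definition gbinom (a : R) (m : nat) : R :=
  (\prod_(i < m) (a - i%:R)) / m`!%:R.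

(* L_n^(alpha)(x) = sum_(k <= n) (-1)^k binom(n + alpha, n - k) x^k / k! *)
Definition laguerre (alpha : R) (n : nat) : {poly R} :=
  \poly_(k < n.+1) ((-1) ^+ k * gbinom (n%:R + alpha) (n - k) / k`!%:R).

(* ((1 - q) sqrt(q x y)^alpha)^-1 exp(- q (x + y) / (1 - q))
   I_alpha (2 sqrt(q x y) / (1 - q)), I_alpha the modified Bessel function,
   with the powers of sqrt(q x y) cancelled against those in the Bessel series,
   so that no square root of q is chosen and x y = 0 is allowed.  All factors
   lie in one slice C_J, hence commute. *)
Definition Rker (alpha : R) q (x y : R) : quat R :=
  qpow (1 - q) (- alpha - 1) * qexp (- ((x + y) *: (q / (1 - q)))) *
  limn (series (fun n : nat => (n`!%:R * Gamma (alpha + n%:R + 1))^-1 *: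
          (((x * y) *: q) ^+ n * (1 - q) ^- (2 * n)))).

Definition laguerre_L2 (alpha : R) : set (R -> quat R) :=
  [set phi : R -> quat R | qmeasurable (`]0, +oo[ : set R) phi /\
     (\int[leb]_(x in `]0%R, +oo[)
        (qnorm (phi x) ^+ 2 * (x `^ alpha * expR (- x)))%:E < +oo)%E].

Definition Sop (alpha y : R) (phi : R -> quat R) q : quat R :=
  qintegral leb `]0, +oo[ (fun x =>
    (x `^ alpha * expR (- x)) *: (Rker alpha q x y * phi x)).

(* Functions on the ball are represented by functions on all quaternions, of
   which only the values on the ball matter. *)
Definition cBergman (alpha y : R) : set (quat R -> quat R) :=
  [set f : quat R -> quat R | exists2 phi, laguerre_L2 alpha phi &
     forall q, qball q -> f q = Sop alpha y phi q].

(* A family (e n), n in N, of nonzero, pairwise orthogonal elements of the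
   right quaternionic inner product space V, whose right linear span is dense
   in V for the norm of V. *)
Definition complete_orthogonal_system (V : set (quat R -> quat R))
    (ip : (quat R -> quat R) -> (quat R -> quat R) -> quat R)
    (N : set nat) (e : nat -> quat R -> quat R) : Prop :=
  [/\ forall n, N n -> V (e n) /\ ip (e n) (e n) != 0,
      forall m n, N m -> N n -> m <> n -> ip (e m) (e n) = 0 &
      forall f (eps : R), V f -> 0 < eps ->
        exists (s : seq nat) (c : nat -> quat R),
          (forall n, n \in s -> N n) /\
          let g := fun q => f q - \sum_(n <- s) e n q * c n in
          Num.sqrt (q0 (ip g g)) < eps].

End SliceAnalysis.

Arguments leb {R}. Arguments leb2 {R}. Arguments disc {R}.

(* Main.v *)
(* Hille-Hardy expansion: R_q(x, y) = sum_n q^n L_n(x) L_n(y) / h_n with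
   h_n = Gamma(alpha + n + 1) / n!.  It follows from the polynomial identity
   L_m(x) L_m(y) / h_m = sum_n (x y)^n L_(m-n)^(alpha + 2n)(x + y) / (n! Gamma(alpha + n + 1)),
   whose two sides solve the same Laguerre equation in x, and from the
   generating function of the L_m^(b), a first order equation in q.
   Orthogonality of the L_n in the weight x^alpha e^-x and Fatou's lemma then
   bound the distance of S phi(q) to sum_(n < N) q^n c_n, c_n = L_n(y) / h_n <L_n, phi>,
   by |phi| times the N-th tail of R_(|q|^2)(y, y).  This bound gives slice
   regularity, the inclusion in the Bergman space and, by dominated convergence
   against R_(|q|^2)(y, y) omega(|q|^2), density of the q^n with L_n(y) <> 0;
   each such q^n is S phi for a multiple phi of L_n.  The q^n are orthogonal
   because the weight is invariant under rotations of the slice. *)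
From HB Require Import structures.
Require Import Defs.
From mathcomp Require Import all_boot all_order all_algebra.
From mathcomp Require Import all_classical all_reals all_analysis.
From mathcomp Require Import measurable_realfun.
From mathcomp Require Import ring lra zify.

Set Implicit Arguments.
Unset Strict Implicit.
Unset Printing Implicit Defensive.

Import Order.TTheory GRing.Theory Num.Theory.
Import numFieldNormedType.Exports.

Local Open Scope classical_set_scope.
Local Open Scope ring_scope.


(** Slices are handled in real coordinates: a power series on C_J is a pair of real series in the
    real and imaginary parts of (u + iv)^m, and the generating function is evaluated along the
    segment t -> t (u + iv), 0 <= t <= 1, where it solves a real differential system. Branches enter
    only in the final comparison with [qpow], at the point 1 - q of positive real part. Convergence
    is controlled by the values L_n^(b)(-z): all terms of the polynomial are nonnegative there, they
    majorise |L_n^(b)(z)|, and their recurrences bound them by M r^(-n) for each 0 < r < 1. The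
    distance estimate has the form |S phi(q) - partial sum|^2 <= 4 |phi|^2 tail(|q|^2); the factor 4
    comes from applying Cauchy-Schwarz to each quaternionic coordinate. The set N_y enters through
    R_(|q|^2)(y, y): when L_n(y) <> 0 it dominates a positive multiple of |q|^(2n), which makes q^n
    square integrable, and when L_n(y) = 0 the coefficient c_n vanishes. *)

(** * Algebra of the Laguerre polynomials *)

Section Laguerre.
Variable R : realType.
Implicit Types (a b : R) (n m k : nat) (p : {poly R}).

Lemma gbinom0 a : gbinom a 0 = 1.
Proof. by rewrite /gbinom big_ord0 fact0 divr1. Qed.

Lemma gbinomS a m : m.+1%:R * gbinom a m.+1 = gbinom a m * (a - m%:R).
Proof.
rewrite /gbinom big_ord_recr /= factS natrM invfM.
rewrite [LHS](_ : _ = (m.+1%:R * m.+1%:R^-1) *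
  ((\prod_(i < m) (a - i%:R)) * (a - m%:R)) * m`!%:R^-1); last by ring.
by rewrite mulfV ?pnatr_eq0 // mul1r mulrAC.
Qed.

Lemma gbinom_succ a m : m.+1%:R * gbinom (a + 1) m.+1 = (a + 1) * gbinom a m.
Proof.
rewrite /gbinom big_ord_recl /= factS natrM invfM subr0.
under eq_bigr => i _ do
  rewrite /bump /= add1n -natr1 opprD addrACA subrr addr0.
rewrite [LHS](_ : _ = (m.+1%:R * m.+1%:R^-1) *
  ((a + 1) * \prod_(i < m) (a - i%:R)) * m`!%:R^-1); last by ring.
by rewrite mulfV ?pnatr_eq0 // mul1r mulrA.
Qed.

Lemma gbinom_pascal a m : gbinom (a + 1) m.+1 = gbinom a m.+1 + gbinom a m.
Proof.
apply: (@mulfI _ m.+1%:R); first by rewrite pnatr_eq0.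
rewrite gbinom_succ mulrDr gbinomS -natr1; ring.
Qed.

Lemma coef_laguerre b n k : (laguerre b n)`_k =
  if (k <= n)%N then (-1) ^+ k * gbinom (n%:R + b) (n - k) / k`!%:R else 0.
Proof. by rewrite coef_poly ltnS. Qed.

Lemma laguerre0 b : laguerre b 0 = 1.
Proof.
apply/polyP => k; rewrite coef_laguerre coef1 leqn0.
by case: eqP => // ->; rewrite subnn gbinom0 fact0 expr0 mulr1 divr1.
Qed.

Lemma deriv_laguerre b n : (laguerre b n.+1)^`() = - laguerre (b + 1) n.
Proof.
apply/polyP => k; rewrite coef_deriv coefN !coef_laguerre ltnS subSS.
case: leqP => _; last by rewrite mul0rn oppr0.
rewrite factS natrM invfM exprS -[LHS]mulr_natr.
have -> : n.+1%:R + b = n%:R + (b + 1) by rewrite -natr1; ring.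
rewrite [LHS](_ : _ = - (((-1) ^+ k * gbinom (n%:R + (b + 1)) (n - k) *
  k`!%:R^-1) * (k.+1%:R * k.+1%:R^-1))); last by ring.
by rewrite mulfV ?pnatr_eq0 // mulr1.
Qed.

Lemma laguerre_pascal b n :
  laguerre (b + 1) n.+1 = laguerre b n.+1 + laguerre (b + 1) n.
Proof.
apply/polyP => k; rewrite coefD !coef_laguerre; case: ltngtP => // hk.
- rewrite ifT; last by rewrite -ltnS.
  by rewrite subSn // addrA gbinom_pascal -natr1 [b + 1]addrC addrA; ring.
- by rewrite leqNgt (ltn_trans _ hk) // addr0.
- by rewrite hk subnn !gbinom0 leqNgt ltnSn addr0.
Qed.

(** This is the Laguerre equation, coefficient by coefficient, with denominators cleared. *)
Lemma coef_laguerreS b n k :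
  k.+1%:R * (b + k.+1%:R) * (laguerre b n)`_k.+1 =
  (k%:R - n%:R) * (laguerre b n)`_k.
Proof.
rewrite !coef_laguerre; case: (ltngtP k n) => hk; last 2 first.
- by rewrite !mulr0.
- by rewrite hk subrr mul0r mulr0.
case: n hk => // n; rewrite ltnS => hk.
rewrite subSS subSn // exprS factS natrM invfM.
have h := gbinomS (n.+1%:R + b) (n - k).
rewrite [RHS](_ : _ = - ((-1) ^+ k * k`!%:R^-1) *
  ((n - k).+1%:R * gbinom (n.+1%:R + b) (n - k).+1)); last first.
  rewrite -[(n - k).+1%:R]natr1 natrB // -[n.+1%:R]natr1; ring.
rewrite h natrB //.
rewrite [LHS](_ : _ = (k.+1%:R * k.+1%:R^-1) * ((b + k.+1%:R) * - (-1) ^+ k *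
   gbinom (n.+1%:R + b) (n - k) * k`!%:R^-1)); last by ring.
by rewrite mulfV ?pnatr_eq0 // mul1r -[n.+1%:R]natr1 -[k.+1%:R]natr1; ring.
Qed.

(** The Laguerre operator; L_n^(a) is its eigenvector for the eigenvalue -n. *)
Definition lagD a p : {poly R} := 'X * p^`()^`() + ((a + 1)%:P - 'X) * p^`().

Lemma coef_lagD a p k :
  (lagD a p)`_k = k.+1%:R * (a + k.+1%:R) * p`_k.+1 - k%:R * p`_k.
Proof.
rewrite /lagD mulrBl !(coefD, coefN, coefCM, coefXM).
case: k => [|k] /=; rewrite !coef_deriv; first by rewrite mulr1n; ring.
rewrite -[p`_k.+2 *+ _]mulr_natr -[_ * _ *+ _]mulr_natr.
rewrite -[p`_k.+1 *+ _]mulr_natr -[k.+2%:R]natr1.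
ring.
Qed.

Lemma laguerre_ode b n : lagD b (laguerre b n) = - (n%:R *: laguerre b n).
Proof.
by apply/polyP => k; rewrite coef_lagD coef_laguerreS coefN coefZ; ring.
Qed.

(** In the Laguerre equation for L_(n+1)^(b) the derivatives are shifted polynomials, and
    [laguerre_pascal] merges the two terms carrying z. The result drives both the growth bound and
    the derivative of the generating series. *)
Lemma laguerre_pred_le b n z :
  n.+1%:R * (laguerre b n.+1).[z] =
  (b + 1) * (laguerre (b + 1) n).[z] - z * (laguerre (b + 2) n).[z].
Proof.
have h1 := congr1 (fun p => p.[z]) (laguerre_ode b n.+1).
move: h1; rewrite /lagD !deriv_laguerre !derivN !hornerE.
have e2 : b + 2 = b + 1 + 1 by ring.
case: n => [|n].
  by rewrite !laguerre0 -[1 : {poly R}]/(1%:P) derivC !hornerE => h1; lra.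
rewrite deriv_laguerre !hornerE.
have h3 := congr1 (fun p => p.[z]) (laguerre_pascal (b + 1) n).
rewrite -e2 !hornerE in h3 *; rewrite h3 => h1; lra.
Qed.

Lemma gbinom_gt0 a m : m%:R - 1 < a -> 0 < gbinom a m.
Proof.
move=> h; rewrite divr_gt0 ?ltr0n ?fact_gt0 //; apply: prodr_gt0 => i _.
rewrite subr_gt0; apply: le_lt_trans h.
by rewrite lerBrDr natr1 ler_nat.
Qed.

Lemma laguerre_coef_gt0 b n k : -1 < b -> (k <= n)%N ->
  0 < gbinom (n%:R + b) (n - k) / k`!%:R.
Proof.
move=> hb hk; rewrite divr_gt0 ?ltr0n ?fact_gt0 // gbinom_gt0 // natrB //.
have : 0 <= k%:R :> R by [].
lra.
Qed.

Lemma laguerre_neg b n z :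
  (laguerre b n).[- z] =
  \sum_(k < n.+1) gbinom (n%:R + b) (n - k) / k`!%:R * z ^+ k.
Proof.
rewrite (@horner_coef_wide _ n.+1) ?size_poly //; apply: eq_bigr => k _.
rewrite coef_laguerre -ltnS ltn_ord (exprNn z).
rewrite [LHS](_ : _ = ((-1) ^+ k * (-1) ^+ k) *
  (gbinom (n%:R + b) (n - k) / k`!%:R * z ^+ k)); last by ring.
by rewrite -exprD addnn -mul2n exprM sqrrN !expr1n mul1r.
Qed.

Lemma laguerre_neg_ge0 b n z : -1 < b -> 0 <= z -> 0 <= (laguerre b n).[- z].
Proof.
move=> hb hz; rewrite laguerre_neg; apply: sumr_ge0 => k _.
by rewrite mulr_ge0 ?exprn_ge0 // ltW // laguerre_coef_gt0 // -ltnS.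
Qed.

(** The coefficients alternate in sign, so at -z all terms become nonnegative and their sum is the
    bound given by the triangle inequality. It obeys the same recurrences as the polynomials, which
    makes it a convenient majorant. *)
Lemma normr_laguerre b n z : -1 < b -> 0 <= z ->
  `|(laguerre b n).[z]| <= (laguerre b n).[- z].
Proof.
move=> hb hz; rewrite -{1}[z]opprK !laguerre_neg.
apply: le_trans (ler_norm_sum _ _ _) _; apply: ler_sum => k _.
rewrite normrM ger0_norm; last by rewrite ltW // laguerre_coef_gt0 // -ltnS.
rewrite normrX normrN (ger0_norm hz) //.
Qed.

Lemma laguerre_at0 b n : (laguerre b n).[0] = gbinom (n%:R + b) n.
Proof.
by rewrite horner_coef0 coef_laguerre /= subn0 fact0 divr1 expr0 mul1r.
Qed.

End Laguerre.

Lemma addr_nat1_gt0 (R : realType) (a : R) k : -1 < a -> 0 < a + k.+1%:R.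
Proof. by move=> ha; rewrite -natr1 addrCA ltr_wpDl ?ler0n //; lra. Qed.

(** * Orthogonality in terms of moments *)

Section MomentFunctional.
Variable R : realType.
Implicit Types (a b : R) (n m k : nat) (p q : {poly R}) (mu : nat -> R).

(** Integration against x^a e^-x in algebraic form: [mu k] stands for the k-th moment, and
    orthogonality uses only the recurrence of the moments. Shifting [mu] by one replaces a by a +
    1. *)
Definition moment mu p : R := \sum_(i < size p) p`_i * mu i.

Lemma moment_wide mu p n : (size p <= n)%N -> moment mu p = \sum_(i < n) p`_i * mu i.
Proof.
move=> h; rewrite /moment -!(big_mkord xpredT (fun i => p`_i * mu i)).
rewrite [RHS](@big_cat_nat _ _ _ (size p)) //= [X in _ + X]big_nat_cond.
rewrite [X in _ + X]big1 ?addr0 // => i /andP[/andP[hi _] _].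
by rewrite nth_default // mul0r.
Qed.

Lemma momentD mu p q : moment mu (p + q) = moment mu p + moment mu q.
Proof.
have h1 := leq_maxl (size p) (size q); have h2 := leq_maxr (size p) (size q).
rewrite (moment_wide mu h1) (moment_wide mu h2).
rewrite (@moment_wide mu (p + q) _ (size_polyD p q)) -big_split /=.
by apply: eq_bigr => i _; rewrite coefD mulrDl.
Qed.

Lemma momentZ mu a p : moment mu (a *: p) = a * moment mu p.
Proof.
rewrite (@moment_wide mu (a *: p) (size p)) ?size_scale_leq // mulr_sumr.
by apply: eq_bigr => i _; rewrite coefZ mulrA.
Qed.

Lemma moment0 mu : moment mu 0 = 0.
Proof. by rewrite -(scale0r 0) momentZ mul0r. Qed.

Lemma moment_sum mu n (F : 'I_n -> {poly R}) :
  moment mu (\sum_(i < n) F i) = \sum_(i < n) moment mu (F i).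
Proof. exact: (big_morph _ (momentD mu) (moment0 mu)). Qed.

Lemma momentXn mu k : moment mu 'X^k = mu k.
Proof.
rewrite /moment size_polyXn big_ord_recr /= coefXn eqxx mul1r big1 ?add0r // => i _.
by rewrite coefXn ltn_eqF ?mul0r.
Qed.

Lemma momentMX mu p : moment mu ('X * p) = moment (mu \o S) p.
Proof.
rewrite (@moment_wide mu _ (size p).+1); last first.
  by rewrite (leq_trans (size_polyMleq _ _)) // size_polyX.
rewrite big_ord_recl coefXM mul0r add0r; apply: eq_bigr => i _.
by rewrite coefXM.
Qed.

(* Integration by parts against the weight x^a e^-x: the derivative of
   x^(a+1) e^-x p is x^a e^-x times this polynomial. *)
Lemma moment_parts a mu p : (forall k, mu k.+1 = (a + k.+1%:R) * mu k) ->
  moment mu ('X * p^`() + ((a + 1)%:P - 'X) * p) = 0.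
Proof.
move=> hmu; rewrite -[p]coefK poly_def raddf_sum /=.
rewrite !mulr_sumr -big_split moment_sum big1 // => i _.
rewrite derivZ derivXn -!scalerAr /= -scalerDr momentZ mulrBl mul_polyC -exprS.
case: i => [[|i] hi] /=.
  rewrite mulr0n mulr0 add0r momentD -scaleN1r !momentZ !momentXn hmu; ring.
rewrite mulrnAr -exprS.
rewrite !momentD -scaler_nat -scaleN1r !momentZ !momentXn (hmu i.+1) -[i.+2%:R]natr1; ring.
Qed.

(** Self-adjointness: integrating f' g - f g' by parts gives [lagD a f * g - f * lagD a g], hence (n
    - m) times the moment of f g. *)
Lemma moment_laguerre_orth a mu m n : (forall k, mu k.+1 = (a + k.+1%:R) * mu k) ->
  m != n -> moment mu (laguerre a m * laguerre a n) = 0.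
Proof.
move=> hmu hmn; set f := laguerre a m; set g := laguerre a n.
have hf : lagD a f = - (m%:R *: f) by exact: laguerre_ode.
have hg : lagD a g = - (n%:R *: g) by exact: laguerre_ode.
have := moment_parts (f^`() * g - f * g^`()) hmu.
rewrite (_ : _ + _ = lagD a f * g - f * lagD a g); last first.
  by rewrite /lagD !poly.derivE; ring.
rewrite hf hg mulNr mulrN opprK -scalerAl -scalerAr addrC -scalerBl momentZ.
move/eqP; rewrite mulf_eq0 => /orP[|/eqP //].
by rewrite subr_eq0 eqr_nat eq_sym (negbTE hmn).
Qed.

(** Integrating f' f by parts for f = L_(n+1)^(a) gives (n + 1) <f, f> = <x f', f'>. Since f' = -
    L_n^(a+1) and the factor x shifts the moments to those of a + 1, the induction changes a. *)
Lemma moment_laguerre_sqr n a mu : (forall k, mu k.+1 = (a + k.+1%:R) * mu k) ->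
  moment mu (laguerre a n * laguerre a n) = mu n / n`!%:R.
Proof.
elim: n a mu => [|n IH] a mu hmu.
  by rewrite laguerre0 mulr1 -(momentXn mu 0) expr0 fact0 divr1.
set f := laguerre a n.+1.
have hf : lagD a f = - (n.+1%:R *: f) by exact: laguerre_ode.
have := moment_parts (f^`() * f) hmu.
rewrite (_ : _ + _ = lagD a f * f + 'X * (f^`() * f^`())); last first.
  by rewrite /lagD !poly.derivE; ring.
rewrite hf momentD momentMX mulNr -scaleN1r -scalerAl !momentZ.
rewrite deriv_laguerre mulrNN (IH (a + 1)) => [/=|k]; last first.
  by rewrite /= hmu -[k.+2%:R]natr1; ring.
move=> h; apply: (@mulfI _ n.+1%:R); first by rewrite pnatr_eq0.
rewrite factS natrM invfM [RHS](_ : _ = (n.+1%:R * n.+1%:R^-1) *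
  (mu n.+1 * n`!%:R^-1)); last by ring.
by rewrite mulfV ?pnatr_eq0 // mul1r; lra.
Qed.

End MomentFunctional.

(** * Coefficient form of the Hille-Hardy formula *)

Section HardyHilleCoefficients.
Variable R : realType.
Variables (a y : R) (nu : nat -> R).
Hypothesis a_gt : -1 < a.
Hypothesis nu0 : 0 < nu 0.
Hypothesis nuS : forall k, nu k.+1 = (a + k.+1%:R) * nu k.
Implicit Types (n m k : nat) (p : {poly R}).

Lemma nu_gt0 k : 0 < nu k.
Proof.
by elim: k => // k IH; rewrite nuS; apply: mulr_gt0 => //; apply: addr_nat1_gt0.
Qed.

(** The equation determines the coefficient k + 1 from the coefficient k, because (k + 1)(a + k + 1)
    > 0 when a > -1; the value at 0 therefore fixes the solution. *)
Lemma lagD_uniq m p : lagD a p = - (m%:R *: p) -> p`_0 = 0 -> p = 0.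
Proof.
move=> hp h0; apply/polyP => k; rewrite coef0; elim: k => // k IH.
have := congr1 (fun p : {poly R} => p`_k) hp.
rewrite coef_lagD coefN coefZ IH !mulr0 subr0 oppr0 => /eqP.
rewrite !mulf_eq0 pnatr_eq0 /= => /orP[/eqP h|/eqP //].
by have := addr_nat1_gt0 k a_gt; rewrite h ltxx.
Qed.

Definition hh_shift m n : {poly R} :=
  laguerre (a + (2 * n)%:R) (m - n) \Po ('X + y%:P).

Definition hh_poly m : {poly R} :=
  \sum_(n < m.+1) (y ^+ n / (n`!%:R * nu n)) *: ('X^n * hh_shift m n).

Lemma horner_hh_poly m x : (hh_poly m).[x] =
  \sum_(n < m.+1) (x * y) ^+ n / (n`!%:R * nu n) *
     (laguerre (a + (2 * n)%:R) (m - n)).[x + y].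
Proof.
rewrite horner_sum; apply: eq_bigr => n _.
rewrite /hh_shift !hornerE horner_comp !hornerE exprMn /=; ring.
Qed.

(** With theta = x d/dx, conjugation by x^n turns theta into theta + n. The extra factor ['X] avoids
    the exponent n - 1. *)
Let thetaXn n p : 'X * ('X^n * p)^`() = 'X^n * (n%:R *: p + 'X * p^`()).
Proof.
rewrite derivM derivXn mulrDr scaler_nat; case: n => [|n].
  by rewrite !mulr0n !expr0; ring.
by rewrite mulrA mulrnAr -exprS; ring.
Qed.

Let deriv_comp_shift p : (p \Po ('X + y%:P))^`() = p^`() \Po ('X + y%:P).
Proof. by rewrite deriv_comp derivD derivX derivC addr0 mulr1. Qed.

(** The factor g solves the Laguerre equation of parameter a + 2n in the variable x + y. Using it to
    eliminate x g'' leaves n (n + a) g and a remainder carrying y, which the summand n + 1 of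
    [hh_poly] cancels. The prefactor ['X] clears the lowered power of x that differentiating x^n
    produces. *)
Lemma lagD_hh_shift m n : (n <= m)%N ->
  'X * (lagD a ('X^n * hh_shift m n) + m%:R *: ('X^n * hh_shift m n)) =
  'X^n * ((n%:R * (n%:R + a)) *: hh_shift m n +
          y *: ('X * ((hh_shift m n)^`() - (hh_shift m n)^`()^`()))).
Proof.
move=> hn; set g := hh_shift m n; set b := a + (2 * n)%:R.
have ode : ('X + y%:P) * g^`()^`() + ((b + 1)%:P - 'X - y%:P) * g^`() +
    (m%:R - n%:R)%:P * g = 0.
  have := congr1 (fun p => p \Po ('X + y%:P)) (laguerre_ode b (m - n)).
  rewrite /lagD !(comp_polyD, comp_polyB, comp_polyM, raddfN) /=.
  rewrite !comp_polyC !comp_polyX comp_polyZ -mul_polyC natrB //.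
  rewrite /g /hh_shift !deriv_comp_shift -/b.
  by move/eqP; rewrite -addr_eq0 => /eqP <-; ring.
have h1 := thetaXn n g; set u := n%:R *: g + 'X * g^`() in h1.
have h2 := thetaXn n u; rewrite -h1 derivM derivX mul1r mulrDr h1 in h2.
have hu : u^`() = n%:R *: g^`() + g^`() + 'X * g^`()^`().
  by rewrite /u derivD derivZ derivM derivX mul1r addrA.
rewrite /lagD mulrDr mulrDr [_ * (_ * (_ * _)^`())]mulrCA h1.
have -> : 'X * ('X * ('X^n * g)^`()^`()) =
    'X^n * (n%:R *: u + 'X * u^`()) - 'X^n * u by rewrite -h2; ring.
rewrite hu /u -!mul_polyC.
have eg : 'X * ('X * g^`()^`()) = 'X * (- (y%:P * g^`()^`() +
    ((b + 1)%:P - 'X - y%:P) * g^`() + (m%:R - n%:R)%:P * g)).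
  by congr (_ * _); apply/eqP; rewrite -addr_eq0 -ode; apply/eqP; ring.
rewrite !mulrDr eg /b natrM !(polyCD, polyCB, polyCM).
ring.
Qed.

(** Each derivative lowers the degree and raises the parameter by one; Pascal's rule combines the
    two terms into the factor of the next summand. *)
Lemma hh_shift_deriv2 m n : (n < m)%N ->
  (hh_shift m n)^`()^`() - (hh_shift m n)^`() = hh_shift m n.+1.
Proof.
move=> hn; rewrite /hh_shift -(subnSK hn); set b := a + (2 * n)%:R.
have -> : a + (2 * n.+1)%:R = b + 1 + 1.
  by rewrite /b mulnS natrD; ring.
rewrite !deriv_comp_shift -raddfB /= deriv_laguerre derivN.
congr (_ \Po _); case: (m - n.+1)%N => [|k].
  by rewrite !laguerre0 -[1 : {poly R}]/(1%:P) derivC; ring.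
by rewrite deriv_laguerre (laguerre_pascal (b + 1)); ring.
Qed.

Lemma lagD_hh_poly m : lagD a (hh_poly m) = - (m%:R *: hh_poly m).
Proof.
apply/eqP; rewrite -addr_eq0; apply/eqP/(mulfI (negbT (polyX_eq0 R))).
rewrite mulr0.
pose w n := y ^+ n / (n`!%:R * nu n).
(* [u n] is the part of summand n with weight n (n + a). By [wS] the remaining part of summand n is
   minus [u n.+1], so the sum telescopes from [u 0], which is 0. *)
pose u n : {poly R} := (w n * (n%:R * (n%:R + a))) *: ('X^n * hh_shift m n).
have wS n : w n.+1 * (n.+1%:R * (n.+1%:R + a)) = y * w n.
  rewrite /w factS natrM nuS !invfM exprS [_ + a]addrC.
  rewrite [LHS](_ : _ = (n.+1%:R * n.+1%:R^-1) * ((a + n.+1%:R) / (a + n.+1%:R))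
    * (y * (y ^+ n * (n`!%:R^-1 * (nu n)^-1)))); last by ring.
  by rewrite !mulfV ?pnatr_eq0 // ?mul1r // gt_eqF // addr_nat1_gt0.
have hD : lagD a (hh_poly m) + m%:R *: hh_poly m =
    \sum_(n < m.+1) w n *: (lagD a ('X^n * hh_shift m n) +
                            m%:R *: ('X^n * hh_shift m n)).
  rewrite /hh_poly scaler_sumr /lagD !raddf_sum /= !mulr_sumr -!big_split /=.
  apply: eq_bigr => n _; rewrite !derivZ -!mul_polyC /w; ring.
have term n : (n <= m)%N -> 'X * (w n *: (lagD a ('X^n * hh_shift m n) +
    m%:R *: ('X^n * hh_shift m n))) = u n - (if (n < m)%N then u n.+1 else 0).
  move=> hn; rewrite -scalerAr lagD_hh_shift // /u; case: ltnP => hm.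
    rewrite -(hh_shift_deriv2 hm) wS exprS -!mul_polyC !polyCM; ring.
  (* For n = m the factor is the constant 1: its derivatives vanish and nothing is left to
     cancel. *)
  have -> : n = m by apply/eqP; rewrite eqn_leq hn.
  rewrite subr0 /hh_shift subnn laguerre0 comp_polyC derivC deriv0 subr0 mulr0.
  by rewrite scaler0 addr0 -scalerAr scalerA.
rewrite hD mulr_sumr.
rewrite (eq_bigr (fun n : 'I_m.+1 => u n - (if (n < m)%N then u n.+1 else 0)));
  last by move=> n _; apply: term; rewrite -ltnS.
rewrite sumrB big_ord_recl [X in _ - X]big_ord_recr /= ltnn addr0.
have -> : u 0 = 0 by rewrite /u !mul0r mulr0 scale0r.
rewrite add0r; apply/eqP; rewrite subr_eq0; apply/eqP; apply: eq_bigr => i _.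
by rewrite ltn_ord.
Qed.

Lemma fact_gbinom m : m`!%:R * gbinom (m%:R + a) m = nu m / nu 0.
Proof.
elim: m => [|m IH].
  by rewrite fact0 gbinom0 mulr1 divff // gt_eqF.
rewrite factS natrM mulrAC -natr1 addrAC [(m%:R + 1)](natr1) gbinom_succ.
rewrite -mulrA [gbinom _ _ * _]mulrC IH nuS -natr1; ring.
Qed.

Lemma hardy_hille_coef m x :
  m`!%:R / nu m * ((laguerre a m).[x] * (laguerre a m).[y]) =
  \sum_(n < m.+1) (x * y) ^+ n / (n`!%:R * nu n) *
     (laguerre (a + (2 * n)%:R) (m - n)).[x + y].
Proof.
rewrite -horner_hh_poly; pose c := m`!%:R / nu m * (laguerre a m).[y].
suff : hh_poly m - c *: laguerre a m = 0.
  by move/eqP; rewrite subr_eq0 => /eqP ->; rewrite hornerZ /c; ring.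
apply: (@lagD_uniq m).
  have -> : lagD a (hh_poly m - c *: laguerre a m) =
      lagD a (hh_poly m) - c *: lagD a (laguerre a m).
    by rewrite /lagD !(derivB, derivZ) -!mul_polyC; ring.
  by rewrite lagD_hh_poly laguerre_ode scalerBr !scalerA -!mul_polyC; ring.
(* At x = 0 only the summand n = 0 survives, and [fact_gbinom] matches it with the value of L_m^(a)
   there. *)
rewrite coefB coefZ -!horner_coef0 horner_hh_poly laguerre_at0 add0r.
rewrite big_ord_recl /= big1 ?addr0 => [|i _]; last first.
  by rewrite mul0r /bump /= expr0n mul0r mul0r.
rewrite expr0 subn0 fact0 !mul1r /c.
have := fact_gbinom m; have := gt_eqF (nu_gt0 m); have := gt_eqF (nu_gt0 0).
move=> /negbT h0 /negbT hm h.
rewrite [X in _ - X](_ : _ = (m`!%:R * gbinom (m%:R + a) m) / nu m *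
  (laguerre a m).[y]); last by ring.
by rewrite h; field; rewrite h0 hm.
Qed.

End HardyHilleCoefficients.

(** * Finiteness and functional equation of the Gamma integral *)

Section GammaFunction.
Variable R : realType.
Implicit Types (s a x : R).

(** The integrand may be unbounded at 0, so the fundamental theorem is applied on [1/(n + 1), +oo[
    and monotone convergence exhausts the half-line. *)
Lemma ge0_FTC_0y (f F : R -> R) (l0 l : R) :
  (forall x, 0 < x -> 0 <= f x) ->
  (forall x, 0 < x -> {for x, continuous f}) ->
  (forall x, 0 < x -> is_derive x (1 : R) F (f x)) ->
  F x @[x --> 0^'+] --> l0 -> F x @[x --> +oo] --> l ->
  (\int[leb]_(x in `]0%R, +oo[) (f x)%:E = (l - l0)%:E)%E.
Proof.
move=> f0 cf dF F0 Fl.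
pose e n : R := n.+1%:R^-1.
have e_gt0 n : 0 < e n by rewrite invr_gt0 ltr0n.
have piece n : (\int[leb]_(x in `[e n, +oo[) (f x)%:E = (l - F (e n))%:E)%E.
  rewrite EFinB /leb; apply: ge0_continuous_FTC2y => //.
  - by move=> x hx; apply: f0; apply: lt_le_trans hx.
  - apply: continuous_in_subspaceT => x; rewrite inE /= in_itv /= andbT => hx.
    by apply: cf; apply: lt_le_trans hx.
  - move=> x hx; have x0 : 0 < x by apply: lt_trans hx.
    exact: (@ex_derive _ _ _ _ _ _ _ (dF x x0)).
  - apply: cvg_at_right_filter; apply: differentiable_continuous.
    by apply/derivable1_diffP; exact: (@ex_derive _ _ _ _ _ _ _ (dF _ (e_gt0 n))).
  - move=> x; rewrite in_itv /= andbT => hx.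
    have x0 : 0 < x by apply: lt_trans hx.
    by rewrite derive1E; exact: (@derive_val _ _ _ _ _ _ _ (dF x x0)).
have mf : measurable_fun (`]0, +oo[ : set R) f.
  apply: open_continuous_measurable_fun => // x.
  by rewrite inE /= in_itv /= andbT => hx; exact: cf.
have hU : `]0, +oo[%classic = \bigcup_n `[e n, +oo[%classic.
  by rewrite itvoyEbigcup; apply: eq_bigcup => // n _; rewrite add0r.
have sub n : `[e n, +oo[%classic `<=` `]0, +oo[%classic.
  by move=> x /=; rewrite !in_itv /= !andbT; apply: lt_le_trans.
have h2 : (fun n => \int[leb]_(x in `[e n, +oo[) (f x)%:E)%E @ \oo
    --> (l - l0)%:E.
  under eq_fun do rewrite piece.
  apply: cvg_EFin; first by near=> n.
  apply: cvgB; first exact: cvg_cst.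
  have /cvg_at_rightP := F0; apply; split => //.
  exact: cvg_harmonic.
rewrite hU; apply: cvg_unique h2 => //; apply: ge0_nondecreasing_set_cvg_integral.
- move=> m n mn; rewrite subsetEset => x /=; rewrite !in_itv /= !andbT.
  by apply: le_trans; rewrite lef_pV2 ?posrE ?ltr0n // ler_nat ltnS.
- by move=> n; exact: measurable_itv.
- move=> n; apply/measurable_EFinP; apply: measurable_funS mf => //.
- by move=> n x /sub; rewrite /= in_itv /= andbT lee_fin => /f0.
Unshelve. all: by end_near. Qed.

(** Exponentiate s ln t <= s t at t = x / (2 s), which spends half of the decay of e^-x. *)
Lemma powR_expR_le s x : 0 < s -> 0 < x ->
  x `^ s * expR (- x) <= expR (s * ln (2 * s)) * expR (- 2^-1 * x).
Proof.
move=> s0 x0; rewrite /powR gt_eqF // -!expRD ler_expR.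
have h : ln (x / (2 * s)) < x / (2 * s) by apply: ln_sublinear; rewrite divr_gt0 // mulr_gt0.
rewrite ln_div ?posrE ?mulr_gt0 // in h.
have h2 : s * (ln x - ln (2 * s)) < s * (x / (2 * s)) by rewrite ltr_pM2l.
have h3 : s * (x / (2 * s)) = x / 2 by field; rewrite gt_eqF.
by rewrite h3 in h2; rewrite mulNr [2^-1 * x]mulrC; lra.
Qed.

Let gam s x := x `^ (s - 1) * expR (- x).

Lemma measurable_gamma_fun s : measurable_fun (`]0, +oo[ : set R) (gam s).
Proof.
apply: measurable_funTS; apply: measurable_funM; first exact: measurable_powR.
by apply: measurableT_comp => //; exact: measurable_funTS.
Qed.

Let gam_ge0 s x : 0 <= gam s x.
Proof. by rewrite mulr_ge0 ?powR_ge0 ?expR_ge0. Qed.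

(** The derivative s x^(s-1) e^-x - x^s e^-x of x^s e^-x changes sign, while [ge0_FTC_0y] is for
    nonnegative integrands. The exponential [h] that dominates x^s e^-x repairs this: with r = h -
    x^s e^-x >= 0, both s x^(s-1) e^-x + r and x^s e^-x + r are nonnegative with integral 2 C, and
    the finite integral of r cancels. *)
Lemma gamma_rec s : 0 < s ->
  (\int[leb]_(x in `]0%R, +oo[) (gam s x)%:E < +oo)%E /\
  (\int[leb]_(x in `]0%R, +oo[) (gam (s + 1) x)%:E =
   s%:E * \int[leb]_(x in `]0%R, +oo[) (gam s x)%:E)%E.
Proof.
move=> s0; pose C := expR (s * ln (2 * s)).
have C0 : 0 < C by exact: expR_gt0.
pose h x := C * expR (- 2^-1 * x).
pose H x := - (2 * C) * expR (- 2^-1 * x).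
have dH x : is_derive x (1 : R) H (h x).
  have d1 := is_deriveZ (- 2^-1 : R) (is_derive_id x (1 : R)).
  have d2 := is_deriveZ (- (2 * C)) (is_derive1_comp (is_derive_expR _) d1).
  by apply: is_derive_eq d2 _; rewrite /h /GRing.scale /=; field.
pose G t x := x `^ t * expR (- x).
have dG t x : 0 < x -> is_derive x (1 : R) (G t) (t * gam t x - gam (t + 1) x).
  move=> x0.
  have d1 : is_derive x (1 : R) (fun x : R => expR (- x)) (expR (- x) * -1).
    exact: (is_derive1_comp (is_derive_expR _) (is_deriveNid _ _)).
  have d2 := is_deriveM (is_derive1_powR t x0) d1.
  by apply: is_derive_eq d2 _; rewrite /gam addrK /GRing.scale /=; ring.
pose r x := h x - gam (s + 1) x.
have gam1 x : gam (s + 1) x = x `^ s * expR (- x) by rewrite /gam addrK.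
have r_ge0 x : 0 < x -> 0 <= r x.
  by move=> x0; rewrite subr_ge0 gam1; exact: powR_expR_le.
have h_ge0 x : 0 <= h x by rewrite mulr_ge0 ?expR_ge0 ?ltW.
have cH x : {for x, continuous H}.
  apply: differentiable_continuous; apply/derivable1_diffP.
  exact: (@ex_derive _ _ _ _ _ _ _ (dH x)).
have hE x : h x = - 2^-1 * H x by rewrite /h /H; field.
have ch x : {for x, continuous h}.
  rewrite (_ : h = fun x => - 2^-1 * H x); last exact/funext.
  by apply: cvgM; [exact: cvg_cst|exact: cH].
have cgam t x : 0 < x -> {for x, continuous (gam t)}.
  move=> x0; apply: differentiable_continuous; apply/derivable1_diffP.
  exact: (@ex_derive _ _ _ _ _ _ _ (dG (t - 1) x x0)).
have H0 : H x @[x --> 0^'+] --> - (2 * C).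
  have <- : H 0 = - (2 * C) by rewrite /H mulr0 expR0 mulr1.
  by apply: cvg_at_right_filter; exact: cH.
have ey : expR (- 2^-1 * x) @[x --> +oo] --> (0 : R).
  have h1 : (2^-1 * x : R) @[x --> +oo] --> +oo.
    by apply: gt0_cvgMry => //; apply: cvg_id.
  under eq_fun do rewrite mulNr.
  exact: (cvg_comp _ _ h1 (@cvgr_expR R)).
have Hy : H x @[x --> +oo] --> 0.
  by rewrite -[X in _ --> X](mulr0 (- (2 * C))); apply: cvgM => //; exact: cvg_cst.
have hy : h x @[x --> +oo] --> 0.
  by rewrite -[X in _ --> X](mulr0 C); apply: cvgM => //; exact: cvg_cst.
have G0 : G s x @[x --> 0^'+] --> 0.
  rewrite -[X in _ --> X](mul0r (expR (- 0))); apply: cvgM.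
    exact: powR_cvg0.
  apply: cvg_at_right_filter; apply: continuous_comp; last exact: continuous_expR.
  exact: opp_continuous.
have Gy : G s x @[x --> +oo] --> 0.
  apply: (squeeze_cvgr _ (cvg_cst 0) hy); near=> x.
  have x0 : 0 < x by near: x; exact: nbhs_pinfty_gt.
  by rewrite mulr_ge0 ?powR_ge0 ?expR_ge0 //= powR_expR_le.
have inth : (\int[leb]_(x in `]0%R, +oo[) (h x)%:E = (2 * C)%:E)%E.
  rewrite (ge0_FTC_0y (fun x _ => h_ge0 x) (fun x _ => ch x) (fun x _ => dH x) H0 Hy).
  by rewrite sub0r opprK.
have intr : (\int[leb]_(x in `]0%R, +oo[) (s * gam s x + r x)%:E = (2 * C)%:E)%E.
  have -> : 2 * C = 0 + 0 - (0 - 2 * C) by ring.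
  apply: (@ge0_FTC_0y _ (fun x => G s x + H x)).
  - by move=> x x0; rewrite addr_ge0 ?r_ge0 // mulr_ge0 // ltW.
  - move=> x x0; apply: cvgD; first by apply: cvgM; [exact: cvg_cst|exact: cgam].
    by apply: cvgB; [exact: ch|exact: cgam].
  - move=> x x0; apply: is_derive_eq (is_deriveD (dG s x x0) (dH x)) _.
    rewrite /r; ring.
  - by apply: cvgD.
  - by apply: cvgD.
have mgam t := measurable_gamma_fun t.
have mh : measurable_fun (`]0, +oo[ : set R) h.
  by apply: measurable_funTS; apply: continuous_measurable_fun => x; exact: ch.
have mr : measurable_fun (`]0, +oo[ : set R) r.
  exact: measurable_funB.
have pos x : (`]0, +oo[%classic : set R) x -> 0 < x by rewrite /= in_itv /= andbT.
have e1 : (s%:E * (\int[leb]_(x in `]0%R, +oo[) (gam s x)%:E) +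
    (\int[leb]_(x in `]0%R, +oo[) (r x)%:E) = (2 * C)%:E)%E.
  rewrite -intr -ge0_integralZl_EFin //; last 3 first.
  - by move=> x _; rewrite lee_fin; exact: gam_ge0.
  - apply/measurable_EFinP. exact: mgam.
  - exact: ltW.
  rewrite -ge0_integralD //.
  - by move=> x _; rewrite -EFinM lee_fin mulr_ge0 ?gam_ge0 // ltW.
  - by apply/measurable_EFinP; apply: measurable_funM => //; exact: mgam.
  - by move=> x /pos x0; rewrite lee_fin r_ge0.
  - apply/measurable_EFinP; exact: mr.
have e2 : ((\int[leb]_(x in `]0%R, +oo[) (gam (s + 1) x)%:E) +
    (\int[leb]_(x in `]0%R, +oo[) (r x)%:E) = (2 * C)%:E)%E.
  rewrite -inth -ge0_integralD //.
  - by apply: eq_integral => x _; rewrite -EFinD /r; congr EFin; ring.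
  - by move=> x _; rewrite lee_fin; exact: gam_ge0.
  - apply/measurable_EFinP; exact: mgam.
  - by move=> x /pos x0; rewrite lee_fin r_ge0.
  - apply/measurable_EFinP; exact: mr.
have p1 : (0 <= \int[leb]_(x in `]0%R, +oo[) (gam s x)%:E)%E.
  by apply: integral_ge0 => x _; rewrite lee_fin; exact: gam_ge0.
have p2 : (0 <= \int[leb]_(x in `]0%R, +oo[) (gam (s + 1) x)%:E)%E.
  by apply: integral_ge0 => x _; rewrite lee_fin; exact: gam_ge0.
have p3 : (0 <= \int[leb]_(x in `]0%R, +oo[) (r x)%:E)%E.
  by apply: integral_ge0 => x /pos x0; rewrite lee_fin r_ge0.
move: e1 e2 p1 p2 p3.
case: (\int[leb]_(x in `]0%R, +oo[) (gam s x)%:E)%E => [u| |] //;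
case: (\int[leb]_(x in `]0%R, +oo[) (gam (s + 1) x)%:E)%E => [v| |] //;
case: (\int[leb]_(x in `]0%R, +oo[) (r x)%:E)%E => [w| |] //.
all: rewrite ?gt0_muley ?lte_fin //.
rewrite -!EFinM -!EFinD => -[e1] -[e2] _ _ _; split; first exact: ltry.
by congr EFin; lra.
Unshelve. all: by end_near. Qed.

End GammaFunction.

Lemma integral_gt0 d (T : measurableType d) (R : realType)
    (mu : {measure set T -> \bar R}) (D : set T) (f : T -> R) :
  measurable D -> measurable_fun D f -> (forall x, D x -> 0 < f x) ->
  (0 < mu D)%E -> (0 < \int[mu]_(x in D) (f x)%:E)%E.
Proof.
move=> mD mf f0 muD; rewrite lt_neqAle; apply/andP; split; last first.
  by apply: integral_ge0 => x /f0 h; rewrite lee_fin ltW.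
apply/eqP => h0; have mf' : measurable_fun D (EFin \o f) by apply/measurable_EFinP.
have : ae_eq mu D (EFin \o f) (cst 0%E).
  apply/(ae_eq_integral_abs _ mD mf'); rewrite {1}h0.
  by apply: eq_integral => x /set_mem /f0 h; rewrite /= ger0_norm // ltW.
case=> N [mN N0 sub]; have DN : D `<=` N.
  move=> x Dx; apply: sub => /= /(_ Dx) [h]; have := f0 x Dx.
  by rewrite h ltxx.
have : (mu D <= mu N)%E by apply: le_measure; rewrite ?inE.
by move=> /(lt_le_trans muD); rewrite N0 ltxx.
Qed.

(** * Gamma moments and orthogonality of the L_n in the weight *)

Section Weight.
Variable R : realType.
Implicit Types (s a x : R) (p q : {poly R}) (n k : nat).

Definition wgt a x := x `^ a * expR (- x).
Definition gmom a k := Gamma (a + k%:R + 1).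

Lemma wgt_ge0 a x : 0 <= wgt a x.
Proof. by rewrite mulr_ge0 ?powR_ge0 ?expR_ge0. Qed.

Lemma measurable_wgt a : measurable_fun (`]0, +oo[ : set R) (wgt a).
Proof. by have := measurable_gamma_fun (a + 1); rewrite addrK. Qed.

Lemma wgt_gt0 a x : 0 < x -> 0 < wgt a x.
Proof. by move=> x0; rewrite mulr_gt0 ?powR_gt0 ?expR_gt0. Qed.

Lemma integral_wgt a : -1 < a ->
  (\int[leb]_(x in `]0%R, +oo[) (wgt a x)%:E = (Gamma (a + 1))%:E)%E.
Proof.
move=> ha; have a0 : 0 < a + 1 by lra.
have [h _] := gamma_rec a0; rewrite /Gamma /Rintegral addrK in h *.
rewrite fineK // ge0_fin_numE //; apply: integral_ge0 => x _.
by rewrite lee_fin wgt_ge0.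
Qed.

Lemma GammaS s : 0 < s -> Gamma (s + 1) = s * Gamma s.
Proof.
move=> s0; have [h1 h2] := gamma_rec s0; rewrite /Gamma /Rintegral h2.
rewrite fineM // ge0_fin_numE //; apply: integral_ge0 => x _.
by rewrite lee_fin wgt_ge0.
Qed.

Lemma Gamma_gt0 s : 0 < s -> 0 < Gamma s.
Proof.
move=> s0; rewrite -lte_fin.
have e : s = s - 1 + 1 by ring.
rewrite e -integral_wgt; last by lra.
apply: integral_gt0 => //; first exact: measurable_wgt.
  by move=> x /=; rewrite in_itv /= andbT; exact: wgt_gt0.
rewrite -[X in (0 < X)%E]/(lebesgue_measure (`]0%R, +oo[%classic : set R)).
by rewrite lebesgue_measure_itv /= ltry /= ltry.
Qed.

Lemma gmomS a k : -1 < a -> gmom a k.+1 = (a + k.+1%:R) * gmom a k.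
Proof.
move=> ha; rewrite /gmom -[k.+1%:R]natr1 [a + (_ + 1)]addrA GammaS //.
by rewrite -addrA natr1 addr_nat1_gt0.
Qed.

Lemma gmom_gt0 a k : -1 < a -> 0 < gmom a k.
Proof. by move=> ha; apply: Gamma_gt0; rewrite -addrA natr1 addr_nat1_gt0. Qed.

Lemma integrable_mono_wgt a k : -1 < a ->
  leb.-integrable `]0, +oo[ (fun x => (x ^+ k * wgt a x)%:E) /\
  \int[leb]_(x in `]0, +oo[) (x ^+ k * wgt a x) = gmom a k.
Proof.
move=> ha; have hak : -1 < a + k%:R by rewrite ltr_wpDr ?ler0n.
have e : {in (`]0, +oo[%classic : set R), (fun x => x ^+ k * wgt a x) =1 wgt (a + k%:R)}.
  move=> x; rewrite inE /= in_itv /= andbT => x0.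
  rewrite /wgt powRD ?(gt_eqF x0) ?implybT //.
  by rewrite powR_mulrn ?ltW //; ring.
have hi := integral_wgt hak; split; last first.
  transitivity (\int[leb]_(x in `]0, +oo[) wgt (a + k%:R) x).
    by apply: eq_Rintegral => x hx; exact: e.
  by rewrite /Rintegral hi.
apply/integrableP; split.
  apply/measurable_EFinP; apply: (eq_measurable_fun (wgt (a + k%:R))).
    by move=> x hx; rewrite e.
  exact: measurable_wgt.
apply: (@le_lt_trans _ _ (Gamma (a + k%:R + 1))%:E); last exact: ltry.
rewrite -hi le_eqVlt; apply/orP; left; apply/eqP.
by apply: eq_integral => x hx; rewrite /= e // ger0_norm // wgt_ge0.
Qed.

Lemma integrable_poly_wgt a p : -1 < a ->
  leb.-integrable `]0, +oo[ (fun x => (p.[x] * wgt a x)%:E) /\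
  \int[leb]_(x in `]0, +oo[) (p.[x] * wgt a x) = moment (gmom a) p.
Proof.
move=> ha; pose F n x := (\sum_(i < n) p`_i * x ^+ i) * wgt a x.
have key n : leb.-integrable `]0, +oo[ (fun x => (F n x)%:E) /\
    \int[leb]_(x in `]0, +oo[) F n x = \sum_(i < n) p`_i * gmom a i.
  elim: n => [|n [IH1 IH2]].
    have -> : F 0 = fun=> 0 by apply/funext => x; rewrite /F big_ord0 mul0r.
    rewrite big_ord0; split; first exact: integrable0.
    by rewrite /Rintegral integral0.
  have [h1 h2] := integrable_mono_wgt n ha.
  have e : F n.+1 = fun x => F n x + p`_n * (x ^+ n * wgt a x).
    by apply/funext => x; rewrite /F big_ord_recr /= mulrDl; ring.
  have i2 : leb.-integrable `]0, +oo[ (fun x => (p`_n * (x ^+ n * wgt a x))%:E).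
    exact: (integrableZl _ _ h1).
  rewrite e; split.
    exact: (integrableD _ IH1 i2).
  by rewrite RintegralD // IH2 RintegralZl // h2 big_ord_recr.
have [k1 k2] := key (size p).
have e : (fun x => p.[x] * wgt a x) = F (size p).
  by apply/funext => x; rewrite /F horner_coef.
split; last by rewrite e.
by rewrite (_ : (fun x => _) = (fun x => (F (size p) x)%:E)) //; rewrite -e.
Qed.

Definition lag_norm a n := gmom a n / n`!%:R.

Lemma lag_norm_gt0 a n : -1 < a -> 0 < lag_norm a n.
Proof. by move=> ha; rewrite divr_gt0 ?gmom_gt0 // ltr0n fact_gt0. Qed.

Lemma laguerre_orth a m n : -1 < a ->
  \int[leb]_(x in `]0, +oo[) ((laguerre a m).[x] * (laguerre a n).[x] * wgt a x)
  = if m == n then lag_norm a n else 0.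
Proof.
move=> ha; transitivity (\int[leb]_(x in `]0, +oo[)
    ((laguerre a m * laguerre a n).[x] * wgt a x)).
  by apply: eq_Rintegral => x _; rewrite hornerM.
rewrite (integrable_poly_wgt _ ha).2.
have hg k : gmom a k.+1 = (a + k.+1%:R) * gmom a k by exact: gmomS.
by case: eqVneq => [->|h]; [exact: moment_laguerre_sqr|exact: moment_laguerre_orth h].
Qed.

End Weight.

(** * Real coordinates of complex powers *)

Section ComplexPowers.
Variable R : realType.
Implicit Types (u v : R) (m : nat).

(* Real and imaginary parts of (u + iv)^m. *)
Fixpoint cpw u v m : R * R :=
  if m is m'.+1 then
    (u * (cpw u v m').1 - v * (cpw u v m').2, v * (cpw u v m').1 + u * (cpw u v m').2)
  else (1, 0).

Lemma cpw_norm u v m :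
  (cpw u v m).1 ^+ 2 + (cpw u v m).2 ^+ 2 = (u ^+ 2 + v ^+ 2) ^+ m.
Proof.
elim: m => [|m IH]; first by rewrite /= expr0n expr1n addr0 expr0.
by rewrite [RHS]exprS -IH /=; ring.
Qed.

Lemma cpw_le u v m :
  `|(cpw u v m).1| <= Num.sqrt (u ^+ 2 + v ^+ 2) ^+ m /\
  `|(cpw u v m).2| <= Num.sqrt (u ^+ 2 + v ^+ 2) ^+ m.
Proof.
have h : Num.sqrt (u ^+ 2 + v ^+ 2) ^+ m =
    Num.sqrt ((cpw u v m).1 ^+ 2 + (cpw u v m).2 ^+ 2).
  rewrite cpw_norm; elim: m => [|m IH]; first by rewrite !expr0 sqrtr1.
  by rewrite !(exprS _ m) sqrtrM ?addr_ge0 ?sqr_ge0 // IH.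
by rewrite h -!sqrtr_sqr; split; apply: ler_wsqrtr;
  rewrite ?lerDl ?lerDr sqr_ge0.
Qed.

Lemma cpwD u v m n : cpw u v (m + n) =
  ((cpw u v m).1 * (cpw u v n).1 - (cpw u v m).2 * (cpw u v n).2,
   (cpw u v m).1 * (cpw u v n).2 + (cpw u v m).2 * (cpw u v n).1).
Proof.
elim: m => [|m IH]; first by rewrite add0n /= !mul1r !mul0r subr0 addr0 -surjective_pairing.
by rewrite addSn /= IH /=; congr (_, _); ring.
Qed.

End ComplexPowers.

(** * Growth of the Laguerre values *)

Section Summability.
Variable R : realType.
Implicit Types (b z r : R) (n m : nat).

(** With weights r^n, the values for b, b + 1 and b + 2 form a closed system: Pascal's rule bounds d
    and e in terms of s up to factors 1 / (1 - r), and [laguerre_pred_le] expresses (n + 1) s_(n+1)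
    through d_n and e_n. The factor n + 1 makes s stay bounded. *)
Lemma laguerre_growth b z r : -1 < b -> 0 <= z -> 0 < r < 1 ->
  exists M, forall n, (laguerre b n).[- z] * r ^+ n <= M.
Proof.
move=> hb hz /andP[r0 r1].
pose s n := (laguerre b n).[- z] * r ^+ n.
pose d n := (laguerre (b + 1) n).[- z] * r ^+ n.
pose e n := (laguerre (b + 2) n).[- z] * r ^+ n.
have s_ge0 n : 0 <= s n by rewrite mulr_ge0 ?exprn_ge0 ?laguerre_neg_ge0 // ltW.
have hr : 0 < 1 - r by rewrite subr_gt0.
have dS n : d n.+1 = r * d n + s n.+1.
  by rewrite /d /s laguerre_pascal hornerD exprS; ring.
have eS n : e n.+1 = r * e n + d n.+1.
  rewrite /e /d (_ : b + 2 = b + 1 + 1); last by ring.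
  by rewrite [laguerre (b + 1 + 1) n.+1]laguerre_pascal hornerD exprS; ring.
have sS n : n.+1%:R * s n.+1 = r * ((b + 1) * d n + z * e n).
  by rewrite /s mulrA laguerre_pred_le /d /e exprS; ring.
(* [C] results from inserting d <= M / (1 - r) and e <= M / (1 - r)^2 into [sS]. Past [N], which
   exceeds [C], the factor n + 1 absorbs it; up to [N] the bound holds because [M] sums all these
   values. *)
pose C := r * ((b + 1) / (1 - r) + z / (1 - r) ^+ 2).
pose N := Num.bound C; pose M := \sum_(i < N.+1) s i.
have C0 : 0 <= C.
  apply: mulr_ge0; first exact: ltW.
  apply: addr_ge0; apply: divr_ge0 => //; try lra.
  exact: sqr_ge0.
have sM n : (n <= N)%N -> s n <= M.
  rewrite -ltnS => hn; rewrite /M (bigD1 (Ordinal hn)) //= lerDl.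
  exact: sumr_ge0.
have M0 : 0 <= M by exact: sumr_ge0.
have s0M := sM 0 isT.
have key n : [/\ s n <= M, d n * (1 - r) <= M & e n * (1 - r) ^+ 2 <= M].
  elim: n => [|n [IH1 IH2 IH3]].
    have e0 : s 0 = 1 by rewrite /s laguerre0 hornerC mulr1.
    have e1 : d 0 = 1 by rewrite /d laguerre0 hornerC mulr1.
    have e2 : e 0 = 1 by rewrite /e laguerre0 hornerC mulr1.
    rewrite e1 e2 !mul1r; split=> //; rewrite -e0 in s0M *; rewrite e0 in s0M *; nra.
  have sn : s n.+1 <= M.
    have [/sM //|hn] := leqP n.+1 N.
    have h1 : n.+1%:R * s n.+1 <= C * M.
      have -> : C * M = r * ((b + 1) * (M / (1 - r)) + z * (M / (1 - r) ^+ 2)).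
        by rewrite /C; ring.
      rewrite sS ler_pM2l // lerD //.
        by rewrite ler_wpM2l //; [lra|rewrite ler_pdivlMr].
      by rewrite ler_wpM2l // ler_pdivlMr // exprn_gt0.
    have h2 : C * M <= n.+1%:R * M.
      rewrite ler_wpM2r //; have := archi_boundP C0; rewrite -/N => hN.
      by apply: le_trans (ltW hN) _; rewrite ler_nat ltnW.
    by have := le_trans h1 h2; rewrite ler_pM2l // ltr0n.
  have dn : d n.+1 * (1 - r) <= M by rewrite dS; nra.
  split=> //; rewrite eS; nra.
by exists M => n; have [] := key n.
Qed.

Lemma laguerre_summable b z r : -1 < b -> 0 <= z -> 0 <= r < 1 ->
  cvgn (series (fun n => (laguerre b n).[- z] * r ^+ n)).
Proof.
(* [t] lies strictly between r and 1 and is positive even for r = 0, as the growth bound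
   requires. *)
move=> hb hz /andP[r0 r1]; pose t := (1 + r) / 2.
have t0 : 0 < t by rewrite /t; lra.
have t1 : t < 1 by rewrite /t; lra.
have [|M hM] := @laguerre_growth b z t hb hz; first by rewrite t0.
have rt0 : 0 <= r / t by rewrite divr_ge0 // ltW.
have M0 : 0 <= M.
  by apply: le_trans (hM 0); rewrite mulr_ge0 ?exprn_ge0 ?laguerre_neg_ge0 // ltW.
apply: (@series_le_cvg _ _ (geometric M (r / t))).
- by move=> n; rewrite mulr_ge0 ?exprn_ge0 ?laguerre_neg_ge0.
- by move=> n; rewrite /= mulr_ge0 ?exprn_ge0.
- move=> n /=; have -> : r ^+ n = t ^+ n * (r / t) ^+ n.
    by rewrite -exprMn mulrCA mulfV ?mulr1 // gt_eqF.
  by rewrite mulrA ler_wpM2r // exprn_ge0.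
- by apply: is_cvg_geometric_series; rewrite ger0_norm // ltr_pdivrMr // mul1r /t; lra.
Qed.

End Summability.

(** * Generating function of the Laguerre polynomials *)

Section GeneratingFunction.
Variable R : realType.
Variables (z u v : R).
Hypothesis z_ge0 : 0 <= z.
Hypothesis uv_lt1 : u ^+ 2 + v ^+ 2 < 1.
Implicit Types (p q b t : R).

Let r := Num.sqrt (u ^+ 2 + v ^+ 2).

Let r_ge0 : 0 <= r. Proof. exact: sqrtr_ge0. Qed.
Let r_lt1 : r < 1. Proof. by rewrite /r -[X in _ < X]sqrtr1 ltr_sqrt. Qed.

Let P m := (cpw u v m).1.
Let Q m := (cpw u v m).2.

(* Coefficients of Re ((p - iq) sum_m L_m^(b)(z) (t c)^m) as a power series
   in t, where c = u + iv. *)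
Definition gen_coef p q b m := (laguerre b m).[z] * (p * P m + q * Q m).

Lemma normr_gen_coef p q b m : -1 < b ->
  `|gen_coef p q b m| <= (`|p| + `|q|) * ((laguerre b m).[- z] * r ^+ m).
Proof.
move=> hb; rewrite normrM mulrCA; have [h1 h2] := cpw_le u v m.
apply: ler_pM => //; first exact: normr_laguerre.
apply: le_trans (ler_normD _ _) _; rewrite !normrM mulrDl lerD //;
  by apply: ler_wpM2l.
Qed.

Lemma cvg_gen p q b t : -1 < b -> `|t| * r < 1 -> cvgn (pseries (gen_coef p q b) t).
Proof.
move=> hb ht; apply: normed_cvg.
apply: (@series_le_cvg _ _ (fun m => (`|p| + `|q|) *
  ((laguerre b m).[- z] * (`|t| * r) ^+ m))).
- by move=> m; exact: normr_ge0.
- move=> m; rewrite mulr_ge0 ?addr_ge0 // mulr_ge0 ?laguerre_neg_ge0 //.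
  by rewrite exprn_ge0 // mulr_ge0.
- move=> m /=; rewrite normrM normrX exprMn.
  rewrite [X in _ <= X](_ : _ = (`|p| + `|q|) * ((laguerre b m).[- z] * r ^+ m) *
    `|t| ^+ m); last by ring.
  by rewrite ler_wpM2r ?exprn_ge0 // normr_gen_coef.
- apply: (is_cvg_seriesZ (f := fun m => (laguerre b m).[- z] * (`|t| * r) ^+ m)).
  by apply: laguerre_summable => //; rewrite ht mulr_ge0.
Qed.

Definition gen p q b t := limn (pseries (gen_coef p q b) t).

Lemma pseries_lin (f g : nat -> R) (k l t : R) : cvgn (pseries f t) -> cvgn (pseries g t) ->
  pseries (fun m => k * f m + l * g m) t @ \oo --> k * limn (pseries f t) + l * limn (pseries g t).
Proof.
move=> hf hg.
have -> : pseries (fun m => k * f m + l * g m) t =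
    (fun n => k * pseries f t n + l * pseries g t n).
  apply/funext => n; rewrite /pseries /series /= !mulr_sumr -big_split /=.
  by apply: eq_bigr => i _; ring.
by apply: cvgD; apply: cvgM => //; exact: cvg_cst.
Qed.

Lemma gen_lin p q b t : -1 < b -> `|t| * r < 1 ->
  gen p q b t = p * gen 1 0 b t + q * gen 0 1 b t.
Proof.
move=> hb ht; apply/cvg_lim => //.
have -> : gen_coef p q b = fun m => p * gen_coef 1 0 b m + q * gen_coef 0 1 b m.
  by apply/funext => m; rewrite /gen_coef; ring.
by apply: pseries_lin; apply: cvg_gen.
Qed.

(** In complex form, G^(b) = (1 - t c) G^(b+1). Multiplying p - iq by c = u + iv gives p' - iq' with
    p' = p u + q v and q' = q u - p v. *)
Lemma gen_pascal p q b t : -1 < b -> `|t| * r < 1 ->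
  gen p q b t = gen p q (b + 1) t - t * gen (p * u + q * v) (q * u - p * v) (b + 1) t.
Proof.
move=> hb ht; apply/cvg_lim => //; rewrite -cvg_shiftS.
have hb1 : -1 < b + 1 by lra.
set p' := p * u + q * v; set q' := q * u - p * v.
rewrite (_ : (fun n => _) = fun n => pseries (gen_coef p q (b + 1)) t n.+1 -
    t * pseries (gen_coef p' q' (b + 1)) t n); last first.
  apply/funext; elim=> [|n IH].
    rewrite /pseries /series /= !big_nat1 big_geq // mulr0 subr0 !expr0.
    by rewrite /gen_coef !laguerre0.
  rewrite /pseries /series /= in IH *.
  rewrite [LHS]big_nat_recr //= IH [X in _ = X - _]big_nat_recr //=.
  rewrite [X in _ = _ - _ * X]big_nat_recr //= exprS /gen_coef laguerre_pascal.
  by rewrite hornerD /p' /q' /P /Q /=; ring.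
apply: cvgB.
  by rewrite (cvg_shiftS (pseries (gen_coef p q (b + 1)) t)); exact: cvg_gen.
by apply: cvgM; [exact: cvg_cst|exact: cvg_gen].
Qed.

Lemma gen_coef_diffs p q b : pseries_diffs (gen_coef p q b) =
  fun m => (b + 1) * gen_coef (p * u + q * v) (q * u - p * v) (b + 1) m +
           (- z) * gen_coef (p * u + q * v) (q * u - p * v) (b + 2) m.
Proof.
apply/funext => m; rewrite /pseries_diffs /gen_coef mulrA laguerre_pred_le.
by rewrite /P /Q /=; ring.
Qed.

(** In complex form, dG^(b)/dt = c ((b + 1) G^(b+1) - z G^(b+2)), which is [laguerre_pred_le] summed
    over the degree. *)
Lemma gen_derive p q b t : -1 < b -> `|t| * r < 1 ->
  is_derive t (1 : R) (gen p q b)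
    ((b + 1) * gen (p * u + q * v) (q * u - p * v) (b + 1) t +
     (- z) * gen (p * u + q * v) (q * u - p * v) (b + 2) t).
Proof.
move=> hb ht; have hb1 : -1 < b + 1 by lra.
have hb2 : -1 < b + 2 by lra.
(* Termwise differentiation asks for convergence of the series and of its formal derivatives at some
   K beyond |t|. Any K with K r < 1 qualifies, such as the midpoint of |t| and 1 / r. *)
have [K [K0 tK Kr]] : exists K : R, [/\ 0 <= K, `|t| < K & K * r < 1].
  have [r0|r0] := eqVneq r 0.
    by exists (`|t| + 1); split; rewrite ?r0 ?mulr0 ?ltr01 ?ltrDl ?addr_ge0.
  have rp : 0 < r by rewrite lt_neqAle eq_sym r0.
  exists ((`|t| + r^-1) / 2).
  have h : `|t| < r^-1 by rewrite -[r^-1]mul1r ltr_pdivlMr.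
  have h0 : 0 <= `|t| by [].
  split; [lra|lra|].
  have : (`|t| + r^-1) / 2 < r^-1 by lra.
  by rewrite -[X in _ < X]mul1r ltr_pdivlMr.
have hK : `|K| * r < 1 by rewrite ger0_norm.
have cK p' q' b' : -1 < b' -> cvgn (pseries (gen_coef p' q' b') K).
  by move=> h; apply: cvg_gen.
have cl := @pseries_lin _ _ (b + 1) (- z) t
  (@cvg_gen (p * u + q * v) (q * u - p * v) _ _ hb1 ht)
  (@cvg_gen (p * u + q * v) (q * u - p * v) _ _ hb2 ht).
have -> : (b + 1) * gen (p * u + q * v) (q * u - p * v) (b + 1) t +
     (- z) * gen (p * u + q * v) (q * u - p * v) (b + 2) t =
    limn (pseries (pseries_diffs (gen_coef p q b)) t).
  by apply/esym/cvg_lim => //; rewrite gen_coef_diffs.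
apply: (@pseries_snd_diffs _ _ K).
- exact: cK.
- by rewrite gen_coef_diffs; exact: cvgP (pseries_lin (cK _ _ _ hb1) (cK _ _ _ hb2)).
- rewrite gen_coef_diffs.
  set f1 := gen_coef _ _ (b + 1); set f2 := gen_coef _ _ (b + 2).
  have -> : pseries_diffs (fun m => (b + 1) * f1 m + - z * f2 m) =
      fun m => (b + 1) * pseries_diffs f1 m + - z * pseries_diffs f2 m.
    by apply/funext => m; rewrite /pseries_diffs; ring.
  apply: cvgP; apply: pseries_lin.
    rewrite gen_coef_diffs; apply: cvgP; apply: pseries_lin; apply: cK; lra.
  rewrite gen_coef_diffs; apply: cvgP; apply: pseries_lin; apply: cK; lra.
- by rewrite (ger0_norm K0).
Qed.

Let derive0_cst (f : R -> R) : (forall x : R, 0 <= x <= 1 -> is_derive x (1 : R) f 0) ->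
  f 1 = f 0.
Proof.
move=> df; have [| |c _] := @MVT_segment R f (fun=> 0) 0 1 ler01.
- by move=> x; rewrite in_itv /= => /andP[x0 x1]; apply: df; rewrite !ltW.
- apply: derivable_within_continuous => x; rewrite in_itv /= => hx.
  exact: (@ex_derive _ _ _ _ _ _ _ (df x hx)).
by rewrite mul0r => /eqP; rewrite subr_eq0 => /eqP.
Qed.

(** [N t] is |1 - t c|^2; u < 1 keeps 1 - t u, and so [N t], positive on [0, 1]. *)
Let N t := 1 - 2 * u * t + (u ^+ 2 + v ^+ 2) * t ^+ 2.

Let u_lt1 : u < 1.
Proof.
have h0 := sqr_ge0 v; have h1 := sqr_ge0 (u - 1).
have {}h1 : 0 <= u ^+ 2 - 2 * u + 1 by rewrite (_ : _ + 1 = (u - 1) ^+ 2) //; ring.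
move: uv_lt1 h0 h1; move: (u ^+ 2) (v ^+ 2) => u2 v2; lra.
Qed.

Let tu_gt0 t : 0 <= t <= 1 -> 0 < 1 - t * u.
Proof.
move=> /andP[t0 t1]; rewrite subr_gt0; have [u0|u0] := leP u 0.
  by apply: le_lt_trans ltr01; rewrite mulr_ge0_le0.
by apply: le_lt_trans u_lt1; rewrite ler_piMl // ltW.
Qed.

Let NE t : N t = (1 - t * u) ^+ 2 + (t * v) ^+ 2.
Proof. by rewrite /N; ring. Qed.

Let N_gt0 t : 0 <= t <= 1 -> 0 < N t.
Proof.
by move=> /tu_gt0 h; rewrite NE ltr_wpDr ?sqr_ge0 // exprn_gt0.
Qed.

Let tr_lt1 t : 0 <= t <= 1 -> `|t| * r < 1.
Proof.
by move=> /andP[t0 t1]; rewrite ger0_norm // (le_lt_trans _ r_lt1) // ler_piMl.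
Qed.

(* e^(X t) (cos (Y t) + i sin (Y t)) is the inverse of the generating function
   at t c: its logarithmic derivative is the opposite of that of the sum. *)
Let X b t := (b + 1) / 2 * ln (N t) + z * ((t * u - (u ^+ 2 + v ^+ 2) * t ^+ 2) / N t).
Let Y b t := (b + 1) * atan (- (t * v) / (1 - t * u)) + z * (t * v / N t).

(** m1 + i n1 is 1 / (1 - t c), and kr + i ki = (b + 1) c / (1 - t c) - z c / (1 - t c)^2 is the
    logarithmic derivative of (1 - t c)^(-b-1) exp(- z t c / (1 - t c)). *)
Let m1 t := (1 - t * u) / N t.
Let n1 t := t * v / N t.
Let kr b t := (b + 1) * (u * m1 t - v * n1 t) -
  z * (u * (m1 t ^+ 2 - n1 t ^+ 2) - v * (2 * m1 t * n1 t)).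
Let ki b t := (b + 1) * (v * m1 t + u * n1 t) -
  z * (v * (m1 t ^+ 2 - n1 t ^+ 2) + u * (2 * m1 t * n1 t)).

Let gen_step b t : -1 < b -> 0 <= t <= 1 ->
  gen 1 0 (b + 1) t = m1 t * gen 1 0 b t - n1 t * gen 0 1 b t /\
  gen 0 1 (b + 1) t = n1 t * gen 1 0 b t + m1 t * gen 0 1 b t.
Proof.
move=> hb ht; have hb1 : -1 < b + 1 by lra.
have tr := tr_lt1 ht; have := NE t; have := N_gt0 ht.
rewrite (gen_pascal 1 0 hb tr) (gen_pascal 0 1 hb tr).
rewrite (gen_lin (1 * u + 0 * v) _ hb1 tr) (gen_lin (0 * u + 1 * v) _ hb1 tr).
rewrite /m1 /n1; set n := N t; set U := gen 1 0 _ t; set V := gen 0 1 _ t.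
move=> n0 nE; have n0' : n != 0 by rewrite gt_eqF.
set A := (U - _); set B := (V - _).
by split; apply: (mulIf n0'); [transitivity ((1 - t * u) * A - t * v * B)|
  transitivity (t * v * A + (1 - t * u) * B)]; rewrite /A /B ; try (by field); rewrite nE; ring.
Qed.

Let gen_derive1 b t : -1 < b -> 0 <= t <= 1 ->
  is_derive t (1 : R) (gen 1 0 b) (kr b t * gen 1 0 b t - ki b t * gen 0 1 b t) /\
  is_derive t (1 : R) (gen 0 1 b) (ki b t * gen 1 0 b t + kr b t * gen 0 1 b t).
Proof.
move=> hb ht; have hb1 : -1 < b + 1 by lra.
have hb2 : -1 < b + 2 by lra.
have tr := tr_lt1 ht.
have [h1 h2] := gen_step hb ht; have [h3 h4] := gen_step hb1 ht.
rewrite -addrA in h3 h4; have e2 : 1 + 1 = 2 :> R by ring.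
rewrite e2 h1 h2 in h3 h4.
split; apply: is_derive_eq (gen_derive _ _ hb tr) _.
  rewrite (gen_lin (1 * u + 0 * v) _ hb1 tr) (gen_lin (1 * u + 0 * v) _ hb2 tr).
  by rewrite h3 h4 h1 h2 /kr /ki; ring.
rewrite (gen_lin (0 * u + 1 * v) _ hb1 tr) (gen_lin (0 * u + 1 * v) _ hb2 tr).
by rewrite h3 h4 h1 h2 /kr /ki; ring.
Qed.

Let derive_N t : is_derive t (1 : R) N (- 2 * u + 2 * (u ^+ 2 + v ^+ 2) * t).
Proof.
pose p : {poly R} := 1 - (2 * u) *: 'X + (u ^+ 2 + v ^+ 2) *: 'X^2.
have -> : N = fun t => p.[t] by apply/funext => s; rewrite /N /p !hornerE.
apply: is_derive_eq (is_derive_poly p t) _.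
by rewrite /p !poly.derivE !hornerE; ring.
Qed.

Let derive_lin (k l t : R) : is_derive t (1 : R) (fun t => k + l * t) l.
Proof.
pose p : {poly R} := k%:P + l *: 'X.
have -> : (fun t => k + l * t) = fun t => p.[t] by apply/funext => s; rewrite /p !hornerE.
by apply: is_derive_eq (is_derive_poly p t) _; rewrite /p !poly.derivE !hornerE; ring.
Qed.

Let derive_quot (f g : R -> R) (t f' g' : R) : g t != 0 ->
  is_derive t (1 : R) f f' -> is_derive t (1 : R) g g' ->
  is_derive t (1 : R) (fun s => f s / g s) ((f' * g t - f t * g') / g t ^+ 2).
Proof.
move=> g0 df dg; have dV := is_deriveV g0 dg.
apply: is_derive_eq (is_deriveM df dV) _.
by rewrite /GRing.scale /=; field.
Qed.

Let derive_X b t : 0 <= t <= 1 -> is_derive t (1 : R) (X b) (- kr b t).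
Proof.
move=> ht; have n0 := N_gt0 ht; have n0' : N t != 0 by rewrite gt_eqF.
have d1 := is_derive1_comp (is_derive1_ln n0) (derive_N t).
pose p : {poly R} := u *: 'X - (u ^+ 2 + v ^+ 2) *: 'X^2.
have d2 : is_derive t (1 : R) (fun t => t * u - (u ^+ 2 + v ^+ 2) * t ^+ 2)
    (u - 2 * (u ^+ 2 + v ^+ 2) * t).
  rewrite (_ : (fun t => _) = fun t => p.[t]); last first.
    by apply/funext => s; rewrite /p !hornerE; ring.
  by apply: is_derive_eq (is_derive_poly p t) _; rewrite /p !poly.derivE !hornerE; ring.
have d3 := derive_quot n0' d2 (derive_N t).
apply: is_derive_eq (is_deriveD (is_deriveZ ((b + 1) / 2) d1) (is_deriveZ z d3)) _.
move: n0'; rewrite /GRing.scale /= /kr /m1 /n1 /N => n0'; field.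
exact: n0'.
Qed.

Let derive_Y b t : 0 <= t <= 1 -> is_derive t (1 : R) (Y b) (- ki b t).
Proof.
move=> ht; have n0 := N_gt0 ht; have n0' : N t != 0 by rewrite gt_eqF.
have tu0 := tu_gt0 ht; have tu0' : 1 - t * u != 0 by rewrite gt_eqF.
have d1 : is_derive t (1 : R) (fun t => t * v) v.
  have -> : (fun t => t * v) = fun t => 0 + v * t by apply/funext => s; ring.
  exact: derive_lin.
have d2 : is_derive t (1 : R) (fun t => 1 - t * u) (- u).
  have -> : (fun t => 1 - t * u) = fun t => 1 + (- u) * t by apply/funext => s; ring.
  exact: derive_lin.
have dn1 : is_derive t (1 : R) (fun t => - (t * v)) (- v) by exact: is_deriveN d1.
have d3 := @derive_quot (fun t => - (t * v)) (fun t => 1 - t * u) t _ _ tu0' dn1 d2.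
have d4 := is_derive1_comp (is_derive1_atan _) d3.
have d5 := derive_quot n0' d1 (derive_N t).
apply: is_derive_eq (is_deriveD (is_deriveZ (b + 1) d4) (is_deriveZ z d5)) _.
have e : (1 + (- (t * v) / (1 - t * u)) ^+ 2)^-1 = (1 - t * u) ^+ 2 / N t.
  by rewrite -[RHS]invf_div; congr (_^-1); rewrite NE; field.
rewrite /GRing.scale /= e.
move: n0'; rewrite /ki /m1 /n1 /N => n0'; field.
by rewrite n0' tu0'.
Qed.

(** The product of G^(b)(t c) and e^(X + iY), with parts [F1] and [F2], has derivative 0 along the
    segment and equals 1 at t = 0. Hence G^(b)(c) = e^(-X - iY) at t = 1. *)
Theorem gen_value b : -1 < b ->
  let n := (1 - u) ^+ 2 + v ^+ 2 in
  let x := (b + 1) / 2 * ln n + z * ((u * (1 - u) - v ^+ 2) / n) in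
  let y := (b + 1) * atan (- v / (1 - u)) + z * (v / n) in
  gen 1 0 b 1 = expR (- x) * cos (- y) /\ gen 0 1 b 1 = expR (- x) * sin (- y).
Proof.
move=> hb nn x y.
have nE : N 1 = nn by rewrite NE /nn !mul1r.
have -> : x = X b 1.
  by rewrite /X /x nE; congr (_ + _ * (_ / _)); ring.
have -> : y = Y b 1 by rewrite /Y /y nE !mul1r.
pose Ex t := expR (X b t) * cos (Y b t).
pose Ey t := expR (X b t) * sin (Y b t).
have dE t : 0 <= t <= 1 ->
    is_derive t (1 : R) Ex (- kr b t * Ex t + ki b t * Ey t) /\
    is_derive t (1 : R) Ey (- ki b t * Ex t - kr b t * Ey t).
  move=> ht; have dx := is_derive1_comp (is_derive_expR _) (derive_X b ht).
  have dc := is_derive1_comp (is_derive_cos _) (derive_Y b ht).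
  have ds := is_derive1_comp (is_derive_sin _) (derive_Y b ht).
  split; [apply: is_derive_eq (is_deriveM dx dc) _|
          apply: is_derive_eq (is_deriveM dx ds) _];
  by rewrite /Ex /Ey /GRing.scale /=; ring.
pose F1 t := Ex t * gen 1 0 b t - Ey t * gen 0 1 b t.
pose F2 t := Ex t * gen 0 1 b t + Ey t * gen 1 0 b t.
have dF1 t : 0 <= t <= 1 -> is_derive t (1 : R) F1 0.
  move=> ht; have [dx dy] := dE t ht; have [du dv] := gen_derive1 hb ht.
  apply: is_derive_eq (is_deriveB (is_deriveM dx du) (is_deriveM dy dv)) _.
  by rewrite /GRing.scale /=; ring.
have dF2 t : 0 <= t <= 1 -> is_derive t (1 : R) F2 0.
  move=> ht; have [dx dy] := dE t ht; have [du dv] := gen_derive1 hb ht.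
  apply: is_derive_eq (is_deriveD (is_deriveM dx dv) (is_deriveM dy du)) _.
  by rewrite /GRing.scale /=; ring.
have gen0 p q : gen p q b 0 = p.
  apply/cvg_lim => //; rewrite -cvg_shiftS.
  rewrite (_ : (fun n => _) = fun=> p); first exact: cvg_cst.
  apply/funext => n; rewrite /pseries /series /= big_nat_recl //= big1 => [|i _].
    by rewrite expr0 addr0 /gen_coef laguerre0 hornerC /P /Q /=; ring.
  by rewrite expr0n mulr0.
have N0 : N 0 = 1 by rewrite /N; ring.
have X0 : X b 0 = 0 by rewrite /X N0 ln1; ring.
have Y0 : Y b 0 = 0 by rewrite /Y N0 !mul0r oppr0 mul0r atan0; ring.
have e1 : F1 1 = 1.
  by rewrite (derive0_cst dF1) /F1 /Ex /Ey !gen0 X0 Y0 expR0 cos0 sin0; ring.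
have e2 : F2 1 = 0.
  by rewrite (derive0_cst dF2) /F2 /Ex /Ey !gen0 X0 Y0 expR0 cos0 sin0; ring.
have cs := cos2Dsin2 (Y b 1); have ee : expR (X b 1) * expR (- X b 1) = 1.
  by rewrite -expRD subrr expR0.
(* The equation E (c + is) (U + iV) = 1 is inverted by multiplying with E' (c - is), using E E' = 1
   and c^2 + s^2 = 1. *)
move: e1 e2; rewrite cosN sinN /F1 /F2 /Ex /Ey.
move: (expR (X b 1)) (expR (- X b 1)) (cos _) (sin _) (gen 1 0 b 1) (gen 0 1 b 1) ee cs.
move=> E E' c s U V ee cs e1 e2; split.
  rewrite -[U]mul1r -cs [LHS](_ : _ = c * (c * U - s * V) + s * (c * V + s * U));
    last by ring.
  rewrite -[c * U - s * V]mul1r -[c * V + s * U]mul1r -ee.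
  rewrite [LHS](_ : _ = E' * (c * (E * c * U - E * s * V) +
    s * (E * c * V + E * s * U))); last by ring.
  by rewrite e1 e2; ring.
rewrite -[V]mul1r -cs [LHS](_ : _ = c * (c * V + s * U) - s * (c * U - s * V));
    last by ring.
rewrite -[c * U - s * V]mul1r -[c * V + s * U]mul1r -ee.
rewrite [LHS](_ : _ = E' * (c * (E * c * V + E * s * U) -
    s * (E * c * U - E * s * V))); last by ring.
by rewrite e1 e2; ring.
Qed.

End GeneratingFunction.

(** * The quaternionic modulus and its comparison with the sup norm *)

Section QuaternionNorm.
Variable R : realType.
Implicit Types (p q I J : quat R) (a b c d s u v : R).

Lemma quatME p q :
  (q0 (p * q) = q0 p * q0 q - q1 p * q1 q - q2 p * q2 q - q3 p * q3 q) *
  (q1 (p * q) = q0 p * q1 q + q1 p * q0 q + q2 p * q3 q - q3 p * q2 q) *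
  (q2 (p * q) = q0 p * q2 q - q1 p * q3 q + q2 p * q0 q + q3 p * q1 q) *
  (q3 (p * q) = q0 p * q3 q + q1 p * q2 q - q2 p * q1 q + q3 p * q0 q).
Proof. by rewrite /GRing.mul /= /qmul !mkquatE. Qed.

Lemma quat1E : (q0 (1 : quat R) = 1) * (q1 (1 : quat R) = 0) *
  (q2 (1 : quat R) = 0) * (q3 (1 : quat R) = 0).
Proof. by rewrite /GRing.one /= !mkquatE. Qed.

Lemma quatNE q : (q0 (- q) = - q0 q) * (q1 (- q) = - q1 q) *
  (q2 (- q) = - q2 q) * (q3 (- q) = - q3 q).
Proof. by rewrite /q0 /q1 /q2 /q3 !mxE. Qed.

Lemma qconjE q : (q0 (qconj q) = q0 q) * (q1 (qconj q) = - q1 q) *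
  (q2 (qconj q) = - q2 q) * (q3 (qconj q) = - q3 q).
Proof. by rewrite /qconj !mkquatE. Qed.

Lemma qnorm_ge0 q : 0 <= qnorm q. Proof. exact: sqrtr_ge0. Qed.

Lemma qnorm_eq_sqr q a : 0 <= a -> qnorm q ^+ 2 = a ^+ 2 -> qnorm q = a.
Proof. by move=> a0 /eqP; rewrite eqrXn2 ?qnorm_ge0 // => /eqP. Qed.

Lemma qnormM p q : qnorm (p * q) = qnorm p * qnorm q.
Proof.
apply: qnorm_eq_sqr; first by rewrite mulr_ge0 ?qnorm_ge0.
by rewrite exprMn !qnorm_sqr !quatME; ring.
Qed.

Lemma qnormZ a q : qnorm (a *: q) = `|a| * qnorm q.
Proof.
apply: qnorm_eq_sqr; first by rewrite mulr_ge0 ?qnorm_ge0.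
by rewrite exprMn real_normK ?num_real // !qnorm_sqr !quatZE; ring.
Qed.

Lemma qnorm1 : qnorm (1 : quat R) = 1.
Proof. by apply: qnorm_eq_sqr => //; rewrite qnorm_sqr !quat1E; ring. Qed.

Lemma qnorm0 : qnorm (0 : quat R) = 0.
Proof. by rewrite -(scale0r (0 : quat R)) qnormZ normr0 mul0r. Qed.

Lemma qnormX q n : qnorm (q ^+ n) = qnorm q ^+ n.
Proof. by elim: n => [|n IH]; rewrite ?expr0 ?qnorm1 // !exprS qnormM IH. Qed.

Lemma qnorm_conj q : qnorm (qconj q) = qnorm q.
Proof. by rewrite /qnorm !qconjE !sqrrN. Qed.

Lemma normr_qcoord q :
  [/\ `|q0 q| <= qnorm q, `|q1 q| <= qnorm q, `|q2 q| <= qnorm q & `|q3 q| <= qnorm q].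
Proof.
have h0 := sqr_ge0 (q0 q); have h1 := sqr_ge0 (q1 q).
have h2 := sqr_ge0 (q2 q); have h3 := sqr_ge0 (q3 q).
by split; rewrite /qnorm -sqrtr_sqr ler_wsqrtr //; lra.
Qed.

Lemma qnormD p q : qnorm (p + q) <= qnorm p + qnorm q.
Proof.
rewrite -(@ler_pXn2r _ 2) ?nnegrE ?addr_ge0 ?qnorm_ge0 //.
(* Cauchy-Schwarz: the Euclidean product of p and q is the real part of conj(p) q. *)
have h : q0 (qconj p * q) <= qnorm p * qnorm q.
  rewrite -(qnorm_conj p) -qnormM; apply: le_trans (ler_norm _) _.
  by have [] := normr_qcoord (qconj p * q).
rewrite sqrrD !qnorm_sqr !quatDE; rewrite quatME !qconjE in h.
by move: h; set t := qnorm p * qnorm q => h; rewrite -mulr_natl; lra.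
Qed.

Lemma qnorm_sum n (F : 'I_n -> quat R) :
  qnorm (\sum_(i < n) F i) <= \sum_(i < n) qnorm (F i).
Proof.
elim/big_ind2: _ => [|x1 x2 y1 y2 h1 h2|//]; first by rewrite qnorm0.
by apply: le_trans (qnormD _ _) _; exact: lerD.
Qed.

Lemma normr_le_qnorm q : `|q| <= qnorm q.
Proof.
rewrite [X in X <= _]/Num.norm /= mx_normrE.
apply: bigmax_le => [|[i j] _ /=]; first exact: qnorm_ge0.
have [h0 h1 h2 h3] := normr_qcoord q.
rewrite (ord1 i); have -> : j = inord (val j) by apply: val_inj; rewrite /= inordK.
by case: j => [[|[|[|[|//]]]] ?].
Qed.

Lemma normr_coord_le q : [/\ `|q0 q| <= `|q|, `|q1 q| <= `|q|, `|q2 q| <= `|q| & `|q3 q| <= `|q|].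
Proof.
have h i : `|(q : 'rV[R]_4) 0 i| <= `|q|.
  rewrite [X in _ <= X]/Num.norm /= mx_normrE.
  exact: (le_bigmax _ (fun ij : 'I_1 * 'I_4 => `|(q : 'rV[R]_4) ij.1 ij.2|) (0, i)).
by split; exact: h.
Qed.

Lemma qnorm_le_normr q : qnorm q <= 2 * `|q|.
Proof.
have [h0 h1 h2 h3] := normr_coord_le q.
rewrite -(@ler_pXn2r _ 2) ?nnegrE ?mulr_ge0 ?qnorm_ge0 // qnorm_sqr.
have sq x : `|x| <= `|q| -> x ^+ 2 <= `|q| ^+ 2.
  by move=> h; rewrite -real_normK ?num_real // ler_pXn2r ?nnegrE.
by rewrite exprMn; have := sq _ h0; have := sq _ h1; have := sq _ h2; have := sq _ h3; lra.
Qed.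

Lemma normr_qmul p q : `|p * q| <= 2 * qnorm p * `|q|.
Proof.
apply: le_trans (normr_le_qnorm _) _; rewrite qnormM [2 * _]mulrC -mulrA.
by apply: ler_wpM2l; [exact: qnorm_ge0|exact: qnorm_le_normr].
Qed.

Lemma cvg_qmull T (F : set_system T) (FF : Filter F) (f : T -> quat R) p (l : quat R) :
  f @ F --> l -> (fun t => p * f t) @ F --> p * l.
Proof.
move=> /cvgrPdist_lt fl; apply/cvgrPdist_lt => e e0.
have c0 : 0 < 2 * qnorm p + 1 by rewrite ltr_wpDl // mulr_ge0 ?qnorm_ge0.
have := fl (e / (2 * qnorm p + 1)); rewrite divr_gt0 // => /(_ isT).
apply: filterS => t; rewrite -mulrBr ltr_pdivlMr // => ht.
apply: le_lt_trans (normr_qmul _ _) _; apply: le_lt_trans ht.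
by rewrite mulrC ler_wpM2l // lerDl.
Qed.

Lemma cvg_qcoord T (F : set_system T) (FF : Filter F) (f : T -> quat R) (l : quat R) :
  f @ F --> l ->
  [/\ (fun t => q0 (f t)) @ F --> q0 l, (fun t => q1 (f t)) @ F --> q1 l,
      (fun t => q2 (f t)) @ F --> q2 l & (fun t => q3 (f t)) @ F --> q3 l].
Proof.
move=> /cvgrPdist_lt fl.
have sub t : q0 (l - f t) = q0 l - q0 (f t) /\ q1 (l - f t) = q1 l - q1 (f t) /\
    q2 (l - f t) = q2 l - q2 (f t) /\ q3 (l - f t) = q3 l - q3 (f t).
  by rewrite !quatDE !quatNE.
split; apply/cvgrPdist_lt => e e0; apply: filterS (fl e e0) => t; apply: le_lt_trans;
  have [h0 h1 h2 h3] := normr_coord_le (l - f t); have [s0 [s1 [s2 s3]]] := sub t.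
- by rewrite -s0.
- by rewrite -s1.
- by rewrite -s2.
- by rewrite -s3.
Qed.

End QuaternionNorm.

(** * Slices in real coordinates *)

Section Slices.
Variable R : realType.
Implicit Types (p q I J : quat R) (a b c d s u v : R).

(** The vector part of J^2 is 2 (q0 J) times that of J, and it is zero; a nonzero [q0 J] would make
    J real, with a nonnegative square. *)
Lemma qsphereE J : qsphere J -> q0 J = 0 /\ q1 J ^+ 2 + q2 J ^+ 2 + q3 J ^+ 2 = 1.
Proof.
rewrite /qsphere /= expr2 => h.
have := congr1 (@q0 R) h; have := congr1 (@q1 R) h.
have := congr1 (@q2 R) h; have := congr1 (@q3 R) h.
rewrite !quatME !quatNE !quat1E oppr0 => h3 h2 h1 h0.
have [e|ne] := eqVneq (q0 J) 0; first by split=> //; rewrite e in h0; lra.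
have k (x : R) : q0 J * x + x * q0 J = 0 -> x = 0.
  move=> e; have /eqP : q0 J * x = 0 by lra.
  by rewrite mulf_eq0 (negbTE ne) => /eqP.
have e1 : q1 J = 0 by apply: k; rewrite -[RHS]h1; ring.
have e2 : q2 J = 0 by apply: k; rewrite -[RHS]h2; ring.
have e3 : q3 J = 0 by apply: k; rewrite -[RHS]h3; ring.
by exfalso; move: h0; rewrite e1 e2 e3; have := sqr_ge0 (q0 J); rewrite expr2; lra.
Qed.

Lemma slice_ptE J u v : q0 J = 0 ->
  (q0 (slice_pt J u v) = u) * (q1 (slice_pt J u v) = v * q1 J) *
  (q2 (slice_pt J u v) = v * q2 J) * (q3 (slice_pt J u v) = v * q3 J).
Proof. by move=> h; rewrite /slice_pt !quatDE !quatZE !quat1E h !mulr1 !mulr0 !add0r !addr0. Qed.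

Lemma slice_ptM J a b c d : qsphere J ->
  slice_pt J a b * slice_pt J c d = slice_pt J (a * c - b * d) (a * d + b * c).
Proof.
move=> /qsphereE[j0 j1]; apply: quatP; rewrite quatME !slice_ptE //; last 3 first.
- by ring.
- by ring.
- by ring.
by rewrite -[b * d]mulr1 -j1; ring.
Qed.

Lemma slice_ptD J a b c d :
  slice_pt J a b + slice_pt J c d = slice_pt J (a + c) (b + d).
Proof. by rewrite /slice_pt addrACA -!scalerDl. Qed.

Lemma slice_ptZ J s a b : s *: slice_pt J a b = slice_pt J (s * a) (s * b).
Proof. by rewrite /slice_pt scalerDr !scalerA. Qed.

Lemma slice_pt1 J : slice_pt J 1 0 = 1.
Proof. by rewrite /slice_pt scale1r scale0r addr0. Qed.

Lemma slice_ptX J u v n : qsphere J ->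
  slice_pt J u v ^+ n = slice_pt J (cpw u v n).1 (cpw u v n).2.
Proof.
move=> hJ; elim: n => [|n IH]; first by rewrite expr0 slice_pt1.
by rewrite exprS IH slice_ptM //= [v * _ + _]addrC.
Qed.

Lemma qnorm_slice_pt J u v : qsphere J -> qnorm (slice_pt J u v) = Num.sqrt (u ^+ 2 + v ^+ 2).
Proof.
move=> /qsphereE[j0 j1]; rewrite /qnorm !slice_ptE // !exprMn; congr Num.sqrt.
by rewrite -[v ^+ 2 in RHS]mulr1 -j1; ring.
Qed.

Lemma qball_slice_pt J u v : qsphere J -> qball (slice_pt J u v) <-> u ^+ 2 + v ^+ 2 < 1.
Proof.
by move=> hJ; rewrite /qball /= qnorm_slice_pt // -[X in _ < X]sqrtr1 ltr_sqrt.
Qed.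

Lemma slice_exists q : exists J u v, qsphere J /\ q = slice_pt J u v.
Proof.
pose w := Num.sqrt (q1 q ^+ 2 + q2 q ^+ 2 + q3 q ^+ 2).
have w2 : w ^+ 2 = q1 q ^+ 2 + q2 q ^+ 2 + q3 q ^+ 2.
  by rewrite sqr_sqrtr // !addr_ge0 ?sqr_ge0.
have sph (J : quat R) : q0 J = 0 -> q1 J ^+ 2 + q2 J ^+ 2 + q3 J ^+ 2 = 1 -> qsphere J.
  move=> j0 j1; rewrite /qsphere /= expr2; apply: quatP;
    rewrite quatME quatNE quat1E j0; last 3 first.
  - by ring.
  - by ring.
  - by ring.
  by rewrite -j1; ring.
have [w0|w0] := eqVneq w 0.
  have h0 := sqr_ge0 (q1 q); have h1 := sqr_ge0 (q2 q); have h2 := sqr_ge0 (q3 q).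
  rewrite w0 expr0n /= in w2.
  have z x : x ^+ 2 = 0 -> x = 0 :> R by move=> /eqP; rewrite sqrf_eq0 => /eqP.
  have e1 : q1 q = 0 by apply: z; lra.
  have e2 : q2 q = 0 by apply: z; lra.
  have e3 : q3 q = 0 by apply: z; lra.
  (* A real quaternion lies in every slice; the unit i is one choice. *)
  exists (mkquat 0 1 0 0), (q0 q), 0; split.
    by apply: sph; rewrite !mkquatE //; ring.
  by apply: quatP; rewrite slice_ptE ?mkquatE // mul0r.
exists (mkquat 0 (q1 q / w) (q2 q / w) (q3 q / w)), (q0 q), w; split.
  apply: sph; rewrite !mkquatE // !expr_div_n -!mulrDl w2 mulfV // -w2.
  by rewrite expf_neq0.
by apply: quatP; rewrite slice_ptE ?mkquatE // mulrC divfK.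
Qed.

Lemma slice_ptV J a b : qsphere J -> slice_pt J a b != 0 ->
  (slice_pt J a b)^-1 = slice_pt J (a / (a ^+ 2 + b ^+ 2)) (- b / (a ^+ 2 + b ^+ 2)).
Proof.
move=> hJ h0.
have n0 : a ^+ 2 + b ^+ 2 != 0.
  apply: contra_neq h0 => e; have ha := sqr_ge0 a; have hb := sqr_ge0 b.
  have z x : x ^+ 2 = 0 -> x = 0 :> R by move=> /eqP; rewrite sqrf_eq0 => /eqP.
  have -> : a = 0 by apply: z; lra.
  have -> : b = 0 by apply: z; lra.
  by rewrite /slice_pt !scale0r addr0.
have u : slice_pt J a b \is a GRing.unit by [].
apply: (mulrI u); rewrite divrr // slice_ptM // -(slice_pt1 J).
by congr slice_pt; field.
Qed.

Let qnorm_im J b : qsphere J -> qnorm (b *: J) = `|b|.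
Proof.
move=> hJ; have -> : b *: J = slice_pt J 0 b by rewrite /slice_pt scale0r add0r.
by rewrite qnorm_slice_pt // expr0n add0r sqrtr_sqr.
Qed.

Lemma qim_slice_pt J a b : qsphere J -> qim (slice_pt J a b) = b *: J.
Proof.
by move=> /qsphereE[j0 _]; rewrite /qim slice_ptE // /slice_pt addrAC subrr add0r.
Qed.

(* An odd function of the angle does not see the choice of J or - J. *)
Lemma slice_odd J a b (f : R -> R) : qsphere J -> (forall x, f (- x) = - f x) ->
  f (qnorm (qim (slice_pt J a b))) *: qdir (slice_pt J a b) = f b *: J.
Proof.
move=> hJ fodd; rewrite /qdir qim_slice_pt // qnorm_im //.
have f0 : f 0 = 0 by have := fodd 0; rewrite oppr0; lra.
have [->|b0] := eqVneq b 0; first by rewrite normr0 f0 !scale0r.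
rewrite !scalerA; congr (_ *: _); have [bp|bn] := leP 0 b.
  by rewrite ger0_norm // -mulrA mulVf // mulr1.
by rewrite ltr0_norm // fodd invrN mulrNN -mulrA mulVf // mulr1.
Qed.

Lemma qexp_slice_pt J a b : qsphere J ->
  qexp (slice_pt J a b) = slice_pt J (expR a * cos b) (expR a * sin b).
Proof.
move=> hJ; rewrite -slice_ptZ /qexp; have [j0 _] := qsphereE hJ.
rewrite slice_ptE // (slice_odd _ _ hJ (@sinN R)) qim_slice_pt // qnorm_im //.
by rewrite cos_norm.
Qed.

(** For a > 0 the angle acos(a / rho) is atan(|b| / a); [slice_odd] and the parity of the cosine
    then restore the sign of b. *)
Lemma qpow_slice_pt J a b s : qsphere J -> 0 < a ->
  qpow (slice_pt J a b) s =
  slice_pt J (Num.sqrt (a ^+ 2 + b ^+ 2) `^ s * cos (s * atan (b / a)))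
             (Num.sqrt (a ^+ 2 + b ^+ 2) `^ s * sin (s * atan (b / a))).
Proof.
move=> hJ a0; rewrite -slice_ptZ /qpow; have [j0 _] := qsphereE hJ.
rewrite slice_ptE // qnorm_slice_pt //; set rho := Num.sqrt _.
have e : acos (a / rho) = atan (`|b| / a).
  have -> : a / rho = cos (atan (`|b| / a)).
    rewrite cos_atan; have -> : 1 + (`|b| / a) ^+ 2 = (rho / a) ^+ 2.
      rewrite !expr_div_n real_normK ?num_real // sqr_sqrtr ?addr_ge0 ?sqr_ge0 //.
      by field; rewrite gt_eqF.
    by rewrite sqrtr_sqr ger0_norm ?invf_div // divr_ge0 ?sqrtr_ge0 // ltW.
  apply: cosK; rewrite in_itv /=; apply/andP; split.
    by rewrite -(@atan0 R) le_atan // divr_ge0 // ltW.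
  have := atan_ltpi2 (`|b| / a); have := @pi_gt0 R; lra.
rewrite e; pose f x := sin (s * atan (x / a)).
have fodd x : f (- x) = - f x by rewrite /f mulNr atanN mulrN sinN.
have := slice_odd a b hJ fodd; rewrite qim_slice_pt // qnorm_im // /f => ->.
congr (_ *: (_ + _)); congr (_ %:A).
have [b0|b0] := leP 0 b; first by rewrite ger0_norm.
by rewrite ltr0_norm // mulNr atanN mulrN cosN.
Qed.

Lemma cvg_slice_pt J T (F : set_system T) (FF : Filter F) (f g : T -> R) (a b : R) :
  f @ F --> a -> g @ F --> b -> (fun t => slice_pt J (f t) (g t)) @ F --> slice_pt J a b.
Proof.
move=> fa gb; apply: (@cvgD _ (quat R)); apply: (@cvgZr_tmp _ (quat R)) => //.
Qed.

End Slices.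

(** * Summation of a double series along diagonals *)

Section Tannery.
Variables (R : realType) (V : normedModType R).
Variables (A : nat -> nat -> V) (M : nat -> R) (s : nat -> V) (l : V).
Hypothesis A_le : forall n k, `|\sum_(0 <= j < k) A n j| <= M n.
Hypothesis cM : cvgn (series M).
Hypothesis rows : forall n, series (A n) @ \oo --> s n.
Hypothesis cs : series s @ \oo --> l.

Let diag m := \sum_(0 <= n < m.+1) A n (m - n).

(** The first K diagonals fill the triangle n + j < K, that is, row n cut at K - n. *)
Let series_diag K : series diag K = \sum_(0 <= n < K) \sum_(0 <= j < K - n) A n j.
Proof.
elim: K => [|K IH]; first by rewrite /series /= !big_geq.
rewrite seriesSr IH [RHS]big_nat_recr //= subSnn big_nat1.
rewrite [diag K]big_nat_recr //= subnn addrA; congr (_ + _).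
rewrite -big_split /=; apply: eq_big_nat => n /andP[_ hn].
by rewrite subSn ?(ltnW hn) // [RHS]big_nat_recr.
Qed.

(** Rows beyond N contribute at most the tail of [M], wherever they are cut, and the finitely many
    others converge. This is why [A_le] speaks of every truncation of a row. *)
Lemma cvg_series_diag : series (fun m => \sum_(0 <= n < m.+1) A n (m - n)) @ \oo --> l.
Proof.
have -> : series (fun m => \sum_(0 <= n < m.+1) A n (m - n)) = series diag by [].
apply/cvgrPdist_le => e e0.
have M0 n : 0 <= M n by apply: le_trans (A_le n 0).
have e3 : 0 < e / 3 by rewrite divr_gt0.
have /cvgrPdist_lt hM := cM; have /cvgrPdist_lt hs := cs.
have [N [hN1 hN2]] : exists N, `|limn (series M) - series M N| < e / 3 /\
    `|l - series s N| < e / 3.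
  by have [N _ h] := filterI (hM _ e3) (hs _ e3); exists N; apply: h => /=.
have fin k : (fun K => \sum_(0 <= n < k) \sum_(0 <= j < K - n) A n j) @ \oo --> series s k.
  elim: k => [|k IH].
    rewrite /series /= big_geq //; under eq_fun do rewrite big_geq //.
    exact: cvg_cst.
  rewrite seriesSr; under eq_fun do rewrite big_nat_recr //=.
  apply: cvgD => //; rewrite -(cvg_shiftn k).
  by under eq_fun do rewrite addnK; exact: rows.
near=> K.
have NK : (N <= K)%N by near: K; exact: nbhs_infty_ge.
rewrite series_diag (@big_cat_nat _ _ _ N) //=.
set S1 := \sum_(0 <= i < N) _; set S2 := \sum_(N <= i < K) _.
have h1 : `|series s N - S1| < e / 3.
  by rewrite /S1; near: K; move/cvgrPdist_lt : (fin N); apply.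
have h2 : `|S2| <= e / 3.
  apply: le_trans (ler_norm_sum _ _ _) _.
  apply: (@le_trans _ _ (\sum_(N <= i < K) M i)).
    by apply: ler_sum => i _; exact: A_le.
  have -> : \sum_(N <= i < K) M i = series M K - series M N.
    by rewrite sub_series_geq.
  have hK : series M K <= limn (series M).
    by apply: nondecreasing_cvgn_le => //; apply: nondecreasing_series => *.
  apply: le_trans (ltW hN1); apply: le_trans (ler_norm _).
  by rewrite lerD2r.
have -> : l - (S1 + S2) = (l - series s N) + ((series s N - S1) - S2).
  by rewrite addrA subrKA opprD addrA.
apply: le_trans (ler_normD _ _) _.
have := ler_normB (series s N - S1) S2; lra.
Unshelve. all: by end_near. Qed.

End Tannery.

(** * The kernel as a power series in q *)

Section HardyHille.
Variable R : realType.
Variables (a x y u v : R) (J : quat R).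
Hypotheses (a_gt : -1 < a) (x_ge0 : 0 <= x) (y_ge0 : 0 <= y).
Hypotheses (hJ : qsphere J) (uv_lt1 : u ^+ 2 + v ^+ 2 < 1).
Implicit Types (b t : R) (n m : nat).

Let z := x + y.
Let z_ge0 : 0 <= z. Proof. exact: addr_ge0. Qed.
Let q := slice_pt J u v.
Let r := qnorm q.
Let r_ge0 : 0 <= r. Proof. exact: qnorm_ge0. Qed.
Let r_lt1 : r < 1. Proof. exact/(qball_slice_pt _ _ hJ). Qed.
Let rE : r = Num.sqrt (u ^+ 2 + v ^+ 2). Proof. exact: qnorm_slice_pt. Qed.

Let H b := slice_pt J (gen z u v 1 0 b 1) (gen z u v 0 1 b 1).

Let one_r : `|1 : R| * Num.sqrt (u ^+ 2 + v ^+ 2) < 1.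
Proof. by rewrite normr1 mul1r -rE. Qed.

Let gen_series b : -1 < b ->
  series (fun m => (laguerre b m).[z] *: q ^+ m) @ \oo --> H b.
Proof.
move=> hb; rewrite (_ : series _ = fun k => slice_pt J (pseries (gen_coef z u v 1 0 b) 1 k)
   (pseries (gen_coef z u v 0 1 b) 1 k)); last first.
  apply/funext => k; rewrite /pseries /series /=.
  elim: k => [|k IH]; first by rewrite !big_geq // /slice_pt !scale0r addr0.
  rewrite !big_nat_recr //= IH -slice_ptD slice_ptX // slice_ptZ expr1n !mulr1.
  by congr (_ + slice_pt _ _ _); rewrite /gen_coef; ring.
by apply: cvg_slice_pt; apply: cvg_gen.
Qed.

Let one_q : 1 - q = slice_pt J (1 - u) (- v).
Proof. by rewrite -(slice_pt1 J) /q -scaleN1r slice_ptZ slice_ptD; congr slice_pt; ring. Qed.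

Let one_q_neq0 : 1 - q != 0.
Proof.
rewrite subr_eq0; apply/eqP => e; have := r_lt1.
by rewrite /r -e qnorm1 ltxx.
Qed.

Let H_pascal b : -1 < b -> (1 - q) * H (b + 1) = H b.
Proof.
move=> hb; have hb1 : -1 < b + 1 by lra.
rewrite one_q /H slice_ptM // !(gen_pascal z_ge0 _ _ hb one_r).
rewrite (gen_lin z_ge0 (1 * u + 0 * v) _ hb1 one_r).
rewrite (gen_lin z_ge0 (0 * u + 1 * v) _ hb1 one_r).
by congr slice_pt; ring.
Qed.

(** Each unit in the parameter costs one factor (1 - q)^-1; this is the origin of the powers (1 -
    q)^(-2n) in the Bessel series. *)
Let H_shift n : H (a + (2 * n)%:R) = (1 - q) ^- (2 * n) * H a.
Proof.
have hn m : -1 < a + m%:R by apply: lt_le_trans a_gt _; rewrite lerDl.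
have e m : (1 - q) ^+ m * H (a + m%:R) = H a.
  elim: m => [|m IH]; first by rewrite expr0 mul1r addr0.
  by rewrite exprSr -mulrA -natr1 addrA H_pascal.
by rewrite -(e (2 * n)%N) mulKr // unitrX // unitfE.
Qed.

Let comm_qH : GRing.comm q (H a).
Proof. by rewrite /GRing.comm /q /H !slice_ptM //; congr slice_pt; ring. Qed.

(** Since |q| < 1, the real part of 1 - q is positive, so its principal power is the one expressed
    by atan in [gen_value]. The two formulas then agree in modulus and in angle. *)
Let H_value : H a =
  qpow (1 - q) (- a - 1) * qexp (- ((x + y) *: (q / (1 - q)))).
Proof.
have u1 : 0 < 1 - u.
  have := normr_qcoord q; rewrite -/r => -[h _ _ _].
  have [j0 _] := qsphereE hJ; rewrite /q slice_ptE // in h.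
  by rewrite subr_gt0; apply: le_lt_trans r_lt1; exact: le_trans (ler_norm u) h.
have [] := gen_value z_ge0 uv_lt1 a_gt.
set n := (1 - u) ^+ 2 + v ^+ 2; set X := (a + 1) / 2 * _ + _.
set Y := (a + 1) * _ + _ => h1 h2; rewrite /H h1 h2.
have n0 : 0 < n by rewrite ltr_wpDr ?sqr_ge0 // exprn_gt0.
have nV : (1 - u) ^+ 2 + (- v) ^+ 2 = n by rewrite sqrrN.
rewrite one_q qpow_slice_pt // slice_ptV -?one_q // nV /q slice_ptM //.
rewrite -scaleNr slice_ptZ qexp_slice_pt // slice_ptM //.
set rho := Num.sqrt n; have rho0 : 0 < rho by rewrite sqrtr_gt0.
have hln : ln n = 2 * ln rho.
  have <- : rho ^+ 2 = n by rewrite sqr_sqrtr // ltW.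
  by rewrite lnXn // mulr_natl.
have eY : - Y = (- a - 1) * atan (- v / (1 - u)) +
    - (x + y) * (u * (- - v / n) + v * ((1 - u) / n)).
  by rewrite /Y /z; field; rewrite gt_eqF.
have eX : expR (- X) = rho `^ (- a - 1) *
    expR (- (x + y) * (u * ((1 - u) / n) - v * (- - v / n))).
  rewrite /powR gt_eqF // -expRD; congr expR; rewrite /X hln /z.
  by field; rewrite gt_eqF.
by rewrite eY cosD sinD eX; congr slice_pt; ring.
Qed.

(** The series of majorants at the radius r = |q|. It obeys the same shift rule as [H], with 1 - r
    in place of 1 - q, and so bounds the rows of the double series by [T a] times a summable
    sequence. *)
Let T b := limn (series (fun m => (laguerre b m).[- z] * r ^+ m)).

Let T_series b : -1 < b -> series (fun m => (laguerre b m).[- z] * r ^+ m) @ \oo --> T b.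
Proof. by move=> hb; apply: laguerre_summable => //; rewrite r_ge0. Qed.

Let T_pascal b : -1 < b -> T b = (1 - r) * T (b + 1).
Proof.
move=> hb; have hb1 : -1 < b + 1 by lra.
apply/cvg_lim => //; rewrite -cvg_shiftS.
pose f b m := (laguerre b m).[- z] * r ^+ m.
rewrite (_ : (fun n => _) = fun k => series (f (b + 1)) k.+1 - r * series (f (b + 1)) k); last first.
  apply/funext; elim=> [|k IH].
    by rewrite /series /= !big_nat1 big_geq // mulr0 subr0 /f !laguerre0.
  rewrite seriesSr IH [in RHS](seriesSr _ k.+1) [X in _ = _ - _ * X]seriesSr /f.
  by rewrite laguerre_pascal hornerD exprS; ring.
rewrite mulrBl mul1r; apply: cvgB; first by rewrite cvg_shiftS; exact: T_series.
by apply: cvgM; [exact: cvg_cst|exact: T_series].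
Qed.

Let T_shift n : T (a + (2 * n)%:R) = T a / (1 - r) ^+ (2 * n).
Proof.
have r1 : 1 - r != 0 by rewrite subr_eq0 gt_eqF.
have hn m : -1 < a + m%:R by apply: lt_le_trans a_gt _; rewrite lerDl.
elim: (2 * n)%N => [|m IH]; first by rewrite addr0 expr0 divr1.
apply: (mulfI r1); rewrite -natr1 addrA -T_pascal // IH exprS.
by field; rewrite expf_neq0.
Qed.

Let w n := (x * y) ^+ n / (n`!%:R * gmom a n).

Let w_ge0 n : 0 <= w n.
Proof.
by rewrite divr_ge0 ?exprn_ge0 ?mulr_ge0 // ltW // gmom_gt0.
Qed.

Let w_summable t : 0 <= t -> cvgn (series (fun n => w n * t ^+ n)).
Proof.
move=> t0; pose k := x * y * t / (a + 1).
have a1 : 0 < a + 1 by have := a_gt; lra.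
have k0 : 0 <= k by rewrite divr_ge0 ?mulr_ge0 // ltW.
(* Each step of the recurrence of the moments multiplies by at least a + 1, which leaves the
   exponential series of [k] as majorant. *)
have gm n : gmom a 0 * (a + 1) ^+ n <= gmom a n.
  elim: n => [|n IH]; first by rewrite expr0 mulr1.
  rewrite exprS mulrCA gmomS //; apply: ler_pM => //; first exact: ltW.
  - by rewrite mulr_ge0 ?exprn_ge0 ?(ltW (gmom_gt0 _ _)) // ltW.
  - by rewrite lerD2l ler1n.
have g0 := gmom_gt0 0 a_gt.
apply: (@series_le_cvg _ _ (fun n => (gmom a 0)^-1 * exp_coeff k n)).
- by move=> n; rewrite mulr_ge0 ?exprn_ge0.
- by move=> n; rewrite mulr_ge0 ?invr_ge0 ?(ltW g0) // exp_coeff_ge0.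
- move=> n; rewrite /exp_coeff /= /k.
  have e : w n * t ^+ n = (x * y * t) ^+ n / n`!%:R * (gmom a n)^-1.
    by rewrite /w !exprMn invfM; ring.
  rewrite e (_ : _^-1 * _ = (x * y * t) ^+ n / n`!%:R * (gmom a 0 * (a + 1) ^+ n)^-1); last first.
    by rewrite expr_div_n invfM; ring.
  apply: ler_wpM2l; first by rewrite divr_ge0 ?exprn_ge0 ?mulr_ge0.
  by rewrite lef_pV2 ?posrE ?gmom_gt0 // mulr_gt0 // exprn_gt0.
- exact: (is_cvg_seriesZ (f := exp_coeff k)) (is_cvg_series_exp_coeff k).
Qed.

Let qnormV (p : quat R) : p != 0 -> qnorm p^-1 = (qnorm p)^-1.
Proof.
move=> p0; have h : qnorm p * qnorm p^-1 = 1 by rewrite -qnormM mulrV ?qnorm1 // unitfE.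
have n0 : qnorm p != 0 by apply/eqP => e; move: h; rewrite e mul0r => /eqP; rewrite eq_sym oner_eq0.
by apply: (mulfI n0); rewrite h mulfV.
Qed.

Let e n : quat R := (n`!%:R * gmom a n)^-1 *: (((x * y) *: q) ^+ n * (1 - q) ^- (2 * n)).

Let e_norm n : qnorm (e n) <= w n * (r / (1 - r) ^+ 2) ^+ n.
Proof.
have r1 : 0 < 1 - r by rewrite subr_gt0.
have h : 1 - r <= qnorm (1 - q).
  have := qnormD (1 - q) q; rewrite subrK qnorm1 -/r; lra.
rewrite /e qnormZ qnormM qnormX qnormZ -/r ger0_norm; last first.
  by rewrite invr_ge0 mulr_ge0 // ltW // gmom_gt0.
have u2 : (1 - q) ^+ (2 * n) != 0.
  have h1 : 1 - q \is a GRing.unit by exact: one_q_neq0.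
  exact: (unitrX (2 * n) h1).
rewrite ger0_norm ?mulr_ge0 // (qnormV u2) qnormX.
rewrite [X in _ <= X](_ : _ = (n`!%:R * gmom a n)^-1 * ((x * y * r) ^+ n *
  ((1 - r) ^+ (2 * n))^-1)); last first.
  by rewrite /w expr_div_n -exprM !exprMn; ring.
apply: ler_wpM2l; first by rewrite invr_ge0 mulr_ge0 // ltW // gmom_gt0.
apply: ler_wpM2l; first by rewrite exprn_ge0 ?mulr_ge0.
rewrite lef_pV2 ?posrE ?exprn_gt0 //; last by apply: lt_le_trans h.
by apply: lerXn2r; rewrite ?nnegrE ?(ltW r1) ?qnorm_ge0.
Qed.

Let cvg_e : cvgn (series e).
Proof.
apply: (@normed_cvg R (quat R)).
apply: (@series_le_cvg _ _ (fun n => w n * (r / (1 - r) ^+ 2) ^+ n)).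
- by move=> n; exact: normr_ge0.
- by move=> n; rewrite mulr_ge0 // exprn_ge0 // divr_ge0 // sqr_ge0.
- by move=> n; apply: le_trans (normr_le_qnorm _) (e_norm n).
- by apply: w_summable; rewrite divr_ge0 // sqr_ge0.
Qed.

(** The array A n j = w_n L_j^(a+2n)(x + y) q^(n+j) is summed in two ways. Along the diagonals n + j
    = m, [hardy_hille_coef] gives the Laguerre products; along the rows, [H_shift] gives [H a] times
    the terms [e n] of the Bessel series. *)
Lemma Rker_series_slice :
  series (fun m => ((laguerre a m).[x] * (laguerre a m).[y] / lag_norm a m) *: q ^+ m)
    @ \oo --> Rker a q x y.
Proof.
rewrite /Rker -H_value.
have -> : H a * limn (series (fun n => (n`!%:R * Gamma (a + n%:R + 1))^-1 *:
    (((x * y) *: q) ^+ n * (1 - q) ^- (2 * n)))) = H a * limn (series e) by [].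
have hn m : -1 < a + m%:R by apply: lt_le_trans a_gt _; rewrite lerDl.
pose A n j := (w n * (laguerre (a + (2 * n)%:R) j).[z]) *: q ^+ (n + j).
rewrite (_ : series _ = series (fun m => \sum_(0 <= n < m.+1) A n (m - n)%N)); last first.
  congr (series _); apply/funext => m.
  rewrite (eq_big_nat _ _ (F2 := fun n => (w n * (laguerre (a + (2 * n)%:R) (m - n)%N).[z]) *: q ^+ m)).
    rewrite -scaler_suml; congr (_ *: _); rewrite big_mkord.
    rewrite -(hardy_hille_coef y a_gt (gmom_gt0 0 a_gt) (fun k => gmomS k a_gt)) /lag_norm.
    by rewrite invf_div; ring.
  by move=> n /andP[_ hnm]; rewrite /A subnKC.
apply: (@cvg_series_diag _ _ A (fun n => T a * (w n * (r / (1 - r) ^+ 2) ^+ n)) (fun n => H a * e n)).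
- move=> n k; apply: le_trans (ler_norm_sum _ _ _) _.
  apply: (@le_trans _ _ (w n * r ^+ n * \sum_(0 <= j < k) (laguerre (a + (2 * n)%:R) j).[- z] * r ^+ j)).
    rewrite mulr_sumr; apply: ler_sum => j _; rewrite normrZ exprD.
    apply: (@le_trans _ _ (w n * (laguerre (a + (2 * n)%:R) j).[- z] * (r ^+ n * r ^+ j))); last by
      rewrite le_eqVlt; apply/orP; left; apply/eqP; ring.
    rewrite normrM (ger0_norm (w_ge0 n)); apply: ler_pM => //.
    + by rewrite mulr_ge0.
    + by apply: ler_wpM2l => //; exact: normr_laguerre.
    + by apply: le_trans (normr_le_qnorm _) _; rewrite qnormM !qnormX.
  rewrite [X in _ <= X](_ : _ = w n * r ^+ n * T (a + (2 * n)%:R)); last first.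
    by rewrite T_shift expr_div_n -exprM; ring.
  apply: ler_wpM2l; first by rewrite mulr_ge0 ?exprn_ge0.
  apply: (nondecreasing_cvgn_le (u_ := series _)); last exact: T_series.
  by apply: nondecreasing_series => j _ _; rewrite mulr_ge0 ?laguerre_neg_ge0 ?exprn_ge0.
- apply: (is_cvg_seriesZ (f := fun n => w n * (r / (1 - r) ^+ 2) ^+ n)).
  by apply: w_summable; rewrite divr_ge0 // sqr_ge0.
- move=> n; have -> : H a * e n = w n *: (q ^+ n * H (a + (2 * n)%:R)).
    have -> : e n = w n *: (q ^+ n * (1 - q) ^- (2 * n)).
      by rewrite /e exprZn -scalerAl scalerA mulrC.
    rewrite H_shift -scalerAr; congr (_ *: _).
    rewrite mulrA (commrX n (commr_sym comm_qH)) -!mulrA; congr (_ * _).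
    apply: commrV; apply: commrX.
    by apply: commrB; [exact: commr1|apply: commr_sym].
  rewrite (_ : series (A n) = fun k => w n *: (q ^+ n *
    series (fun m => (laguerre (a + (2 * n)%:R) m).[z] *: q ^+ m) k)); last first.
    apply/funext => k; rewrite /series /= mulr_sumr scaler_sumr.
    by apply: eq_bigr => j _; rewrite /A -scalerAr scalerA exprD.
  apply: (@cvgZl_tmp _ (quat R)); apply: cvg_qmull; exact: gen_series.
- rewrite (_ : series _ = fun k => H a * series e k); last first.
    by apply/funext => k; rewrite /series /= mulr_sumr.
  by apply: cvg_qmull; exact: cvg_e.
Qed.

End HardyHille.

Theorem Rker_series (R : realType) (a x y : R) (q : quat R) :
  -1 < a -> 0 <= x -> 0 <= y -> qball q ->
  series (fun m => ((laguerre a m).[x] * (laguerre a m).[y] / lag_norm a m) *: q ^+ m)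
    @ \oo --> Rker a q x y.
Proof.
move=> ha hx hy; have [J [u [v [hJ ->]]]] := slice_exists q.
by move=> /(qball_slice_pt _ _ hJ) huv; exact: Rker_series_slice.
Qed.

(** The right-hand side has minimum 2 sqrt(a b) over t. Testing t = X / a suffices, and for a = 0 a
    large t contradicts X > 0. *)
Lemma sqr_le_mul_of_scaled (R : realType) (X a b : R) : 0 <= X -> 0 <= a -> 0 <= b ->
  (forall t, 0 < t -> 2 * X <= t * a + t^-1 * b) -> X ^+ 2 <= a * b.
Proof.
move=> X0 a0 b0 h; have [->|Xn] := eqVneq X 0; first by rewrite expr0n mulr_ge0.
have Xp : 0 < X by rewrite lt_neqAle eq_sym Xn.
have [ea|an] := eqVneq a 0.
  have b1 : 0 < b + 1 by rewrite ltr_wpDl.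
  have := h ((b + 1) / X); rewrite divr_gt0 // => /(_ isT).
  rewrite ea mulr0 add0r invf_div mulrAC ler_pdivlMr // => h1.
  have : X * b <= X * (b + 1) by rewrite ler_pM2l // lerDl.
  have : 0 < X * (b + 1) by rewrite mulr_gt0.
  lra.
have ap : 0 < a by rewrite lt_neqAle eq_sym an.
have := h (X / a); rewrite divr_gt0 // => /(_ isT).
rewrite divfK // invf_div => h1.
have : X <= a * b / X by have -> : a * b / X = a / X * b; [ring|lra].
by rewrite ler_pdivlMr // expr2.
Qed.

(** * Cauchy-Schwarz for real and quaternionic integrals *)

Section IntegralBounds.
Context d (T : measurableType d) (R : realType) (mu : {measure set T -> \bar R}).
Variables (D : set T) (mD : measurable D).
Implicit Types (f g A B : T -> R) (h k : T -> quat R).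

Lemma le_integrableR f g : measurable_fun D f -> (forall x, D x -> `|f x| <= g x) ->
  mu.-integrable D (EFin \o g) -> mu.-integrable D (EFin \o f).
Proof.
move=> mf fg ig; apply: le_integrable ig => //; first by apply/measurable_EFinP.
by move=> x Dx; rewrite /= lee_fin; apply: le_trans (fg x Dx) (ler_norm _).
Qed.

Lemma ge0_integrableR f : measurable_fun D f -> (forall x, D x -> 0 <= f x) ->
  (\int[mu]_(x in D) (f x)%:E < +oo)%E -> mu.-integrable D (EFin \o f).
Proof.
move=> mf f0 fi; apply/integrableP; split; first by apply/measurable_EFinP.
apply: le_lt_trans fi; rewrite le_eqVlt; apply/orP; left; apply/eqP.
by apply: eq_integral => x /set_mem Dx; rewrite /= ger0_norm // f0.
Qed.

Lemma Rintegral_EFin f : mu.-integrable D (EFin \o f) ->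
  (\int[mu]_(x in D) (f x)%:E)%E = (\int[mu]_(x in D) f x)%:E.
Proof. by move=> fi; rewrite /Rintegral fineK //; exact: integrable_fin_num fi. Qed.

Lemma integrableZR (k : R) f : mu.-integrable D (EFin \o f) ->
  mu.-integrable D (EFin \o (fun x => k * f x)).
Proof. by move=> fi; exact: (integrableZl mD k fi). Qed.

Lemma integrableDR f g : mu.-integrable D (EFin \o f) -> mu.-integrable D (EFin \o g) ->
  mu.-integrable D (EFin \o (fun x => f x + g x)).
Proof. by move=> fi gi; exact: (integrableD mD fi gi). Qed.

(** Integrating |f| <= (t A + B / t) / 2 for every t > 0 gives the family of bounds of
    [sqr_le_mul_of_scaled]; the case t = 1 also yields the integrability of f. *)
Lemma integral_CauchySchwarz f A B : measurable_fun D f ->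
  mu.-integrable D (EFin \o A) -> mu.-integrable D (EFin \o B) ->
  (forall x, D x -> 0 <= A x) -> (forall x, D x -> 0 <= B x) ->
  (forall x, D x -> f x ^+ 2 <= A x * B x) ->
  mu.-integrable D (EFin \o f) /\
  (\int[mu]_(x in D) f x) ^+ 2 <= (\int[mu]_(x in D) A x) * (\int[mu]_(x in D) B x).
Proof.
move=> mf iA iB A0 B0 fAB.
have amgm t x : 0 < t -> D x -> `|f x| <= 2^-1 * (t * A x + t^-1 * B x).
  move=> t0 Dx; have ti : 0 < t^-1 by rewrite invr_gt0.
  have hA := A0 x Dx; have hB := B0 x Dx.
  have p0 : 0 <= 2^-1 * (t * A x + t^-1 * B x).
    by rewrite mulr_ge0 // addr_ge0 // mulr_ge0 // ltW.
  rewrite -(@ler_pXn2r _ 2) ?nnegrE // real_normK ?num_real //.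
  apply: le_trans (fAB x Dx) _.
  have e : t * t^-1 = 1 by rewrite mulfV // gt_eqF.
  have e2 : (t * A x) * (t^-1 * B x) = A x * B x by rewrite mulrACA e mul1r.
  rewrite -e2 -subr_ge0; move: (t * A x) (t^-1 * B x) => u v.
  rewrite (_ : _ - _ = 2^-1 ^+ 2 * (u - v) ^+ 2); last by field.
  by rewrite mulr_ge0 // sqr_ge0.
have iAB t : mu.-integrable D (EFin \o (fun x => 2^-1 * (t * A x + t^-1 * B x))).
  by apply: integrableZR; apply: integrableDR; apply: integrableZR.
have intf : mu.-integrable D (EFin \o f).
  by apply: le_integrableR (iAB 1) => // x Dx; apply: amgm.
split=> //; rewrite -[X in X <= _]real_normK ?num_real //.
apply: sqr_le_mul_of_scaled => //; try by apply: Rintegral_ge0.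
move=> t t0; apply: (@le_trans _ _ (2 * \int[mu]_(x in D) (2^-1 * (t * A x + t^-1 * B x)))).
  rewrite ler_pM2l //; apply: le_trans (le_normr_Rintegral mD intf) _.
  apply: le_Rintegral => //; last by move=> x Dx; exact: amgm.
  by apply: le_integrableR (iAB 1) => [|x Dx]; [exact: measurableT_comp|rewrite normr_id; exact: amgm].
rewrite RintegralZl //; last by apply: integrableDR; apply: integrableZR.
rewrite RintegralD //; [|exact: integrableZR|exact: integrableZR].
by rewrite !RintegralZl // mulrA mulfV // mul1r.
Qed.

Definition qintegrable h : Prop :=
  [/\ mu.-integrable D (EFin \o (q0 \o h)), mu.-integrable D (EFin \o (q1 \o h)),
      mu.-integrable D (EFin \o (q2 \o h)) & mu.-integrable D (EFin \o (q3 \o h))].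

Lemma qintegrable0 : qintegrable (fun=> 0).
Proof.
have e (f : quat R -> R) : f 0 = 0 -> mu.-integrable D (EFin \o (f \o (fun=> 0))).
  move=> f0; rewrite (_ : _ \o _ = cst 0%E); first exact: integrable0.
  by apply/funext => x /=; rewrite f0.
by split; [apply: (e (@q0 R))|apply: (e (@q1 R))|apply: (e (@q2 R))|apply: (e (@q3 R))];
  rewrite quat0E.
Qed.

Lemma qintegrableD h k : qintegrable h -> qintegrable k -> qintegrable (fun x => h x + k x).
Proof.
move=> [h0 h1 h2 h3] [k0 k1 k2 k3]; split.
- rewrite (_ : _ \o _ = (EFin \o (q0 \o h)) \+ (EFin \o (q0 \o k)))%E.
    exact: integrableD.
  by apply/funext => x /=; rewrite quatDE.
- rewrite (_ : _ \o _ = (EFin \o (q1 \o h)) \+ (EFin \o (q1 \o k)))%E.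
    exact: integrableD.
  by apply/funext => x /=; rewrite quatDE.
- rewrite (_ : _ \o _ = (EFin \o (q2 \o h)) \+ (EFin \o (q2 \o k)))%E.
    exact: integrableD.
  by apply/funext => x /=; rewrite quatDE.
- rewrite (_ : _ \o _ = (EFin \o (q3 \o h)) \+ (EFin \o (q3 \o k)))%E.
    exact: integrableD.
  by apply/funext => x /=; rewrite quatDE.
Qed.

Lemma qintegralD h k : qintegrable h -> qintegrable k ->
  qintegral mu D (fun x => h x + k x) = qintegral mu D h + qintegral mu D k.
Proof.
move=> [h0 h1 h2 h3] [k0 k1 k2 k3]; rewrite /qintegral; apply: quatP; rewrite quatDE !mkquatE -RintegralD //;
  by apply: eq_Rintegral => x _; rewrite quatDE.
Qed.

Lemma qintegral0 : qintegral mu D (fun=> 0) = 0.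
Proof.
by apply: quatP; rewrite /qintegral !mkquatE !quat0E /Rintegral integral0.
Qed.

(** Left multiplication by a quaternion acts on coordinates through a real 4 x 4 matrix; this
    handles one of its rows. *)
Let lin4 f0 f1 f2 f3 (c0 c1 c2 c3 : R) :
  mu.-integrable D (EFin \o f0) -> mu.-integrable D (EFin \o f1) ->
  mu.-integrable D (EFin \o f2) -> mu.-integrable D (EFin \o f3) ->
  mu.-integrable D (EFin \o (fun x => c0 * f0 x + c1 * f1 x + c2 * f2 x + c3 * f3 x)) /\
  \int[mu]_(x in D) (c0 * f0 x + c1 * f1 x + c2 * f2 x + c3 * f3 x) =
  c0 * (\int[mu]_(x in D) f0 x) + c1 * (\int[mu]_(x in D) f1 x) +
  c2 * (\int[mu]_(x in D) f2 x) + c3 * (\int[mu]_(x in D) f3 x).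
Proof.
move=> i0 i1 i2 i3.
have j0 := integrableZR c0 i0; have j1 := integrableZR c1 i1.
have j2 := integrableZR c2 i2; have j3 := integrableZR c3 i3.
have k1 := integrableDR j0 j1; have k2 := integrableDR k1 j2.
split; first exact: integrableDR k2 j3.
by rewrite !RintegralD // !RintegralZl.
Qed.

Lemma qintegralMl (p : quat R) h : qintegrable h ->
  qintegrable (fun x => p * h x) /\
  qintegral mu D (fun x => p * h x) = p * qintegral mu D h.
Proof.
move=> [h0 h1 h2 h3].
have [a0 b0] := lin4 (q0 p) (- q1 p) (- q2 p) (- q3 p) h0 h1 h2 h3.
have [a1 b1] := lin4 (q1 p) (q0 p) (- q3 p) (q2 p) h0 h1 h2 h3.
have [a2 b2] := lin4 (q2 p) (q3 p) (q0 p) (- q1 p) h0 h1 h2 h3.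
have [a3 b3] := lin4 (q3 p) (- q2 p) (q1 p) (q0 p) h0 h1 h2 h3.
have e0 x : q0 (p * h x) = q0 p * q0 (h x) + - q1 p * q1 (h x) + - q2 p * q2 (h x) + - q3 p * q3 (h x).
  by rewrite quatME; ring.
have e1 x : q1 (p * h x) = q1 p * q0 (h x) + q0 p * q1 (h x) + - q3 p * q2 (h x) + q2 p * q3 (h x).
  by rewrite quatME; ring.
have e2 x : q2 (p * h x) = q2 p * q0 (h x) + q3 p * q1 (h x) + q0 p * q2 (h x) + - q1 p * q3 (h x).
  by rewrite quatME; ring.
have e3 x : q3 (p * h x) = q3 p * q0 (h x) + - q2 p * q1 (h x) + q1 p * q2 (h x) + q0 p * q3 (h x).
  by rewrite quatME; ring.
split.
  split; [move: a0|move: a1|move: a2|move: a3]; congr (integrable _ _ _); apply/funext => x /=;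
    by rewrite ?e0 ?e1 ?e2 ?e3.
apply: quatP; rewrite quatME /qintegral !mkquatE.
- by apply: etrans (etrans b0 _); [apply: eq_Rintegral => x _; exact: e0|ring].
- by apply: etrans (etrans b1 _); [apply: eq_Rintegral => x _; exact: e1|ring].
- by apply: etrans (etrans b2 _); [apply: eq_Rintegral => x _; exact: e2|ring].
- by apply: etrans (etrans b3 _); [apply: eq_Rintegral => x _; exact: e3|ring].
Qed.

Lemma qintegral_sum n (h : nat -> T -> quat R) : (forall i, qintegrable (h i)) ->
  qintegrable (fun x => \sum_(0 <= i < n) h i x) /\
  qintegral mu D (fun x => \sum_(0 <= i < n) h i x) = \sum_(0 <= i < n) qintegral mu D (h i).
Proof.
move=> hi; elim: n => [|n [IH1 IH2]].
  rewrite big_geq //; rewrite (_ : (fun x => _) = fun=> 0); last first.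
    by apply/funext => x; rewrite big_geq.
  by split; [exact: qintegrable0|exact: qintegral0].
rewrite (_ : (fun x => _) = fun x => \sum_(0 <= i < n) h i x + h n x); last first.
  by apply/funext => x; rewrite big_nat_recr.
by split; [exact: qintegrableD|rewrite qintegralD // IH2 big_nat_recr].
Qed.

(** The factor 4 is the price of bounding each of the four coordinates separately by the modulus. *)
Lemma qintegral_CauchySchwarz h A B : qmeasurable D h ->
  mu.-integrable D (EFin \o A) -> mu.-integrable D (EFin \o B) ->
  (forall x, D x -> 0 <= A x) -> (forall x, D x -> 0 <= B x) ->
  (forall x, D x -> qnorm (h x) ^+ 2 <= A x * B x) ->
  qintegrable h /\
  qnorm (qintegral mu D h) ^+ 2 <=
    4 * ((\int[mu]_(x in D) A x) * (\int[mu]_(x in D) B x)).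
Proof.
move=> [m0 m1 m2 m3] iA iB A0 B0 hAB.
have sq (f : quat R -> R) : (forall p, `|f p| <= qnorm p) ->
    forall x, D x -> (f \o h) x ^+ 2 <= A x * B x.
  move=> hf x Dx; apply: le_trans (hAB x Dx); rewrite -real_normK ?num_real //=.
  by apply: lerXn2r; rewrite ?nnegrE ?qnorm_ge0.
have [c0 d0] := integral_CauchySchwarz m0 iA iB A0 B0 (sq _ (fun p => let: And4 x _ _ _ := normr_qcoord p in x)).
have [c1 d1] := integral_CauchySchwarz m1 iA iB A0 B0 (sq _ (fun p => let: And4 _ x _ _ := normr_qcoord p in x)).
have [c2 d2] := integral_CauchySchwarz m2 iA iB A0 B0 (sq _ (fun p => let: And4 _ _ x _ := normr_qcoord p in x)).
have [c3 d3] := integral_CauchySchwarz m3 iA iB A0 B0 (sq _ (fun p => let: And4 _ _ _ x := normr_qcoord p in x)).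
split=> //; rewrite qnorm_sqr /qintegral !mkquatE.
move: d0 d1 d2 d3; rewrite /comp; lra.
Qed.

End IntegralBounds.

(** * Measurability of quaternion-valued functions *)

Section QMeasurable.
Context d (T : measurableType d) (R : realType).
Variables (D : set T).
Implicit Types (k : T -> R) (f g : T -> quat R).

Lemma qmeasurableM f g : qmeasurable D f -> qmeasurable D g ->
  qmeasurable D (fun x => f x * g x).
Proof.
move=> [f0 f1 f2 f3] [g0 g1 g2 g3]; split.
- rewrite (_ : _ \o _ = fun x => (q0 \o f) x * (q0 \o g) x - (q1 \o f) x * (q1 \o g) x
    - (q2 \o f) x * (q2 \o g) x - (q3 \o f) x * (q3 \o g) x).
    by do ![apply: measurable_funB|apply: measurable_funD|apply: measurable_funM].
  by apply/funext => x /=; rewrite quatME.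
- rewrite (_ : _ \o _ = fun x => (q0 \o f) x * (q1 \o g) x + (q1 \o f) x * (q0 \o g) x
    + (q2 \o f) x * (q3 \o g) x - (q3 \o f) x * (q2 \o g) x).
    by do ![apply: measurable_funB|apply: measurable_funD|apply: measurable_funM].
  by apply/funext => x /=; rewrite quatME.
- rewrite (_ : _ \o _ = fun x => (q0 \o f) x * (q2 \o g) x - (q1 \o f) x * (q3 \o g) x
    + (q2 \o f) x * (q0 \o g) x + (q3 \o f) x * (q1 \o g) x).
    by do ![apply: measurable_funB|apply: measurable_funD|apply: measurable_funM].
  by apply/funext => x /=; rewrite quatME.
- rewrite (_ : _ \o _ = fun x => (q0 \o f) x * (q3 \o g) x + (q1 \o f) x * (q2 \o g) x
    - (q2 \o f) x * (q1 \o g) x + (q3 \o f) x * (q0 \o g) x).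
    by do ![apply: measurable_funB|apply: measurable_funD|apply: measurable_funM].
  by apply/funext => x /=; rewrite quatME.
Qed.

Lemma qmeasurableZ k f : measurable_fun D k -> qmeasurable D f ->
  qmeasurable D (fun x => k x *: f x).
Proof.
move=> mk [f0 f1 f2 f3]; split.
- rewrite (_ : _ \o _ = fun x => k x * (q0 \o f) x); first exact: measurable_funM.
  by apply/funext => x /=; rewrite quatZE.
- rewrite (_ : _ \o _ = fun x => k x * (q1 \o f) x); first exact: measurable_funM.
  by apply/funext => x /=; rewrite quatZE.
- rewrite (_ : _ \o _ = fun x => k x * (q2 \o f) x); first exact: measurable_funM.
  by apply/funext => x /=; rewrite quatZE.
- rewrite (_ : _ \o _ = fun x => k x * (q3 \o f) x); first exact: measurable_funM.
  by apply/funext => x /=; rewrite quatZE.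
Qed.

Lemma qmeasurableD f g : qmeasurable D f -> qmeasurable D g ->
  qmeasurable D (fun x => f x + g x).
Proof.
move=> [f0 f1 f2 f3] [g0 g1 g2 g3]; split.
- rewrite (_ : _ \o _ = fun x => (q0 \o f) x + (q0 \o g) x); first exact: measurable_funD.
  by apply/funext => x /=; rewrite quatDE.
- rewrite (_ : _ \o _ = fun x => (q1 \o f) x + (q1 \o g) x); first exact: measurable_funD.
  by apply/funext => x /=; rewrite quatDE.
- rewrite (_ : _ \o _ = fun x => (q2 \o f) x + (q2 \o g) x); first exact: measurable_funD.
  by apply/funext => x /=; rewrite quatDE.
- rewrite (_ : _ \o _ = fun x => (q3 \o f) x + (q3 \o g) x); first exact: measurable_funD.
  by apply/funext => x /=; rewrite quatDE.
Qed.

Lemma qmeasurable_cst (p : quat R) : qmeasurable D (fun=> p).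
Proof. by split; exact: measurable_cst. Qed.

Lemma qmeasurable_sum n (f : nat -> T -> quat R) : (forall i, qmeasurable D (f i)) ->
  qmeasurable D (fun x => \sum_(0 <= i < n) f i x).
Proof.
move=> hf; elim: n => [|n IH].
  rewrite (_ : (fun x => _) = fun=> 0); first exact: qmeasurable_cst.
  by apply/funext => x; rewrite big_geq.
rewrite (_ : (fun x => _) = fun x => \sum_(0 <= i < n) f i x + f n x); last first.
  by apply/funext => x; rewrite big_nat_recr.
exact: qmeasurableD.
Qed.

Lemma qmeasurable_cvg (f : nat -> T -> quat R) g : (forall i, qmeasurable D (f i)) ->
  (forall x, D x -> f ^~ x @ \oo --> g x) -> qmeasurable D g.
Proof.
move=> mf fg; split.
- apply: (@measurable_fun_cvg _ _ _ _ (fun i => q0 \o f i)).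
    by move=> m; have [] := mf m.
  by move=> x Dx; have [] := cvg_qcoord _ (fg x Dx).
- apply: (@measurable_fun_cvg _ _ _ _ (fun i => q1 \o f i)).
    by move=> m; have [] := mf m.
  by move=> x Dx; have [] := cvg_qcoord _ (fg x Dx).
- apply: (@measurable_fun_cvg _ _ _ _ (fun i => q2 \o f i)).
    by move=> m; have [] := mf m.
  by move=> x Dx; have [] := cvg_qcoord _ (fg x Dx).
- apply: (@measurable_fun_cvg _ _ _ _ (fun i => q3 \o f i)).
    by move=> m; have [] := mf m.
  by move=> x Dx; have [] := cvg_qcoord _ (fg x Dx).
Qed.

Lemma measurable_qnorm_sqr f : qmeasurable D f -> measurable_fun D (fun x => qnorm (f x) ^+ 2).
Proof.
move=> [f0 f1 f2 f3].
rewrite (_ : (fun x => _) = fun x => (q0 \o f) x ^+ 2 + (q1 \o f) x ^+ 2 +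
  (q2 \o f) x ^+ 2 + (q3 \o f) x ^+ 2); last by apply/funext => x; rewrite qnorm_sqr.
by do ![apply: measurable_funD|apply: measurable_funX].
Qed.

End QMeasurable.

Lemma limn_einf_le (R : realType) (u : (\bar R)^nat) (c : \bar R) :
  (forall n, (u n <= c)%E) -> (limn_einf u <= c)%E.
Proof.
move=> uc; rewrite limn_einf_lim; apply: lime_le; first exact: is_cvg_einfs.
apply: nearW => n; apply: le_trans (uc n); apply: ereal_inf_lbound.
by exists n => /=.
Qed.

(** * Square-integral estimate for the kernel and expansion of S phi *)

Section LaguerreKernel.
Variable R : realType.
Variables (a y : R).
Hypotheses (a_gt : -1 < a) (y_ge0 : 0 <= y).
Implicit Types (x t : R) (n m N M : nat) (q : quat R) (phi : R -> quat R).

Let D : set R := `]0, +oo[%classic.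

Let mD : measurable (D : set (measurableTypeR R)). Proof. exact: measurable_itv. Qed.

(** In R_q(x, y) = sum_n q^n L_n(x) L_n(y) / h_n, [lag_eval n] is the factor beside q^n L_n(x),
    [lag_weight n] is the coefficient of t^n in R_t(y, y), and [lag_tail N t] is what its first N
    terms miss. *)
Definition lag_eval n := (laguerre a n).[y] / lag_norm a n.
Definition lag_weight n := (laguerre a n).[y] ^+ 2 / lag_norm a n.
Definition lag_tail N t := q0 (Rker a t%:A y y) - \sum_(0 <= n < N) lag_weight n * t ^+ n.
Definition lag_coef phi n := qintegral leb D (fun x =>
  (wgt a x * ((laguerre a n).[x] * lag_eval n)) *: phi x).
Definition lag_nrm2 phi := \int[leb]_(x in D) (qnorm (phi x) ^+ 2 * wgt a x).

Lemma lag_weight_ge0 n : 0 <= lag_weight n.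
Proof. by rewrite divr_ge0 ?sqr_ge0 // ltW // lag_norm_gt0. Qed.

Lemma lag_weightE n : lag_weight n = lag_eval n ^+ 2 * lag_norm a n.
Proof.
have h := lag_norm_gt0 n a_gt; rewrite /lag_weight /lag_eval; field.
by rewrite gt_eqF.
Qed.

Lemma lag_weight_series t : 0 <= t < 1 ->
  series (fun n => lag_weight n * t ^+ n) @ \oo --> q0 (Rker a t%:A y y).
Proof.
move=> /andP[t0 t1]; have hq : qball (t%:A : quat R).
  by rewrite /qball /= qnormZ qnorm1 mulr1 ger0_norm.
have [h _ _ _] := cvg_qcoord _ (Rker_series a_gt y_ge0 y_ge0 hq).
rewrite (_ : series _ = (fun k => q0 (series (fun m => ((laguerre a m).[y] *
   (laguerre a m).[y] / lag_norm a m) *: (t%:A : quat R) ^+ m) k))) //.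
apply/funext => k; rewrite /series /=; elim: k => [|k IH].
  by rewrite !big_geq // quat0E.
rewrite !big_nat_recr //= quatDE IH quatZE exprZn expr1n quatZE quat1E.
by rewrite /lag_weight; ring.
Qed.

(** The indicator lets N and M vary independently; comparing with the partial sum up to the larger
    of the two avoids a case split. *)
Lemma lag_weight_tail N M t : 0 <= t < 1 ->
  \sum_(0 <= n < M) (N <= n)%:R * (lag_weight n * t ^+ n) <= lag_tail N t.
Proof.
move=> ht; have [t0 t1] := andP ht.
have hs := lag_weight_series ht.
have s_ge0 n : 0 <= lag_weight n * t ^+ n by rewrite mulr_ge0 ?lag_weight_ge0 ?exprn_ge0.
rewrite /lag_tail lerBrDr.
have hle k : \sum_(0 <= n < k) lag_weight n * t ^+ n <= q0 (Rker a t%:A y y).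
  rewrite -(cvg_lim _ hs) //; apply: (nondecreasing_cvgn_le (u_ := series _)).
    by apply: nondecreasing_series.
  exact: cvgP hs.
apply: le_trans (hle (maxn N M)).
rewrite (@big_cat_nat _ _ _ N _ _ _ _ (leq0n N) (leq_maxl N M)) //= [X in X <= _]addrC lerD2l.
apply: (@le_trans _ _ (\sum_(0 <= n < maxn N M) (N <= n)%:R * (lag_weight n * t ^+ n))).
  rewrite [X in _ <= X](@big_cat_nat _ _ _ M _ _ _ _ (leq0n M) (leq_maxr N M)) //= lerDl.
  by apply: sumr_ge0 => i _; rewrite mulr_ge0.
rewrite (@big_cat_nat _ _ _ N _ _ _ _ (leq0n N) (leq_maxl N M)) //=.
rewrite [X in X + _]big_nat_cond [X in X + _]big1 ?add0r => [|i /andP[/andP[_ hi] _]]; last first.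
  by rewrite leqNgt hi mul0r.
by apply: ler_sum_nat => i /andP[hi _]; rewrite hi mul1r.
Qed.

Lemma lag_tail_ge0 N t : 0 <= t < 1 -> 0 <= lag_tail N t.
Proof. by move=> ht; apply: le_trans (lag_weight_tail N 0 ht); rewrite big_geq. Qed.

Lemma lag_tail_cvg0 t : 0 <= t < 1 -> lag_tail ^~ t @ \oo --> 0.
Proof.
move=> ht; rewrite -(subrr (q0 (Rker a t%:A y y))).
by apply: cvgB; [exact: cvg_cst|exact: lag_weight_series].
Qed.

Lemma moment_parseval (e : nat -> R) M :
  let p := \sum_(0 <= n < M) e n *: laguerre a n in
  moment (gmom a) (p * p) = \sum_(0 <= n < M) e n ^+ 2 * lag_norm a n.
Proof.
have hg k : gmom a k.+1 = (a + k.+1%:R) * gmom a k by exact: gmomS.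
have cross k m : (k <= m)%N ->
    moment (gmom a) ((\sum_(0 <= n < k) e n *: laguerre a n) * laguerre a m) = 0.
  elim: k => [|k IH] km; first by rewrite big_geq // mul0r moment0.
  rewrite big_nat_recr //= mulrDl momentD IH ?(ltnW km) // add0r -scalerAl momentZ.
  by rewrite (moment_laguerre_orth hg) ?mulr0 // ltn_eqF.
elim: M => [|M IH] /=; first by rewrite !big_geq // mul0r moment0.
rewrite !big_nat_recr //=; set p := \sum_(0 <= n < M) _.
rewrite (_ : _ * _ = p * p + (2 * e M) *: (p * laguerre a M) +
   (e M ^+ 2) *: (laguerre a M * laguerre a M)); last first.
  by rewrite -!mul_polyC !polyCM; ring.
by rewrite !momentD !momentZ IH cross // (moment_laguerre_sqr M hg) mulr0 addr0.
Qed.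

Let pos x : D x -> 0 < x. Proof. by rewrite /D /= in_itv /= andbT. Qed.

(** The block N <= n < M of the kernel expansion. With the lower bound written as an indicator,
    [K 0 N] is the discarded beginning, and only M goes to infinity. *)
Let K N M q x : quat R :=
  \sum_(0 <= n < M) ((N <= n)%:R * ((laguerre a n).[x] * lag_eval n)) *: q ^+ n.

Let measurable_lag n : measurable_fun (D : set (measurableTypeR R)) (fun x => (laguerre a n).[x]).
Proof.
apply: measurable_funTS; apply: continuous_measurable_fun => x.
exact: continuous_horner.
Qed.

Let mw : measurable_fun (D : set (measurableTypeR R)) (wgt a).
Proof. exact: measurable_wgt. Qed.

Let qmeasurable_K N M q : qmeasurable (D : set (measurableTypeR R)) (K N M q).
Proof.
apply: qmeasurable_sum => n; apply: qmeasurableZ; last exact: qmeasurable_cst.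
apply: measurable_funM; first exact: measurable_cst.
by apply: measurable_funM => //; exact: measurable_lag.
Qed.

Let cvg_K N q x : qball q -> 0 <= x ->
  (fun M => K N M q x) @ \oo --> Rker a q x y - K 0 N q x.
Proof.
move=> hq x0; rewrite -(cvg_shiftn N).
rewrite (_ : (fun M => _) = fun M => K 0 (M + N) q x - K 0 N q x); last first.
  apply/funext => M; rewrite /K.
  rewrite (@big_cat_nat _ _ _ N _ (M + N)) ?leq_addl //=.
  rewrite [X in _ = X - _](@big_cat_nat _ _ _ N _ (M + N)) ?leq_addl //= addrAC subrr add0r.
  rewrite [X in X + _]big_nat_cond [X in X + _]big1 ?add0r => [|i /andP[/andP[_ hi] _]]; last first.
    by rewrite leqNgt hi mul0r scale0r.
  by apply: eq_big_nat => i /andP[hi _]; rewrite hi.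
apply: (@cvgB _ (quat R)); last exact: cvg_cst.
rewrite (cvg_shiftn N (fun M => K 0 M q x)).
rewrite (_ : (fun M => K 0 M q x) = series (fun m => ((laguerre a m).[x] *
  (laguerre a m).[y] / lag_norm a m) *: q ^+ m)); first exact: Rker_series.
apply/funext => M; rewrite /series /K /=; apply: eq_bigr => i _.
by rewrite mul1r mulrA.
Qed.

Let qmeasurable_Rker q : qball q -> qmeasurable (D : set (measurableTypeR R)) (fun x => Rker a q x y).
Proof.
move=> hq; apply: (qmeasurable_cvg (f := fun M => K 0 M q)); first by move=> M; exact: qmeasurable_K.
move=> x /pos /ltW x0.
have h := @cvg_K 0 q x hq x0.
by rewrite [X in _ --> _ - X]/K big_geq // subr0 in h.
Qed.

(** For fixed q each coordinate of [K N M q x] is a polynomial in x, so Parseval applies to each of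
    them; the squares of the coordinates of q^n add up to |q|^(2n). *)
Let normr_sum_sqr N M q : \int[leb]_(x in D) (qnorm (K N M q x) ^+ 2 * wgt a x) =
  \sum_(0 <= n < M) (N <= n)%:R * (lag_weight n * (qnorm q ^+ 2) ^+ n) /\
  leb.-integrable D (EFin \o (fun x => qnorm (K N M q x) ^+ 2 * wgt a x)).
Proof.
pose e (f : quat R -> R) n := (N <= n)%:R * lag_eval n * f (q ^+ n).
pose p f := \sum_(0 <= n < M) e f n *: laguerre a n.
have pE (f : quat R -> R) x : f 0 = 0 -> (forall u v, f (u + v) = f u + f v) ->
    (forall k u, f (k *: u) = k * f u) -> f (K N M q x) = (p f).[x].
  move=> f0 fD fZ; rewrite /K /p; clear p; elim: M => [|m IH].
    by rewrite !big_geq // f0 horner0.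
  rewrite !big_nat_recr //= fD IH hornerD fZ hornerZ /e; congr (_ + _); ring.
pose P := p q0 * p q0 + p q1 * p q1 + p q2 * p q2 + p q3 * p q3.
have hP x : qnorm (K N M q x) ^+ 2 * wgt a x = P.[x] * wgt a x.
  rewrite qnorm_sqr (pE q0) ?(pE q1) ?(pE q2) ?(pE q3) ?quat0E //;
    try by move=> *; rewrite ?quatDE ?quatZE.
  by rewrite /P !hornerD !hornerM !expr2.
have [h1 h2] := integrable_poly_wgt P a_gt.
split; last by rewrite (_ : EFin \o _ = fun x => (P.[x] * wgt a x)%:E) //; apply/funext => x /=; rewrite hP.
rewrite (_ : (fun x => _) = fun x => P.[x] * wgt a x); last by apply/funext => x; rewrite hP.
rewrite h2 /P !momentD !moment_parseval -!big_split /=; apply: eq_bigr => n _.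
rewrite lag_weightE /e -exprM mulnC exprM -qnormX qnorm_sqr.
by case: (N <= n)%N => /=; ring.
Qed.

Lemma Rker_tail_L2 N q : qball q ->
  leb.-integrable D (EFin \o (fun x => qnorm (Rker a q x y - K 0 N q x) ^+ 2 * wgt a x)) /\
  \int[leb]_(x in D) (qnorm (Rker a q x y - K 0 N q x) ^+ 2 * wgt a x) <=
    lag_tail N (qnorm q ^+ 2).
Proof.
move=> hq; have ht : 0 <= qnorm q ^+ 2 < 1.
  by rewrite sqr_ge0 expr_lt1 ?qnorm_ge0.
pose g x := qnorm (Rker a q x y - K 0 N q x) ^+ 2 * wgt a x.
pose F M x := (qnorm (K N M q x) ^+ 2 * wgt a x)%:E.
have mF M : measurable_fun (D : set (measurableTypeR R)) (F M).
  apply/measurable_EFinP; apply: measurable_funM => //.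
  by apply: measurable_qnorm_sqr; exact: qmeasurable_K.
have mg : measurable_fun (D : set (measurableTypeR R)) g.
  apply: measurable_funM => //; apply: measurable_qnorm_sqr.
  apply: (qmeasurable_cvg (f := fun M => K N M q)); first by move=> M; exact: qmeasurable_K.
  move=> x /pos /ltW x0.
  exact: cvg_K.
have g0 x : 0 <= g x by rewrite mulr_ge0 ?sqr_ge0 // wgt_ge0.
have F0 M x : D x -> (0 <= F M x)%E.
  by move=> _; rewrite lee_fin mulr_ge0 ?sqr_ge0 // wgt_ge0.
have FE M : (\int[leb]_(x in D) F M x <= (lag_tail N (qnorm q ^+ 2))%:E)%E.
  have [h1 h2] := normr_sum_sqr N M q.
  by rewrite Rintegral_EFin // h1 lee_fin lag_weight_tail.
have Fg x : D x -> limn_einf (F ^~ x) = (g x)%:E.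
  move=> /pos /ltW x0.
  have hc : F ^~ x @ \oo --> (g x)%:E.
    apply: cvg_EFin; first by near=> M.
    apply: cvgM; last exact: cvg_cst.
    have [c0 c1 c2 c3] := cvg_qcoord _ (@cvg_K N q x hq x0).
    under eq_fun do rewrite qnorm_sqr; rewrite qnorm_sqr.
    have sqc (u : nat -> R) (l : R) : u @ \oo --> l -> (fun M => u M ^+ 2) @ \oo --> l ^+ 2.
      by move=> h; rewrite expr2; under eq_fun do rewrite expr2; exact: cvgM.
    by apply: cvgD; [apply: cvgD; [apply: cvgD|]|]; apply: sqc.
  by rewrite is_cvg_limn_einfE ?(cvg_lim _ hc) //; exact: cvgP hc.
have hfat : (\int[leb]_(x in D) (g x)%:E <= (lag_tail N (qnorm q ^+ 2))%:E)%E.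
  rewrite (_ : (\int[leb]_(x in D) (g x)%:E = \int[leb]_(x in D) limn_einf (F ^~ x))%E); last first.
    by apply: eq_integral => x /set_mem /Fg.
  apply: le_trans (fatou leb mD mF F0) _.
  exact: limn_einf_le.
have ig : leb.-integrable D (EFin \o g).
  apply: ge0_integrableR => //; apply: le_lt_trans hfat _; exact: ltry.
by split=> //; rewrite -lee_fin -Rintegral_EFin.
Unshelve. all: by end_near. Qed.

Lemma integrable_lag_nrm2 phi : laguerre_L2 a phi ->
  leb.-integrable D (EFin \o (fun x => qnorm (phi x) ^+ 2 * wgt a x)).
Proof.
move=> [mphi iphi]; apply: ge0_integrableR => //; last first.
  by move=> x _; rewrite mulr_ge0 ?sqr_ge0 // wgt_ge0.
by apply: measurable_funM => //; exact: measurable_qnorm_sqr.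
Qed.

Lemma lag_nrm2_ge0 phi : 0 <= lag_nrm2 phi.
Proof. by apply: Rintegral_ge0 => x _; rewrite mulr_ge0 ?sqr_ge0 // wgt_ge0. Qed.

(** The bound serves twice: it controls the growth of the coefficients, and it shows that c_n
    vanishes when L_n(y) = 0. *)
Lemma lag_coef_le phi n : laguerre_L2 a phi ->
  qintegrable leb D (fun x => (wgt a x * ((laguerre a n).[x] * lag_eval n)) *: phi x) /\
  qnorm (lag_coef phi n) ^+ 2 <= 4 * (lag_weight n * lag_nrm2 phi).
Proof.
move=> hphi; have [mphi _] := hphi; have iB := integrable_lag_nrm2 hphi.
pose A x := lag_eval n ^+ 2 * ((laguerre a n * laguerre a n).[x] * wgt a x).
have [h1 h2] := integrable_poly_wgt (laguerre a n * laguerre a n) a_gt.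
have iA : leb.-integrable D (EFin \o A) by exact: (integrableZR mD _ h1).
have hg k : gmom a k.+1 = (a + k.+1%:R) * gmom a k by exact: gmomS.
have eA : \int[leb]_(x in D) A x = lag_weight n.
  by rewrite RintegralZl // h2 (moment_laguerre_sqr n hg) lag_weightE.
have [||||i1 i2] := @qintegral_CauchySchwarz _ _ _ leb D mD
  (fun x => (wgt a x * ((laguerre a n).[x] * lag_eval n)) *: phi x) A _ _ iA iB.
- apply: qmeasurableZ => //; apply: measurable_funM => //.
  by apply: measurable_funM => //; exact: measurable_lag.
- by move=> x _; rewrite mulr_ge0 ?sqr_ge0 // mulr_ge0 ?wgt_ge0 // hornerM -expr2 sqr_ge0.
- by move=> x _; rewrite mulr_ge0 ?sqr_ge0 // wgt_ge0.
- move=> x _; rewrite qnormZ exprMn real_normK ?num_real // /A hornerM.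
  by rewrite le_eqVlt; apply/orP; left; apply/eqP; ring.
by split=> //; rewrite -eA.
Qed.

Theorem Sop_approx N q phi : laguerre_L2 a phi -> qball q ->
  qnorm (Sop a y phi q - \sum_(0 <= n < N) q ^+ n * lag_coef phi n) ^+ 2 <=
  4 * (lag_tail N (qnorm q ^+ 2) * lag_nrm2 phi).
Proof.
move=> hphi hq; have [mphi _] := hphi; have iB := integrable_lag_nrm2 hphi.
have [iA eA] := Rker_tail_L2 N hq.
have [||||i1 i2] := @qintegral_CauchySchwarz _ _ _ leb D mD
  (fun x => wgt a x *: ((Rker a q x y - K 0 N q x) * phi x)) _ _ _ iA iB.
- apply: qmeasurableZ => //; apply: qmeasurableM => //.
  apply: (qmeasurable_cvg (f := fun M => K N M q)); first by move=> M; exact: qmeasurable_K.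
  by move=> x /pos /ltW x0; exact: cvg_K.
- by move=> x _; rewrite mulr_ge0 ?sqr_ge0 // wgt_ge0.
- by move=> x _; rewrite mulr_ge0 ?sqr_ge0 // wgt_ge0.
- move=> x _; rewrite qnormZ qnormM !exprMn real_normK ?num_real //.
  by rewrite le_eqVlt; apply/orP; left; apply/eqP; ring.
pose g n x := q ^+ n * ((wgt a x * ((laguerre a n).[x] * lag_eval n)) *: phi x).
have hg n := qintegralMl mD (q ^+ n) (lag_coef_le n hphi).1.
have [j1 j2] := qintegral_sum mD N (fun n => (hg n).1).
have e : Sop a y phi q = qintegral leb D (fun x =>
    wgt a x *: ((Rker a q x y - K 0 N q x) * phi x) + \sum_(0 <= n < N) g n x).
  congr (qintegral _ _ _); apply/funext => x; rewrite -/(wgt a x).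
  have -> : \sum_(0 <= n < N) g n x = wgt a x *: (K 0 N q x * phi x).
    rewrite /K mulr_suml scaler_sumr; apply: eq_bigr => n _.
    by rewrite /g mul1r -scalerAr -[in RHS]scalerAl [in RHS]scalerA.
  by rewrite -scalerDr -mulrDl subrK.
have -> : Sop a y phi q - \sum_(0 <= n < N) q ^+ n * lag_coef phi n =
    qintegral leb D (fun x => wgt a x *: ((Rker a q x y - K 0 N q x) * phi x)).
  rewrite e (qintegralD mD i1 j1) j2 (eq_bigr (fun n => q ^+ n * lag_coef phi n)) ?addrK //.
  by move=> n _; rewrite (hg n).2.
by apply: le_trans i2 _; rewrite ler_pM2l // ler_wpM2r // lag_nrm2_ge0.
Qed.

Lemma laguerre_in_L2 n (k : R) : laguerre_L2 a (fun x => (k * (laguerre a n).[x])%:A).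
Proof.
split.
  by apply: qmeasurableZ; [apply: measurable_funM => //; exact: measurable_lag|exact: qmeasurable_cst].
have [h1 h2] := integrable_poly_wgt (laguerre a n * laguerre a n) a_gt.
have iA := integrableZR mD (k ^+ 2) h1.
rewrite (_ : (\int[leb]_(x in _) _)%E = (\int[leb]_(x in D) (k ^+ 2 * ((laguerre a n * laguerre a n).[x] * wgt a x))%:E)%E).
  by rewrite Rintegral_EFin // ltry.
apply: eq_integral => x _; rewrite qnormZ qnorm1 mulr1 real_normK ?num_real // hornerM.
by rewrite /wgt; congr EFin; ring.
Qed.

(** For phi = L_n / L_n(y), orthogonality leaves the single coefficient c_n = 1, so [Sop_approx]
    bounds the distance to q^n by tails that tend to 0. *)
Lemma Sop_laguerre n q : (laguerre a n).[y] != 0 -> qball q ->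
  Sop a y (fun x => ((laguerre a n).[y]^-1 * (laguerre a n).[x])%:A) q = q ^+ n.
Proof.
move=> hn hq; set phi := fun x => _; have hphi : laguerre_L2 a phi by exact: laguerre_in_L2.
have hc m : lag_coef phi m = (m == n)%:R%:A.
  rewrite /lag_coef.
  rewrite (_ : (fun x => _) = fun x => (lag_eval m / (laguerre a n).[y] *
      ((laguerre a m).[x] * (laguerre a n).[x] * wgt a x))%:A); last first.
    by apply/funext => x; rewrite /phi scalerA; congr (_ *: _); ring.
  pose c := lag_eval m / (laguerre a n).[y].
  have [h1 _] := integrable_poly_wgt (laguerre a m * laguerre a n) a_gt.
  have i1 : leb.-integrable D (EFin \o (fun x => (laguerre a m).[x] * (laguerre a n).[x] * wgt a x)).
    by rewrite (_ : EFin \o _ = fun x => ((laguerre a m * laguerre a n).[x] * wgt a x)%:E) //;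
      apply/funext => x /=; rewrite hornerM.
  have eI : \int[leb]_(x in D) (c * ((laguerre a m).[x] * (laguerre a n).[x] * wgt a x)) = (m == n)%:R.
    rewrite RintegralZl // laguerre_orth // /c /lag_eval; case: eqVneq => [->|_].
      by have h := lag_norm_gt0 n a_gt; rewrite /=; field; rewrite hn gt_eqF.
    by rewrite mulr0.
  have z : \int[leb]_(x in D) (0 : R) = 0 by rewrite /Rintegral integral0.
  apply: quatP; rewrite /qintegral mkquatE quatZE quat1E ?mulr1 ?mulr0.
  - by rewrite -[RHS]eI; apply: eq_Rintegral => x _; rewrite quatZE quat1E mulr1.
  - by rewrite -[RHS]z; apply: eq_Rintegral => x _; rewrite quatZE quat1E mulr0.
  - by rewrite -[RHS]z; apply: eq_Rintegral => x _; rewrite quatZE quat1E mulr0.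
  - by rewrite -[RHS]z; apply: eq_Rintegral => x _; rewrite quatZE quat1E mulr0.
have ht : 0 <= qnorm q ^+ 2 < 1 by rewrite sqr_ge0 expr_lt1 ?qnorm_ge0.
have bnd N : (n < N)%N -> qnorm (Sop a y phi q - q ^+ n) ^+ 2 <=
    4 * (lag_tail N (qnorm q ^+ 2) * lag_nrm2 phi).
  move=> hN; apply: le_trans (Sop_approx N hphi hq); rewrite big_mkord.
  rewrite (bigD1 (Ordinal hN)) //= hc eqxx scale1r mulr1 big1 ?addr0 // => i.
  by rewrite -val_eqE /= => /negbTE hi; rewrite hc hi scale0r mulr0.
have c0 : (fun N => 4 * (lag_tail N (qnorm q ^+ 2) * lag_nrm2 phi)) @ \oo --> (0 : R).
  rewrite [X in _ --> X](_ : 0 = 4 * (0 * lag_nrm2 phi) :> R); last by rewrite mul0r mulr0.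
  apply: cvgM; first exact: cvg_cst.
  by apply: cvgM; [exact: lag_tail_cvg0|exact: cvg_cst].
have le0 : qnorm (Sop a y phi q - q ^+ n) ^+ 2 <= 0.
  rewrite -(cvg_lim _ c0) //; apply: limr_ge; first exact: cvgP c0.
  by near=> N; apply: bnd; near: N; exact: nbhs_infty_gt.
apply/eqP; rewrite -subr_eq0; apply/eqP; apply: contrapT => /eqP h.
by have := qnorm_sqr_neq0 h; rewrite eq_le le0 sqr_ge0.
Unshelve. all: by end_near. Qed.

End LaguerreKernel.

Lemma sqr_geometric_summable (R : realType) (s : R) : 0 < s < 1 ->
  cvgn (series (fun n => n%:R ^+ 2 * s ^+ n)).
Proof.
(* With s = e^(-2d), one factor e^(-nd) absorbs n^2 through (n d)^2 / 2 <= e^(n d), and the other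
   remains as a geometric series. *)
move=> /andP[s0 s1]; pose d := - ln s / 2.
have d0 : 0 < d by rewrite divr_gt0 // oppr_gt0 ln_lt0 // s0.
have sE : s = expR (- d) * expR (- d).
  by rewrite -expRD /d -[LHS]lnK ?posrE //; congr expR; field.
have e1 : expR (- d) < 1 by rewrite expR_lt1 oppr_lt0.
apply: (@series_le_cvg _ _ (geometric (2 / d ^+ 2) (expR (- d)))).
- by move=> n; rewrite mulr_ge0 ?sqr_ge0 // exprn_ge0 // ltW.
- by move=> n; rewrite /= mulr_ge0 ?exprn_ge0 ?expR_ge0 // divr_ge0 ?sqr_ge0.
- move=> n /=; rewrite sE exprMn mulrA; apply: ler_wpM2r; first by rewrite exprn_ge0 ?expR_ge0.
  rewrite -expRM_natl mulrN expRN ler_pdivrMr ?expR_gt0 //.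
  have h : (n%:R * d) ^+ 2 / 2 <= expR (n%:R * d).
    have nd : 0 <= n%:R * d by rewrite mulr_ge0 // ltW.
    have := expR_ge1Dxn 1 nd; rewrite (_ : 2`!%:R = 2) //; lra.
  rewrite (_ : n%:R ^+ 2 = 2 / d ^+ 2 * ((n%:R * d) ^+ 2 / 2)); last first.
    by field; rewrite gt_eqF.
  by apply: ler_wpM2l => //; rewrite divr_ge0 ?sqr_ge0.
- by apply: is_cvg_geometric_series; rewrite ger0_norm ?expR_ge0.
Qed.

(** * Differentiability and slice regularity of power series *)

Section PowerSeries.
Variable R : realType.
Variables (f : quat R -> quat R) (c : nat -> quat R).
Hypothesis c_growth : forall t : R, 0 < t < 1 ->
  exists M, forall n, qnorm (c n) * t ^+ n <= M.
Hypothesis f_series : forall q, qball q ->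
  series (fun n => q ^+ n * c n) @ \oo --> f q.
Implicit Types (q h p J : quat R) (n : nat).

(* The differential of q^n at q, applied to h. *)
Fixpoint dpow q n h : quat R :=
  if n is n'.+1 then dpow q n' h * q + q ^+ n' * h else 0.

Lemma dpow_linear q n (k : R) h1 h2 : dpow q n (k *: h1 + h2) = k *: dpow q n h1 + dpow q n h2.
Proof.
elim: n => [|n IH] /=; first by rewrite scaler0 addr0.
by rewrite IH mulrDl mulrDr scalerDr -scalerAl -scalerAr addrACA.
Qed.

(** This is the bound n t^(n-1) |h|, multiplied by t to avoid the exponent n - 1. *)
Lemma dpow_norm q n h (t : R) : qnorm q <= t -> t * qnorm (dpow q n h) <= n%:R * t ^+ n * qnorm h.
Proof.
move=> qt; have t0 : 0 <= t := le_trans (qnorm_ge0 _) qt.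
elim: n => [|n IH] /=; first by rewrite qnorm0 mulr0 !mul0r.
apply: le_trans (ler_wpM2l t0 (qnormD _ _)) _; rewrite !qnormM qnormX mulrDr.
rewrite (_ : n.+1%:R * t ^+ n.+1 * qnorm h =
  n%:R * t ^+ n * qnorm h * t + t * (t ^+ n * qnorm h)); last by rewrite -natr1 exprS; ring.
apply: lerD.
  rewrite mulrA; apply: ler_pM => //; first by rewrite mulr_ge0 ?qnorm_ge0.
  exact: qnorm_ge0.
apply: ler_wpM2l => //; apply: ler_wpM2r; first exact: qnorm_ge0.
by apply: lerXn2r; rewrite ?nnegrE ?qnorm_ge0.
Qed.

(** The remainders satisfy E_(n+1) = E_n (q + h) + [dpow q n h * h], and n^2 + n <= (n + 1)^2. The
    factor t^2 on the left stands for the exponent n - 2. *)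
Lemma pow_taylor q n h (t : R) : qnorm q <= t -> qnorm (q + h) <= t ->
  t ^+ 2 * qnorm ((q + h) ^+ n - q ^+ n - dpow q n h) <= n%:R ^+ 2 * t ^+ n * qnorm h ^+ 2.
Proof.
move=> qt qht; have t0 : 0 <= t := le_trans (qnorm_ge0 _) qt.
elim: n => [|n IH] /=.
  by rewrite !expr0 subrr subr0 qnorm0 expr0n !mul0r mulr0.
set E := (q + h) ^+ n - q ^+ n - dpow q n h in IH *.
have -> : (q + h) ^+ n.+1 - q ^+ n.+1 - (dpow q n h * q + q ^+ n * h) =
    E * (q + h) + dpow q n h * h.
  have e : (q + h) ^+ n = E + q ^+ n + dpow q n h.
    by rewrite /E; apply: quatP; rewrite !(quatDE, quatNE); ring.
  rewrite exprSr e exprSr !mulrDl !mulrDr.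
  by apply: quatP; rewrite !(quatDE, quatNE); ring.
apply: le_trans (ler_wpM2l (sqr_ge0 _) (qnormD _ _)) _; rewrite !qnormM mulrDr.
have h0 := qnorm_ge0 h.
have d1 := dpow_norm n h qt.
apply: (@le_trans _ _ (n%:R ^+ 2 * t ^+ n * qnorm h ^+ 2 * t + t * (n%:R * t ^+ n * qnorm h) * qnorm h)).
  apply: lerD.
    rewrite mulrA; apply: ler_pM => //; [|exact: qnorm_ge0].
    by rewrite mulr_ge0 ?sqr_ge0 ?qnorm_ge0.
  rewrite [X in X <= _]mulrA; apply: ler_wpM2r => //.
  by rewrite expr2 -[X in X <= _]mulrA; apply: ler_wpM2l.
rewrite (_ : _ + _ = (n%:R ^+ 2 + n%:R) * (t ^+ n.+1 * qnorm h ^+ 2)); last first.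
  by rewrite (exprS t n); ring.
rewrite -[X in _ <= X]mulrA; apply: ler_wpM2r.
  by rewrite mulr_ge0 ?exprn_ge0 ?sqr_ge0.
have n0 : 0 <= n%:R :> R by exact: ler0n.
by rewrite -natr1 sqrrD1 mulr2n; lra.
Qed.

(** In a direction J commuting with q, the differential is J times the one in the real direction:
    this is the source of the Cauchy-Riemann equation on the slice. *)
Lemma dpow_comm q n J : q * J = J * q -> dpow q n J = J * dpow q n 1.
Proof.
move=> hJ; elim: n => [|n IH] /=; first by rewrite mulr0.
by rewrite IH mulrDr mulr1 mulrA (commrX n (esym hJ : GRing.comm J q)).
Qed.

Section AtPoint.
Variable q : quat R.
Hypothesis hq : qball q.

(** Radii |q| < t < s < 1: increments keep q + h within radius t, and growth at s makes the terms at
    t summable with ratio t / s. *)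
Let t := (1 + qnorm q) / 2.
Let s := (1 + t) / 2.
Let q1' : qnorm q < 1. Proof. exact: hq. Qed.
Let t0 : 0 < t. Proof. by have := qnorm_ge0 q; rewrite /t; lra. Qed.
Let t1 : t < 1. Proof. by have := q1'; rewrite /t; lra. Qed.
Let qt : qnorm q < t. Proof. by have := q1'; rewrite /t; lra. Qed.
Let ts : t < s. Proof. by have := t1; rewrite /s; lra. Qed.
Let s01 : 0 < s < 1.
Proof. by apply/andP; have := t0; have := t1; rewrite /s; split; lra. Qed.

Let exM : exists M : R, 0 <= M /\ (forall n, qnorm (c n) * t ^+ n <= M * (t / s) ^+ n).
Proof.
have [M hM] := c_growth s01; have /andP[s0 s1] := s01.
exists M; split.
  by apply: le_trans (hM 0); rewrite mulr_ge0 ?qnorm_ge0 ?exprn_ge0 // ltW.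
move=> n; have sn : 0 < s ^+ n by rewrite exprn_gt0.
rewrite [X in _ <= _ * X]expr_div_n [X in _ <= X]mulrA ler_pdivlMr // [X in X <= _]mulrAC.
by apply: ler_wpM2r => //; rewrite exprn_ge0 // ltW.
Qed.

Let M := projT1 (cid exM).
Let M0 : 0 <= M := (projT2 (cid exM)).1.
Let hM n : qnorm (c n) * t ^+ n <= M * (t / s) ^+ n := (projT2 (cid exM)).2 n.

Let u n := n%:R ^+ 2 * (t / s) ^+ n.
Let u_cvg : cvgn (series u).
Proof.
have /andP[s0 s1] := s01.
by apply: sqr_geometric_summable; rewrite divr_gt0 //= ltr_pdivrMr // mul1r.
Qed.
Let u_ge0 n : 0 <= u n.
Proof. by have /andP[s0 s1] := s01; rewrite mulr_ge0 ?sqr_ge0 // exprn_ge0 // divr_ge0 // ltW. Qed.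
Let U := limn (series u).

Let term_norm n h : t * qnorm (dpow q n h * c n) <= M * u n * qnorm h.
Proof.
rewrite qnormM mulrA; apply: le_trans (ler_wpM2r (qnorm_ge0 _) (dpow_norm n h (ltW qt))) _.
rewrite [X in X <= _](_ : _ = n%:R * (qnorm (c n) * t ^+ n) * qnorm h); last by ring.
apply: ler_wpM2r; first exact: qnorm_ge0.
apply: (@le_trans _ _ (n%:R * (M * (t / s) ^+ n))); first exact: ler_wpM2l.
rewrite /u mulrCA; apply: ler_wpM2l => //; apply: ler_wpM2r.
  by have /andP[s0 s1] := s01; rewrite exprn_ge0 // divr_ge0 // ltW.
by case: n => [|n]; rewrite ?expr0n // expr2 ler_peMl // ler1n.
Qed.

Definition dseries h := limn (series (fun n => dpow q n h * c n)).

Let dseries_cvg h : series (fun n => dpow q n h * c n) @ \oo --> dseries h.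
Proof.
apply: (@normed_cvg R (quat R)).
apply: (@series_le_cvg _ _ (fun n => t^-1 * qnorm h * M * u n)).
- by move=> n; exact: normr_ge0.
- by move=> n; rewrite mulr_ge0 // mulr_ge0 // mulr_ge0 ?qnorm_ge0 // invr_ge0 ltW.
- move=> n; apply: le_trans (normr_le_qnorm _) _.
  rewrite -(ler_pM2l t0); apply: le_trans (term_norm n h) _.
  rewrite le_eqVlt; apply/orP; left; apply/eqP; field.
  by rewrite gt_eqF.
- exact: (is_cvg_seriesZ (f := u)).
Qed.

Lemma dseries_linear (k : R) h1 h2 : dseries (k *: h1 + h2) = k *: dseries h1 + dseries h2.
Proof.
apply/cvg_lim => //.
rewrite (_ : series _ = fun n => k *: series (fun n => dpow q n h1 * c n) n +
   series (fun n => dpow q n h2 * c n) n); last first.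
  apply/funext => n; rewrite /series /= scaler_sumr -big_split; apply: eq_bigr => i _.
  by rewrite dpow_linear mulrDl scalerAl.
apply: (@cvgD _ (quat R)); last exact: dseries_cvg.
by apply: (@cvgZl_tmp _ (quat R)); exact: dseries_cvg.
Qed.

Lemma dseries_comm J : q * J = J * q -> dseries J = J * dseries 1.
Proof.
move=> hJ; apply/cvg_lim => //.
rewrite (_ : series _ = fun n => J * series (fun n => dpow q n 1 * c n) n).
  by apply: cvg_qmull; exact: dseries_cvg.
apply/funext => n; rewrite /series /= mulr_sumr; apply: eq_bigr => i _.
by rewrite (dpow_comm _ hJ) mulrA.
Qed.

Let taylor h : qnorm h <= t - qnorm q ->
  t ^+ 2 * qnorm (f (q + h) - f q - dseries h) <= 2 * (M * U * qnorm h ^+ 2).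
Proof.
move=> hh; have qht : qnorm (q + h) <= t by apply: le_trans (qnormD _ _) _; lra.
have hqh : qball (q + h) by apply: le_lt_trans qht t1.
pose S k := \sum_(0 <= n < k) ((q + h) ^+ n - q ^+ n - dpow q n h) * c n.
have Sc : S @ \oo --> f (q + h) - f q - dseries h.
  rewrite (_ : S = fun k => series (fun n => (q + h) ^+ n * c n) k -
    series (fun n => q ^+ n * c n) k - series (fun n => dpow q n h * c n) k).
    apply: (@cvgB _ (quat R)); last exact: dseries_cvg.
    by apply: (@cvgB _ (quat R)); exact: f_series.
  apply/funext => k; rewrite /S /series /= -!sumrB; apply: eq_bigr => i _.
  by rewrite !mulrBl.
(* The limit in k is taken in the sup norm, that of the topology; returning to [qnorm] afterwards
   costs the factor 2. *)
have Sb k : t ^+ 2 * `|S k| <= M * U * qnorm h ^+ 2.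
  apply: le_trans (ler_wpM2l (sqr_ge0 _) (normr_le_qnorm _)) _.
  rewrite /S big_mkord; apply: le_trans (ler_wpM2l (sqr_ge0 _) (qnorm_sum _)) _.
  rewrite mulr_sumr; apply: (@le_trans _ _ (\sum_(i < k) M * u i * qnorm h ^+ 2)).
    apply: ler_sum => i _; rewrite qnormM mulrA.
    apply: le_trans (ler_wpM2r (qnorm_ge0 _) (pow_taylor i (ltW qt) qht)) _.
    rewrite [X in X <= _](_ : _ = i%:R ^+ 2 * (qnorm (c i) * t ^+ i) * qnorm h ^+ 2); last by ring.
    apply: ler_wpM2r; first exact: sqr_ge0.
    rewrite /u [X in _ <= X]mulrCA; apply: ler_wpM2l; first exact: sqr_ge0.
    exact: hM.
  rewrite -mulr_suml; apply: ler_wpM2r; first exact: sqr_ge0.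
  rewrite -mulr_sumr; apply: ler_wpM2l => //; rewrite -(big_mkord xpredT u).
  apply: (nondecreasing_cvgn_le (u_ := series u)) => //.
  by apply: nondecreasing_series.
have nb : t ^+ 2 * `|f (q + h) - f q - dseries h| <= M * U * qnorm h ^+ 2.
  have hc : (fun k => t ^+ 2 * `|S k|) @ \oo --> t ^+ 2 * `|f (q + h) - f q - dseries h|.
    apply: cvgM; first exact: cvg_cst.
    exact: cvg_norm.
  rewrite -(cvg_lim _ hc) //; apply: limr_le; first exact: cvgP hc.
  by apply: nearW.
have := qnorm_le_normr (f (q + h) - f q - dseries h).
move/(ler_wpM2l (sqr_ge0 t)); lra.
Qed.

Let MU : 0 <= M * U.
Proof.
rewrite mulr_ge0 //; apply: le_trans (nondecreasing_cvgn_le _ u_cvg 0).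
  by rewrite /series /= big_geq.
by apply: nondecreasing_series.
Qed.

Let dseries_le h : t * `|dseries h| <= 2 * (M * U) * `|h|.
Proof.
have Sb k : t * `|series (fun n => dpow q n h * c n) k| <= M * U * qnorm h.
  apply: le_trans (ler_wpM2l (ltW t0) (normr_le_qnorm _)) _.
  rewrite /series /= big_mkord; apply: le_trans (ler_wpM2l (ltW t0) (qnorm_sum _)) _.
  rewrite mulr_sumr; apply: (@le_trans _ _ (\sum_(i < k) M * u i * qnorm h)).
    by apply: ler_sum => i _; exact: term_norm.
  rewrite -mulr_suml; apply: ler_wpM2r; first exact: qnorm_ge0.
  rewrite -mulr_sumr; apply: ler_wpM2l => //; rewrite -(big_mkord xpredT u).
  apply: (nondecreasing_cvgn_le (u_ := series u)) => //.
  by apply: nondecreasing_series.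
have nb : t * `|dseries h| <= M * U * qnorm h.
  have hc : (fun k => t * `|series (fun n => dpow q n h * c n) k|) @ \oo --> t * `|dseries h|.
    apply: cvgM; first exact: cvg_cst.
    by apply: cvg_norm; exact: dseries_cvg.
  rewrite -(cvg_lim _ hc) //; apply: limr_le; first exact: cvgP hc.
  by apply: nearW.
apply: le_trans nb _.
rewrite [X in _ <= X](_ : _ = M * U * (2 * `|h|)); last by ring.
apply: ler_wpM2l => //.
exact: qnorm_le_normr.
Qed.

Lemma pseries_differentiable : differentiable f q /\ ('d f q : quat R -> quat R) = dseries.
Proof.
pose L : {linear quat R -> quat R} :=
  HB.pack dseries (GRing.isLinear.Build R (quat R) (quat R) *:%R dseries dseries_linear).
have Lc : continuous (dseries : quat R -> quat R).
  move=> x; have FF : Filter (nbhs (x : quat R)) by exact: (@nbhs_filter (quat R)).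
  apply: (proj2 (@cvgrPdist_lt R (quat R) (quat R) _ FF dseries (dseries x))) => e e0.
  pose k := 2 * (M * U) / t + 1.
  have k0 : 0 < k by rewrite /k ltr_wpDl // divr_ge0 ?(ltW t0) // mulr_ge0.
  near=> y.
  have -> : dseries x - dseries y = dseries (x - y) by exact: (esym (linearB L x y)).
  have hle : `|dseries (x - y)| <= k * `|x - y|.
    have h := dseries_le (x - y); rewrite -ler_pdivlMl // in h.
    apply: le_trans h _.
    rewrite [X in X <= _](_ : _ = t^-1 * (2 * (M * U)) * `|x - y|); last by ring.
    apply: ler_wpM2r => //.
    by rewrite /k mulrC lerDl.
  apply: le_lt_trans hle _; rewrite -ltr_pdivlMl //.
  near: y; apply: (proj1 (@cvgrPdist_lt R (quat R) (quat R) _ FF id x)); first exact: cvg_id.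
  by rewrite mulr_gt0 // invr_gt0.
have hL : f \o shift q = cst (f q) + L +o_ (0 : quat R) id.
  (* 8 is the factor 2 of [taylor] times the square of the factor 2 between the norms; adding 1
     keeps the divisor positive when M U = 0. *)
  apply/eqaddoP => e e0; have c8 : 0 < 8 * (M * U) + 1 by have := MU; lra.
  near=> h.
  have hh : `|h| < (t - qnorm q) / 2.
    by near: h; apply: (@nbhs0_lt _ (quat R)); rewrite divr_gt0 // subr_gt0.
  have he : `|h| < e * t ^+ 2 / (8 * (M * U) + 1).
    by near: h; apply: (@nbhs0_lt _ (quat R)); rewrite divr_gt0 // mulr_gt0 // exprn_gt0.
  have hq2 := qnorm_le_normr h.
  have hle : qnorm h <= t - qnorm q by lra.
  have ty := taylor hle.
  rewrite !fctE /= [h + q]addrC opprD addrA.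
  set E := f (q + h) - f q - dseries h in ty *.
  have t2 : 0 < t ^+ 2 by rewrite exprn_gt0.
  rewrite -(ler_pM2l t2).
  apply: (@le_trans _ _ (2 * (M * U * (2 * `|h|) ^+ 2))).
    apply: le_trans (ler_wpM2l (sqr_ge0 _) (normr_le_qnorm _)) _; apply: le_trans ty _.
    apply: ler_wpM2l => //; apply: ler_wpM2l => //.
    by apply: lerXn2r; rewrite ?nnegrE ?qnorm_ge0 ?mulr_ge0.
  rewrite [X in X <= _](_ : _ = 8 * (M * U) * `|h| * `|h|); last by ring.
  rewrite [X in _ <= X]mulrA; apply: ler_wpM2r => //.
  move: he; rewrite ltr_pdivlMr //.
  have h0 : 0 <= `|h| by [].
  by rewrite mulrDr mulr1 [`|h| * _]mulrC [t ^+ 2 * e]mulrC; lra.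
have dE : ('d f q : quat R -> quat R) = dseries := diff_unique (Lc : continuous L) hL.
split; last exact: dE.
by apply/diff_locallyP; rewrite dE.
Unshelve. all: by end_near. Qed.

End AtPoint.

(** The partial derivatives in x and y are the differential applied to 1 and to J. As J commutes
    with x + J y, the second is J times the first, and J^2 = -1 cancels them. *)
Theorem pseries_slice_regular : slice_regular f.
Proof.
split=> [q hq|J x y hJ hq]; first by have [] := pseries_differentiable hq.
have [df dE] := pseries_differentiable hq.
have hJq : slice_pt J x y * J = J * slice_pt J x y.
  by rewrite /slice_pt mulrDl mulrDr -!scalerAl -!scalerAr mul1r mulr1.
have e1 : derive1 (fun s : R => f (slice_pt J s y)) x = dseries (slice_pt J x y) 1.
  rewrite -dE -deriveE // /derive1 /derive.
  rewrite (_ : (fun h : R => h^-1 *: (f (slice_pt J (h + x) y) - _)) =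
    fun h : R => h^-1 *: ((f \o shift (slice_pt J x y)) h%:A - f (slice_pt J x y))) //.
  by apply/funext => h /=; congr (_ *: (f _ - _)); rewrite /slice_pt scalerDl addrA.
have e2 : derive1 (fun t : R => f (slice_pt J x t)) y = dseries (slice_pt J x y) J.
  rewrite -dE -deriveE // /derive1 /derive.
  rewrite (_ : (fun h : R => h^-1 *: (f (slice_pt J x (h + y)) - _)) =
    fun h : R => h^-1 *: ((f \o shift (slice_pt J x y)) (h *: J) - f (slice_pt J x y))) //.
  by apply/funext => h /=; congr (_ *: (f _ - _)); rewrite /slice_pt scalerDl addrCA.
rewrite e1 e2 (dseries_comm hq hJq) mulrA -expr2 hJ mulN1r subrr.
by rewrite scaler0.
Qed.

End PowerSeries.

(** * Rotation invariance of planar Lebesgue measure *)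

Section RotationInvariance.
Variable R : realType.
Local Notation TR := (measurableTypeR R).
Implicit Types (a b c s : R).

Let measurable_shift a : measurable_fun [set: TR] (fun x : TR => (x + a : TR)).
Proof. by apply: measurable_funD; [exact: measurable_id|exact: measurable_cst]. Qed.

Lemma lebesgue_measure_shift a (A : set TR) : measurable A ->
  pushforward (@lebesgue_measure R) (fun x : TR => (x + a : TR)) A = lebesgue_measure A.
Proof.
move=> mA; apply/esym.
have := @lebesgue_measure_unique R (pushforward (@lebesgue_measure R)
  (fun x : TR => (x + a : TR))).
move=> /(_ (measurable_shift a) _ A mA) ->; first by [].
move=> _ [[u v]] /= uv <-.
rewrite /pushforward /=.
have -> : (fun x : R => x + a) @^-1` `]u, v]%classic = `]u - a, v - a]%classic.
  by apply/seteqP; split => x /=; rewrite !in_itv /= ltrBlDr lerBrDr.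
rewrite !lebesgue_measure_itv /= !lte_fin ltrD2r; case: ifP => // _.
by rewrite -!EFinD; congr (_%:E); ring.
Qed.

Lemma ge0_integral_shift a (f : R -> \bar R) : measurable_fun [set: TR] f ->
  (forall x, (0 <= f x)%E) ->
  (\int[@lebesgue_measure R]_x f (x + a)%R = \int[@lebesgue_measure R]_x f x)%E.
Proof.
move=> mf f0.
transitivity (\int[pushforward (@lebesgue_measure R) (fun x : TR => (x + a)%R : TR)]_x f x)%E.
  by rewrite ge0_integral_pushforward //; exact: measurable_shift.
by apply: eq_measure_integral => A mA _; exact: lebesgue_measure_shift.
Qed.

Let shear1 a (z : TR * TR) : TR * TR := (z.1 + a * z.2, z.2).
Let shear2 a (z : TR * TR) : TR * TR := (z.1, z.2 + a * z.1).

Let measurable_shear1 a : measurable_fun [set: TR * TR] (shear1 a).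
Proof.
apply: measurable_fun_pair; last exact: measurable_snd.
apply: measurable_funD; first exact: measurable_fst.
by apply: measurable_funM; [exact: measurable_cst|exact: measurable_snd].
Qed.

Let measurable_shear2 a : measurable_fun [set: TR * TR] (shear2 a).
Proof.
apply: measurable_fun_pair; first exact: measurable_fst.
apply: measurable_funD; first exact: measurable_snd.
by apply: measurable_funM; [exact: measurable_cst|exact: measurable_fst].
Qed.

(** By Tonelli, one integrates first along the lines on which the shear is a translation. *)
Lemma ge0_integral_shear1 a (f : TR * TR -> \bar R) : measurable_fun setT f ->
  (forall z, (0 <= f z)%E) ->
  (\int[leb2]_z f (shear1 a z) = \int[leb2]_z f z)%E.
Proof.
move=> mf f0; have mf' : measurable_fun setT (f \o shear1 a) by exact: measurableT_comp.
rewrite /leb2 (fubini_tonelli2 (f \o shear1 a)) //= (fubini_tonelli2 f) //=.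
apply: eq_integral => y _; rewrite /fubini_G /shear1 /=.
apply: (ge0_integral_shift (a * y) (f := fun x => f (x, y))) => //.
by apply: measurableT_comp mf _; exact: measurable_pair2.
Qed.

Lemma ge0_integral_shear2 a (f : TR * TR -> \bar R) : measurable_fun setT f ->
  (forall z, (0 <= f z)%E) ->
  (\int[leb2]_z f (shear2 a z) = \int[leb2]_z f z)%E.
Proof.
move=> mf f0; have mf' : measurable_fun setT (f \o shear2 a) by exact: measurableT_comp.
rewrite /leb2 (fubini_tonelli1 (f \o shear2 a)) //= (fubini_tonelli1 f) //=.
apply: eq_integral => x _; rewrite /fubini_F /shear2 /=.
apply: (ge0_integral_shift (a * x) (f := fun y => f (x, y))) => //.
by apply: measurableT_comp mf _; exact: measurable_pair1.
Qed.

Definition plane_rot c s (z : R * R) : R * R := (c * z.1 - s * z.2, s * z.1 + c * z.2).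

Section Rotation.
Variables c s : R.
Hypotheses (cs : c ^+ 2 + s ^+ 2 = 1) (c1 : 1 + c != 0).

(* A rotation is a product of three shears. *)
Let rotE z : plane_rot c s z = shear1 (- (s / (1 + c))) (shear2 s (shear1 (- (s / (1 + c))) z)).
Proof.
rewrite /plane_rot /shear1 /shear2 /=; set t := s / (1 + c).
have e1 : c = 1 - s * t.
  have s2 : s ^+ 2 = 1 - c ^+ 2 by move: cs; lra.
  rewrite /t mulrA -expr2 s2; apply: (mulIf c1); rewrite mulrBl divfK //; ring.
have e2 : s = t * (1 + c) by rewrite /t divfK.
congr (_, _); last by rewrite {1}e1; ring.
transitivity ((1 - s * t) * z.1 - t * (1 + c) * z.2); first by rewrite -e1 -e2.
by rewrite {1}e1; ring.
Qed.

Lemma ge0_integral_rot (f : TR * TR -> \bar R) : measurable_fun setT f ->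
  (forall z, (0 <= f z)%E) ->
  (\int[leb2]_z f (plane_rot c s z) = \int[leb2]_z f z)%E.
Proof.
move=> mf f0; set t := - (s / (1 + c)).
have mf1 : measurable_fun setT (f \o shear1 t) by exact: measurableT_comp.
have mf2 : measurable_fun setT ((f \o shear1 t) \o shear2 s) by exact: measurableT_comp.
rewrite -(ge0_integral_shear1 t mf f0) -(ge0_integral_shear2 s mf1 (fun z => f0 _)).
rewrite -(ge0_integral_shear1 t mf2 (fun z => f0 _)).
by apply: eq_integral => z _; rewrite rotE.
Qed.

Lemma rot_disc z : disc (plane_rot c s z) <-> disc z.
Proof.
suff e : (plane_rot c s z).1 ^+ 2 + (plane_rot c s z).2 ^+ 2 = z.1 ^+ 2 + z.2 ^+ 2.
  by rewrite /disc /= e.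
by rewrite -[RHS]mul1r -cs /=; ring.
Qed.

Lemma integral_rot (f : TR * TR -> \bar R) : measurable (disc : set (TR * TR)) ->
  measurable_fun disc f ->
  (\int[leb2]_(z in disc) f (plane_rot c s z) = \int[leb2]_(z in disc) f z)%E.
Proof.
move=> md mf; rewrite [LHS]integral_mkcond [RHS]integral_mkcond.
have -> : (fun z => f (plane_rot c s z)) \_ disc = (f \_ disc) \o plane_rot c s.
  apply/funext => z; rewrite /= !patchE.
  have -> // : (plane_rot c s z \in (disc : set (R * R))) = (z \in (disc : set (R * R))).
  by apply/idP/idP; rewrite !inE => /rot_disc.
have mg : measurable_fun setT (f \_ disc) by exact/(measurable_restrictT _ _).1.
rewrite [LHS]integralE [RHS]integralE; congr (_ - _)%E.
- have := @ge0_integral_rot ((f \_ disc)^\+)%E (measurable_funepos mg) (fun z => funepos_ge0 _ z).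
  by move=> <-; apply: eq_integral => z _; rewrite !funeposE.
- have := @ge0_integral_rot ((f \_ disc)^\-)%E (measurable_funeneg mg) (fun z => funeneg_ge0 _ z).
  by move=> <-; apply: eq_integral => z _; rewrite !funenegE.
Qed.

End Rotation.
End RotationInvariance.

(** * Measurability on the disc *)

Section DiscMeasurability.
Variable R : realType.
Local Notation T := (measurableTypeR R * measurableTypeR R)%type.
Local Notation rho z := (z.1 ^+ 2 + z.2 ^+ 2).

Lemma measurable_rho : measurable_fun [set: T] (fun z : T => (rho z : measurableTypeR R)).
Proof.
by apply: measurable_funD; apply: measurable_funX; [exact: measurable_fst|exact: measurable_snd].
Qed.

Lemma measurable_disc : measurable (disc : set T).
Proof.
have := measurable_rho measurableT (measurable_itv `]-oo, (1 : R)[).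
rewrite setTI (_ : _ @^-1` _ = disc) //.
Qed.

Lemma rho_ge0 (z : T) : 0 <= rho z.
Proof. by rewrite addr_ge0 ?sqr_ge0. Qed.

Lemma qmeasurable_slice_ptX (I : quat R) n :
  qmeasurable (disc : set T) (fun z => slice_pt I z.1 z.2 ^+ n).
Proof.
have m1 : qmeasurable (disc : set T) (fun z => slice_pt I z.1 z.2).
  apply: qmeasurableD; apply: qmeasurableZ; try exact: qmeasurable_cst.
    exact: measurable_funTS measurable_fst.
  exact: measurable_funTS measurable_snd.
elim: n => [|n IHn].
  by under [X in qmeasurable _ X]eq_fun do rewrite expr0; exact: qmeasurable_cst.
by under [X in qmeasurable _ X]eq_fun do rewrite exprS; exact: qmeasurableM.
Qed.

End DiscMeasurability.

(** * Power series, size and regularity of S phi *)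

Section SopSlice.
Variables (R : realType) (a y : R).
Hypotheses (a_gt : -1 < a) (y_ge0 : 0 <= y).
Local Notation T := (measurableTypeR R * measurableTypeR R)%type.
Local Notation rho z := (z.1 ^+ 2 + z.2 ^+ 2).
Local Notation diag t := (q0 (Rker a t%:A y y)).

Lemma lag_tail_le N t : 0 <= t < 1 -> lag_tail a y N t <= diag t.
Proof.
move=> /andP[t0 _]; rewrite /lag_tail lerBlDr lerDl.
by apply: sumr_ge0 => n _; rewrite mulr_ge0 ?exprn_ge0 ?lag_weight_ge0.
Qed.

Lemma lag_weight_le n t : 0 <= t < 1 -> lag_weight a y n * t ^+ n <= diag t.
Proof.
move=> t01; have /andP[t0 _] := t01.
have := lag_tail_ge0 a_gt y_ge0 n.+1 t01; rewrite /lag_tail subr_ge0; apply: le_trans.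
rewrite big_nat_recr //= lerDr.
by apply: sumr_ge0 => k _; rewrite mulr_ge0 ?exprn_ge0 ?lag_weight_ge0.
Qed.

Lemma Rker_diag_ge0 t : 0 <= t < 1 -> 0 <= diag t.
Proof.
move=> t01; have /andP[t0 _] := t01; apply: le_trans (lag_weight_le 0 t01).
by rewrite mulr_ge0 ?lag_weight_ge0 ?exprn_ge0.
Qed.

Lemma measurable_Rker_diag : measurable_fun (disc : set T) (fun z => diag (rho z)).
Proof.
apply: (@measurable_fun_cvg _ T R disc
  (fun N (z : T) => \sum_(0 <= n < N) lag_weight a y n * rho z ^+ n)) => [N|z dz]; last first.
  by apply: lag_weight_series => //; rewrite rho_ge0.
apply: measurable_sum => n; apply: measurable_funM; first exact: measurable_cst.
by apply: measurable_funX; apply: measurable_funTS; exact: measurable_rho.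
Qed.

Lemma measurable_lag_tail N : measurable_fun (disc : set T) (fun z => lag_tail a y N (rho z)).
Proof.
apply: measurable_funB; first exact: measurable_Rker_diag.
apply: measurable_sum => n; apply: measurable_funM; first exact: measurable_cst.
by apply: measurable_funX; apply: measurable_funTS; exact: measurable_rho.
Qed.

Variable phi : R -> quat R.
Hypothesis phi_L2 : laguerre_L2 a phi.

Lemma qball_sqr (q : quat R) : qball q -> 0 <= qnorm q ^+ 2 < 1.
Proof. by move=> qb; rewrite sqr_ge0 expr_lt1 ?qnorm_ge0. Qed.

Lemma Sop_series (q : quat R) : qball q ->
  series (fun n => q ^+ n * lag_coef a y phi n) @ \oo --> Sop a y phi q.
Proof.
move=> qb; apply: (proj2 (@cvgrPdist_lt R (quat R) _ (\oo : set_system nat) _ _ _)) => e e0.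
have tl : (4 * (lag_tail a y N (qnorm q ^+ 2) * lag_nrm2 a phi)) @[N --> \oo] --> (0 : R).
  rewrite -(mulr0 (4 : R)) -[X in 4 * X](mul0r (lag_nrm2 a phi)).
  apply: cvgM; first exact: cvg_cst.
  by apply: cvgM; [exact: lag_tail_cvg0 (qball_sqr qb)|exact: cvg_cst].
have e2 : 0 < e ^+ 2 by rewrite exprn_gt0.
move/cvgrPdist_lt : tl => /(_ _ e2) [N _ hN]; exists N => // n /= Nn.
apply: le_lt_trans (normr_le_qnorm _) _.
rewrite -(@ltr_pXn2r _ 2) ?nnegrE ?qnorm_ge0 ?(ltW e0) //.
apply: le_lt_trans (Sop_approx a_gt y_ge0 n phi_L2 qb) _.
by have := hN n Nn; rewrite /= sub0r normrN; apply: le_lt_trans; exact: ler_norm.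
Qed.

Lemma qnorm_Sop_le (q : quat R) : qball q ->
  qnorm (Sop a y phi q) ^+ 2 <= 4 * lag_nrm2 a phi * diag (qnorm q ^+ 2).
Proof.
move=> qb; have := Sop_approx a_gt y_ge0 0 phi_L2 qb.
by rewrite /lag_tail !big_geq // !subr0 -mulrA [lag_nrm2 _ _ * _]mulrC.
Qed.

Lemma Sop_slice_regular (f : quat R -> quat R) :
  (forall q, qball q -> f q = Sop a y phi q) -> slice_regular f.
Proof.
move=> fS; apply: (@pseries_slice_regular _ _ (lag_coef a y phi)); last first.
  by move=> q qb; rewrite fS //; exact: Sop_series.
(* The quantity x = |c_n| t^n satisfies x^2 <= B, and B + 1 then bounds x, whether x <= 1 or x <=
   x^2. *)
move=> t /andP[t0 t1]; exists (4 * lag_nrm2 a phi * diag (t ^+ 2) + 1) => n.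
have t201 : 0 <= t ^+ 2 < 1 by rewrite sqr_ge0 expr_lt1 // ltW.
have P0 := lag_nrm2_ge0 a phi.
set x := _ * t ^+ n; set B := 4 * _ * _.
have x2 : x ^+ 2 <= B.
  rewrite /x exprMn -exprM mulnC exprM.
  apply: le_trans (ler_wpM2r _ (lag_coef_le y a_gt n phi_L2).2) _.
    by rewrite exprn_ge0 ?sqr_ge0.
  have := ler_wpM2l (mulr_ge0 (ler0n R 4) P0) (lag_weight_le n t201).
  by apply: le_trans; rewrite le_eqVlt; apply/orP; left; apply/eqP; ring.
have [x1|/ltW x1] := leP x 1.
  apply: le_trans x1 _; rewrite lerDr; apply: le_trans (sqr_ge0 x) x2.
have : x <= x ^+ 2 by rewrite expr2 ler_peMl // (le_trans ler01).
by move=> /le_trans/(_ x2)/le_trans; apply; rewrite lerDl.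
Qed.

Lemma qmeasurable_Sop (I : quat R) : qsphere I ->
  qmeasurable (disc : set T) (fun z => Sop a y phi (slice_pt I z.1 z.2)).
Proof.
move=> hI; apply: (@qmeasurable_cvg _ T R disc (fun N (z : T) =>
  \sum_(0 <= n < N) slice_pt I z.1 z.2 ^+ n * lag_coef a y phi n)) => [N|z dz].
  apply: qmeasurable_sum => n; apply: qmeasurableM; last exact: qmeasurable_cst.
  exact: qmeasurable_slice_ptX.
by apply: Sop_series; exact/qball_slice_pt.
Qed.

End SopSlice.

(** * Vanishing angular integrals for radial weights *)

Section RadialOrthogonality.
Variable R : realType.
Local Notation T := (measurableTypeR R * measurableTypeR R)%type.
Local Notation rho z := (z.1 ^+ 2 + z.2 ^+ 2).

Lemma cpw_rot (c s : R) (z : R * R) n : cpw (plane_rot c s z).1 (plane_rot c s z).2 n =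
  plane_rot (cpw c s n).1 (cpw c s n).2 (cpw z.1 z.2 n).
Proof.
elim: n => [|n IHn]; first by rewrite /plane_rot /=; congr (_, _); ring.
by rewrite [cpw _ _ _]/= IHn /plane_rot /=; congr (_, _); ring.
Qed.

Lemma cpw_cos_sin (t : R) n : cpw (cos t) (sin t) n = (cos (t *+ n), sin (t *+ n)).
Proof.
elim: n => [|n IHn]; first by rewrite mulr0n cos0 sin0.
by rewrite /= IHn /= mulrS cosD sinD; congr (_, _); rewrite addrC.
Qed.

Lemma measurable_cpw n :
  measurable_fun [set: T] (fun z => ((cpw z.1 z.2 n).1 : measurableTypeR R)) /\
  measurable_fun [set: T] (fun z => ((cpw z.1 z.2 n).2 : measurableTypeR R)).
Proof.
elim: n => [|n [m1 m2]]; first by split; exact: measurable_cst.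
have [mf ms] := (@measurable_fst _ _ (measurableTypeR R) (measurableTypeR R),
  @measurable_snd _ _ (measurableTypeR R) (measurableTypeR R)).
by split; [apply: measurable_funB|apply: measurable_funD]; exact: measurable_funM.
Qed.

Section Radial.
Variables (w : R * R -> R) (k : nat).
Hypotheses (k_gt0 : (0 < k)%N) (w_ge0 : forall z, disc z -> 0 <= w z).
Hypothesis w_rot : forall c s z, c ^+ 2 + s ^+ 2 = 1 -> w (plane_rot c s z) = w z.
Hypothesis w_int : leb2.-integrable (disc : set T) (EFin \o w).

Let mw : measurable_fun (disc : set T) w.
Proof. by apply/measurable_EFinP; exact: (measurable_int _ w_int). Qed.

Lemma integrable_radial_cpw :
  leb2.-integrable (disc : set T) (EFin \o (fun z => w z * (cpw z.1 z.2 k).1)) /\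
  leb2.-integrable (disc : set T) (EFin \o (fun z => w z * (cpw z.1 z.2 k).2)).
Proof.
have [m1 m2] := measurable_cpw k.
have b1 (z : T) : disc z -> Num.sqrt (rho z) ^+ k <= 1.
  move=> dz; rewrite exprn_ile1 ?sqrtr_ge0 //.
  by rewrite -sqrtr1 ler_wsqrtr // ltW.
split; apply: le_integrableR w_int => [||z dz]; first [exact: measurable_disc
  | by apply: measurable_funM => //; exact: measurable_funTS
  | by rewrite normrM ger0_norm ?w_ge0 // -[leRHS]mulr1 ler_wpM2l ?w_ge0 //;
       apply: le_trans (b1 z dz); have [] := cpw_le z.1 z.2 k].
Qed.

(* The rotation by pi / (2k) turns z^k into i z^k, hence fixes the integral and
   multiplies it by i. *)
Lemma Rintegral_radial_cpw :
  \int[leb2]_(z in (disc : set T)) (w z * (cpw z.1 z.2 k).1) = 0 /\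
  \int[leb2]_(z in (disc : set T)) (w z * (cpw z.1 z.2 k).2) = 0.
Proof.
have [i1 i2] := integrable_radial_cpw.
pose t : R := pi / 2 / k%:R.
have k0 : (k%:R : R) != 0 by rewrite pnatr_eq0 -lt0n.
have tk : t *+ k = pi / 2 by rewrite -(mulr_natr t k) /t divfK.
have t_gt0 : 0 < t by rewrite !divr_gt0 ?pi_gt0 ?ltr0n.
have t_le : t <= pi / 2.
  by rewrite -tk -(mulr_natr t k); apply: ler_peMr; [exact: ltW|rewrite ler1n].
(* k >= 1 places t in ]0, pi/2], so cos t >= 0 and the decomposition into shears is available. *)
have c1 : 1 + cos t != 0.
  have : 0 <= cos t by apply: cos_ge0_pihalf; rewrite t_le andbT; move: t_gt0 (pi_gt0 R); lra.
  by move=> c0; rewrite gt_eqF // ltr_wpDr.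
have cs : cos t ^+ 2 + sin t ^+ 2 = 1 by exact: cos2Dsin2.
have rk z : cpw (plane_rot (cos t) (sin t) z).1 (plane_rot (cos t) (sin t) z).2 k =
    (- (cpw z.1 z.2 k).2, (cpw z.1 z.2 k).1).
  by rewrite cpw_rot cpw_cos_sin tk cos_pihalf sin_pihalf /plane_rot /=; congr (_, _); ring.
have e1 : \int[leb2]_(z in (disc : set T)) (w z * (cpw z.1 z.2 k).1) =
    - \int[leb2]_(z in (disc : set T)) (w z * (cpw z.1 z.2 k).2).
  transitivity (\int[leb2]_(z in (disc : set T)) (-1 * (w z * (cpw z.1 z.2 k).2))).
    rewrite /Rintegral -(integral_rot cs c1 (@measurable_disc R) (measurable_int _ i1)).
    congr fine; apply: eq_integral => z _ /=; rewrite w_rot // rk /=.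
    by congr (_%:E); ring.
  by rewrite RintegralZl ?mulN1r //; exact: measurable_disc.
have e2 : \int[leb2]_(z in (disc : set T)) (w z * (cpw z.1 z.2 k).2) =
    \int[leb2]_(z in (disc : set T)) (w z * (cpw z.1 z.2 k).1).
  rewrite /Rintegral -(integral_rot cs c1 (@measurable_disc R) (measurable_int _ i2)).
  by congr fine; apply: eq_integral => z _ /=; rewrite w_rot // rk.
by move: e1 e2; lra.
Qed.

End Radial.

Lemma qconj_slice_pt (I : quat R) u v : q0 I = 0 ->
  qconj (slice_pt I u v) = slice_pt I u (- v).
Proof.
move=> I0; apply: quatP; rewrite /qconj /slice_pt !(quatE, quat1E) ?I0; ring.
Qed.

(* With A + iB = z^m and z^n = z^m z^k, the product is rho^m z^k. *)
Lemma qconj_slice_ptX (I : quat R) u v m k : qsphere I ->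
  qconj (slice_pt I u v ^+ m) * slice_pt I u v ^+ (m + k) =
  (u ^+ 2 + v ^+ 2) ^+ m *: slice_pt I (cpw u v k).1 (cpw u v k).2 /\
  qconj (slice_pt I u v ^+ (m + k)) * slice_pt I u v ^+ m =
  (u ^+ 2 + v ^+ 2) ^+ m *: slice_pt I (cpw u v k).1 (- (cpw u v k).2).
Proof.
move=> hI; have I0 := (qsphereE hI).1.
rewrite !slice_ptX // !qconj_slice_pt // !slice_ptM // cpwD /= -cpw_norm !slice_ptZ.
by split; congr (slice_pt _ _ _); ring.
Qed.

End RadialOrthogonality.

(** * Orthogonality and density for a radial weight *)

Section WeightedDisc.
Variables (R : realType) (a y : R) (I : quat R) (w : R * R -> R).
Local Notation T := (measurableTypeR R * measurableTypeR R)%type.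
Local Notation rho z := (z.1 ^+ 2 + z.2 ^+ 2).
Local Notation diag t := (q0 (Rker a t%:A y y)).
Local Notation D := (disc : set T).
Local Notation D0 := (D `&` [set z : T | 0 < rho z]).
Hypotheses (a_gt : -1 < a) (y_ge0 : 0 <= y) (hI : qsphere I).
Hypothesis w_meas : measurable_fun D w.
Hypothesis w_ge0 : forall z, 0 <= w z.
Hypothesis w_gt0 : forall z, D z -> 0 < rho z -> 0 < w z.
Hypothesis w_rot : forall c s z, c ^+ 2 + s ^+ 2 = 1 -> w (plane_rot c s z) = w z.
Hypothesis w_int : leb2.-integrable D (EFin \o (fun z => w z * diag (rho z))).

(** [w] stands in for omega(|q|^2) and is nonnegative and rotation invariant on the whole plane;
    [slice_ip_radial_weight] links the two products. *)
Definition weighted_ip (f g : quat R -> quat R) : quat R :=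
  qintegral leb2 D (fun z => w z *:
    (qconj (f (slice_pt I z.1 z.2)) * g (slice_pt I z.1 z.2))).

Let disc01 (z : T) : D z -> 0 <= rho z < 1.
Proof. by move=> dz; rewrite rho_ge0. Qed.

Lemma qconj_mul_self (p : quat R) : q0 (qconj p * p) = qnorm p ^+ 2.
Proof. by rewrite quatME qnorm_sqr !qconjE; ring. Qed.

Lemma weighted_ip_sqr f :
  q0 (weighted_ip f f) = \int[leb2]_(z in D) (w z * qnorm (f (slice_pt I z.1 z.2)) ^+ 2).
Proof.
rewrite /weighted_ip /qintegral mkquatE; apply: eq_Rintegral => z _.
by rewrite quatZE qconj_mul_self.
Qed.

(** [lag_weight n] times rho^n is one term of the nonnegative series of R_rho(y, y), and L_n(y) <> 0
    makes its coefficient positive; the integrable function of [w_int] therefore dominates. *)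
Lemma integrable_weightX n : (laguerre a n).[y] != 0 ->
  leb2.-integrable D (EFin \o (fun z => w z * rho z ^+ n)).
Proof.
move=> ny.
have lw0 : 0 < lag_weight a y n.
  by rewrite /lag_weight divr_gt0 ?lag_norm_gt0 // exprn_even_gt0.
have := integrableZR (@measurable_disc R) (lag_weight a y n)^-1 w_int.
apply: le_integrableR; first exact: measurable_disc.
  apply: measurable_funM => //; apply: measurable_funX.
  by apply: measurable_funTS; exact: measurable_rho.
move=> z dz; rewrite ger0_norm; last by rewrite mulr_ge0 ?w_ge0 ?exprn_ge0 ?rho_ge0.
rewrite mulrCA ler_wpM2l ?w_ge0 // mulrC ler_pdivlMr // mulrC.
by apply: lag_weight_le => //; exact: disc01.
Qed.

Lemma measurable_punctured_disc : measurable D0.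
Proof.
apply: measurableI; first exact: measurable_disc.
have := @measurable_rho R measurableT _ (measurable_itv `](0 : R), +oo[).
rewrite setTI (_ : _ @^-1` _ = [set z : T | 0 < rho z]) //.
by apply/seteqP; split => z; rewrite /= in_itv /= andbT.
Qed.

Lemma leb2_punctured_disc_gt0 : (0 < leb2 D0)%E.
Proof.
(* The square of side 1/2 in the first quadrant lies inside the disc and avoids the origin. *)
pose i : set (measurableTypeR R) := `]0, (2^-1 : R)[%classic.
have li : @lebesgue_measure R i = (2^-1)%:E.
  by rewrite /i lebesgue_measure_itv /= lte_fin invr_gt0 ltr0n -EFinB subr0.
have mi : measurable i by exact: measurable_itv.
apply: (@lt_le_trans _ _ (leb2 (i `*` i))).
  have -> : leb2 (i `*` i) = (@lebesgue_measure R i * @lebesgue_measure R i)%E.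
    exact: product_measure1E.
  by rewrite li -EFinM lte_fin mulr_gt0 // invr_gt0 ltr0n.
apply: le_measure; rewrite ?inE //; [exact: measurableX|exact: measurable_punctured_disc|].
move=> [u v]; rewrite /i /= !in_itv /= => -[/andP[u0 u1] /andP[v0 v1]].
have h0 : (0 : R) < 2^-1 by rewrite invr_gt0.
have half : (2^-1 : R) ^+ 2 = 4^-1 by field.
have u2 : u ^+ 2 < (2^-1) ^+ 2 by rewrite ltr_pXn2r ?nnegrE ?(ltW u0) ?(ltW h0).
have v2 : v ^+ 2 < (2^-1) ^+ 2 by rewrite ltr_pXn2r ?nnegrE ?(ltW v0) ?(ltW h0).
by split; [rewrite /disc /=; rewrite half in u2 v2; lra|rewrite addr_gt0 ?exprn_gt0].
Qed.

Let qnorm_ptX (z : T) n : qnorm (slice_pt I z.1 z.2 ^+ n) ^+ 2 = rho z ^+ n.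
Proof. by rewrite qnormX qnorm_slice_pt // exprAC sqr_sqrtr // rho_ge0. Qed.

(** Positivity of [w] is known off the origin, so the integral is bounded below by the one over the
    punctured disc. *)
Lemma weighted_ipX_gt0 n : (laguerre a n).[y] != 0 ->
  0 < q0 (weighted_ip (fun q => q ^+ n) (fun q => q ^+ n)).
Proof.
move=> ny; have wi := integrable_weightX ny.
rewrite weighted_ip_sqr -lte_fin.
rewrite (_ : \int[leb2]_(z in D) _ = \int[leb2]_(z in D) (w z * rho z ^+ n)); last first.
  by apply: eq_Rintegral => z _; rewrite qnorm_ptX.
rewrite -Rintegral_EFin //; last exact: measurable_disc.
have mf : measurable_fun D (fun z => w z * rho z ^+ n).
  by apply/measurable_EFinP; exact: measurable_int wi.
have sub : D0 `<=` D by move=> z [].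
have le : (\int[leb2]_(z in D0) (w z * rho z ^+ n)%:E <= \int[leb2]_(z in D) (w z * rho z ^+ n)%:E)%E.
  apply: (@ge0_subset_integral _ T R leb2 D0 D measurable_punctured_disc (@measurable_disc R) (fun z => (w z * rho z ^+ n)%:E) _ _ sub).
    by apply/measurable_EFinP.
  by move=> z dz; rewrite lee_fin mulr_ge0 ?w_ge0 ?exprn_ge0 ?rho_ge0.
apply: lt_le_trans le; apply: (integral_gt0 measurable_punctured_disc); last exact: leb2_punctured_disc_gt0.
  exact: (measurable_funS (@measurable_disc R) sub mf).
by move=> z [dz z0]; rewrite mulr_gt0 ?exprn_gt0 ?w_gt0.
Qed.

Lemma qintegral_slice_pt0 (A B : R * R -> R) :
  leb2.-integrable D (EFin \o A) -> leb2.-integrable D (EFin \o B) ->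
  \int[leb2]_(z in D) A z = 0 -> \int[leb2]_(z in D) B z = 0 ->
  qintegral leb2 D (fun z => slice_pt I (A z) (B z)) = 0.
Proof.
move=> iA iB A0 B0.
have mD := @measurable_disc R.
have h (k l : R) : \int[leb2]_(z in D) (k * A z + l * B z) = 0.
  by rewrite RintegralD ?RintegralZl ?A0 ?B0 ?mulr0 ?addr0 //; exact: integrableZR.
by apply: quatP; rewrite /qintegral mkquatE quat0E;
  [rewrite -(h 1 (q0 I))|rewrite -(h 0 (q1 I))|rewrite -(h 0 (q2 I))|rewrite -(h 0 (q3 I))];
  apply: eq_Rintegral => z _; rewrite /slice_pt !(quatE, quat1E); ring.
Qed.

(** For exponents j and j + k the integrand is the radial weight w rho^j times z^k or its conjugate.
    Integrability is taken from the smaller exponent, and both orders of the product are treated at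
    once. *)
Lemma weighted_ipX_orth m n : (laguerre a m).[y] != 0 -> (laguerre a n).[y] != 0 ->
  m <> n -> weighted_ip (fun q => q ^+ m) (fun q => q ^+ n) = 0.
Proof.
have wm_ge0 j (z : R * R) : disc z -> 0 <= w z * rho z ^+ j.
  by move=> _; rewrite mulr_ge0 ?w_ge0 ?exprn_ge0 ?rho_ge0.
have wm_rot j c s z : c ^+ 2 + s ^+ 2 = 1 ->
    w (plane_rot c s z) * rho (plane_rot c s z) ^+ j = w z * rho z ^+ j.
  move=> cs; rewrite w_rot //; congr (_ * _ ^+ _).
  by rewrite -[RHS]mul1r -cs /=; ring.
have main j k : (0 < k)%N -> (laguerre a j).[y] != 0 ->
    weighted_ip (fun q => q ^+ j) (fun q => q ^+ (j + k)) = 0 /\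
    weighted_ip (fun q => q ^+ (j + k)) (fun q => q ^+ j) = 0.
  move=> k0 jy; have wi := integrable_weightX jy.
  have [iP iQ] := integrable_radial_cpw k (wm_ge0 j) wi.
  have [P0 Q0] := Rintegral_radial_cpw k0 (wm_ge0 j) (wm_rot j) wi.
  have [mD iQ'] := (@measurable_disc R, integrableZR (@measurable_disc R) (-1) iQ).
  have Q0' : \int[leb2]_(z in D) (-1 * (w z * rho z ^+ j * (cpw z.1 z.2 k).2)) = 0.
    by rewrite RintegralZl // Q0 mulr0.
  split.
  - rewrite -[RHS](qintegral_slice_pt0 iP iQ P0 Q0) /weighted_ip; congr qintegral.
    apply/funext => z; rewrite (qconj_slice_ptX _ _ _ _ hI).1 !slice_ptZ.
    by congr (slice_pt _ _ _); ring.
  - rewrite -[RHS](qintegral_slice_pt0 iP iQ' P0 Q0') /weighted_ip; congr qintegral.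
    apply/funext => z; rewrite (qconj_slice_ptX _ _ _ _ hI).2 !slice_ptZ.
    by congr (slice_pt _ _ _); ring.
move=> my ny; have [mn|nm|-> //] := ltngtP m n => _.
- by rewrite -(subnKC (ltnW mn)); apply: (main _ _ _ my).1; rewrite subn_gt0.
- by rewrite -(subnKC (ltnW nm)); apply: (main _ _ _ ny).2; rewrite subn_gt0.
Qed.

Section Range.
Variable phi : R -> quat R.
Hypothesis phi_L2 : laguerre_L2 a phi.

Lemma integrable_Sop_slice :
  leb2.-integrable D (EFin \o (fun z => w z * qnorm (Sop a y phi (slice_pt I z.1 z.2)) ^+ 2)).
Proof.
have := integrableZR (@measurable_disc R) (4 * lag_nrm2 a phi) w_int.
apply: le_integrableR; first exact: measurable_disc.
  apply: measurable_funM => //; apply: measurable_qnorm_sqr.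
  exact: (qmeasurable_Sop a_gt y_ge0 phi_L2 hI).
move=> z dz; rewrite ger0_norm; last by rewrite mulr_ge0 ?w_ge0 ?sqr_ge0.
rewrite [leRHS]mulrCA ler_wpM2l ?w_ge0 //.
have qb : qball (slice_pt I z.1 z.2) by exact/qball_slice_pt.
have := qnorm_Sop_le a_gt y_ge0 phi_L2 qb.
by have := qnorm_ptX z 1; rewrite !expr1 => ->.
Qed.

Lemma lag_coef_eq0 n : (laguerre a n).[y] = 0 -> lag_coef a y phi n = 0.
Proof.
move=> ny; apply/eqP; apply: contraT => /qnorm_sqr_neq0.
have := (lag_coef_le y a_gt n phi_L2).2.
rewrite /lag_weight ny expr0n /= mul0r mul0r mulr0 => h.
by rewrite eq_le h sqr_ge0.
Qed.

Lemma weighted_tail_cvg0 :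
  (fun N => \int[leb2]_(z in D) (w z * lag_tail a y N (rho z))%:E)%E @ \oo --> 0%E.
Proof.
have mD := @measurable_disc R.
have mf N : measurable_fun D (fun z => (w z * lag_tail a y N (rho z))%:E).
  by apply/measurable_EFinP; apply: measurable_funM => //; exact: measurable_lag_tail.
have h1 : {ae leb2, forall z, D z ->
    (fun N => (w z * lag_tail a y N (rho z))%:E) @ \oo --> (0%E : \bar R)}.
  apply: aeW => z dz; apply: cvg_EFin; first exact: nearW.
  rewrite -(mulr0 (w z)); apply: cvgM; first exact: cvg_cst.
  exact: lag_tail_cvg0 (disc01 dz).
have h2 : {ae leb2, forall z, forall N : nat, D z ->
    (`|(w z * lag_tail a y N (rho z))%:E| <= (EFin \o (fun z => w z * diag (rho z))%R) z)%E}.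
  apply: aeW => z N dz; have z01 := disc01 dz.
  rewrite /= lee_fin ger0_norm; last by rewrite mulr_ge0 ?w_ge0 ?lag_tail_ge0.
  by rewrite ler_wpM2l ?w_ge0 ?lag_tail_le.
have [_ _] := dominated_convergence mD mf (measurable_cst (0%E : \bar R)) h1 w_int h2.
by rewrite integral0.
Qed.

Lemma qmeasurable_Sop_sub (s : seq nat) (c : nat -> quat R) :
  qmeasurable D (fun z => Sop a y phi (slice_pt I z.1 z.2) -
    \sum_(n <- s) slice_pt I z.1 z.2 ^+ n * c n).
Proof.
apply: qmeasurableD; first exact: (qmeasurable_Sop a_gt y_ge0 phi_L2 hI).
under [X in qmeasurable _ X]eq_fun do rewrite -scaleN1r.
apply: qmeasurableZ; first exact: measurable_cst.
elim: s => [|n s IHs].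
  by under [X in qmeasurable _ X]eq_fun do rewrite big_nil; exact: qmeasurable_cst.
under [X in qmeasurable _ X]eq_fun do rewrite big_cons.
apply: qmeasurableD => //; apply: qmeasurableM; last exact: qmeasurable_cst.
exact: qmeasurable_slice_ptX.
Qed.

Lemma weighted_approx (eps : R) : 0 < eps -> exists (s : seq nat),
  (forall n, n \in s -> (laguerre a n).[y] != 0) /\
  let g := fun q => Sop a y phi q - \sum_(n <- s) q ^+ n * lag_coef a y phi n in
  Num.sqrt (q0 (weighted_ip g g)) < eps.
Proof.
move=> eps0; have mD := @measurable_disc R.
set C := 4 * lag_nrm2 a phi.
have C0 : 0 <= C by rewrite mulr_ge0 ?lag_nrm2_ge0.
have tail_int N : leb2.-integrable D (EFin \o (fun z => w z * lag_tail a y N (rho z))).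
  apply: le_integrableR w_int => //.
    by apply: measurable_funM => //; exact: measurable_lag_tail.
  move=> z dz; have z01 := disc01 dz.
  by rewrite ger0_norm ?mulr_ge0 ?w_ge0 ?lag_tail_ge0 // ler_wpM2l ?w_ge0 ?lag_tail_le.
have [N hN] : exists N, C * \int[leb2]_(z in D) (w z * lag_tail a y N (rho z)) < eps ^+ 2.
  (* [C] may be 0, hence the divisor C + 1. *)
  have e0 : 0 < eps ^+ 2 / (C + 1) by rewrite divr_gt0 ?exprn_gt0 // ltr_wpDl.
  have := weighted_tail_cvg0.
  under eq_fun do rewrite (Rintegral_EFin mD (tail_int _)).
  move/fine_cvgP => [_ /cvgrPdist_lt /(_ _ e0) [N _ hN]]; exists N.
  have := hN N (leqnn N); rewrite /= sub0r normrN => /ltr_normlW.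
  rewrite ltr_pdivlMr ?ltr_wpDl //; apply: le_lt_trans; rewrite mulrC ler_wpM2l ?lerDl //.
  by rewrite /Rintegral fine_ge0 // integral_ge0 // => z dz;
    rewrite lee_fin mulr_ge0 ?w_ge0 // lag_tail_ge0 // disc01.
(* Dropping the indices with L_n(y) = 0 does not change the N-th partial sum, since their
   coefficients vanish. *)
exists [seq n <- iota 0 N | (laguerre a n).[y] != 0]; split.
  by move=> n; rewrite mem_filter => /andP[].
set g := fun q => _ - _; rewrite /=.
have gE q : g q = Sop a y phi q - \sum_(0 <= n < N) q ^+ n * lag_coef a y phi n.
  rewrite /g big_filter big_mkcond /index_iota subn0; congr (_ - _); apply: eq_bigr => n _.
  by case: ifPn => // /negPn/eqP/lag_coef_eq0 ->; rewrite mulr0.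
have gm : qmeasurable D (fun z => g (slice_pt I z.1 z.2)) by exact: qmeasurable_Sop_sub.
rewrite -[ltRHS](gtr0_norm eps0) -(sqrtr_sqr eps) ltr_sqrt ?exprn_gt0 //.
apply: le_lt_trans hN; rewrite weighted_ip_sqr -RintegralZl //.
have gle (z : T) : D z -> w z * qnorm (g (slice_pt I z.1 z.2)) ^+ 2
    <= C * (w z * lag_tail a y N (rho z)).
  move=> dz; rewrite [leRHS]mulrCA ler_wpM2l ?w_ge0 // gE.
  have qb : qball (slice_pt I z.1 z.2) by exact/qball_slice_pt.
  have := Sop_approx a_gt y_ge0 N phi_L2 qb.
  by have := qnorm_ptX z 1; rewrite !expr1 => ->; rewrite /C -mulrA [lag_nrm2 _ _ * _]mulrC.
have Ci := integrableZR mD C (tail_int N).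
have g0 (z : T) : 0 <= w z * qnorm (g (slice_pt I z.1 z.2)) ^+ 2.
  by rewrite mulr_ge0 ?w_ge0 ?sqr_ge0.
apply: le_Rintegral => //.
apply: le_integrableR Ci => //.
  by apply: measurable_funM => //; exact: measurable_qnorm_sqr.
by move=> z dz; rewrite ger0_norm // gle.
Qed.

End Range.
End WeightedDisc.

(** * From omega to a weight on the whole plane *)

Section RadialWeight.
Variables (R : realType) (omega : R -> R).
Local Notation T := (measurableTypeR R * measurableTypeR R)%type.
Local Notation rho z := (z.1 ^+ 2 + z.2 ^+ 2).
Local Notation D := (disc : set T).
Local Notation D0 := (D `&` [set z : T | 0 < rho z]).
Hypothesis omega_pos : forall t : R, 0 < t < 1 -> 0 < omega t.
Hypothesis omega_meas : measurable_fun (`]0, 1[ : set R) omega.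

(* Nothing is known about [omega] at 0, which only affects the (null) origin. *)
Definition radial_weight (z : R * R) : R := (omega \_ `]0, 1[) (rho z).

Lemma radial_weight_ge0 z : 0 <= radial_weight z.
Proof.
rewrite /radial_weight patchE; case: ifPn => //; rewrite inE /= in_itv => h.
by rewrite ltW ?omega_pos.
Qed.

Lemma radial_weightE z : D z -> 0 < rho z -> radial_weight z = omega (rho z).
Proof.
by move=> dz z0; rewrite /radial_weight patchE mem_set //= in_itv /= z0; exact: dz.
Qed.

Lemma radial_weight_rot c s z : c ^+ 2 + s ^+ 2 = 1 ->
  radial_weight (plane_rot c s z) = radial_weight z.
Proof.
move=> cs; rewrite /radial_weight.
suff -> : rho (plane_rot c s z) = rho z by [].
by rewrite -[RHS]mul1r -cs /=; ring.
Qed.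

Lemma measurable_radial_weight : measurable_fun D radial_weight.
Proof.
apply: measurable_funTS; apply: measurableT_comp; last exact: measurable_rho.
by apply/(measurable_restrictT _ _).1.
Qed.

Lemma measurable_origin : measurable [set (0, 0) : T].
Proof.
have -> : [set (0, 0) : T] = [set (0 : R)] `*` [set (0 : R)].
  by apply/seteqP; split => -[u v] /=; [case=> -> ->|case=> -> ->].
by apply: measurableX; exact: measurable_set1.
Qed.

Lemma leb2_origin : leb2 [set (0, 0) : T] = 0%E.
Proof.
have -> : [set (0, 0) : T] = [set (0 : R)] `*` [set (0 : R)].
  by apply/seteqP; split => -[u v] /=; [case=> -> ->|case=> -> ->].
transitivity (@lebesgue_measure R [set 0%R] * @lebesgue_measure R [set 0%R])%E.
  by apply: product_measure1E; exact: measurable_set1.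
by rewrite lebesgue_measure_set1 mule0.
Qed.

Lemma disc_punctured : D = D0 `|` [set (0, 0)].
Proof.
apply/seteqP; split => [[u v] duv|z [[] // | ->]]; last by rewrite /disc /= expr0n /= addr0.
have [uv0|uv0] := ltP 0 (u ^+ 2 + v ^+ 2); [by left|right].
have := sqr_ge0 u; have := sqr_ge0 v => v0 u0.
by rewrite /=; congr (_, _); apply/eqP; rewrite -sqrf_eq0; apply/eqP; lra.
Qed.

(** [omega] is known to be measurable on ]0, 1[; the origin is split off as a singleton, on which
    every function is measurable. *)
Lemma measurable_omega_rho : measurable_fun D (fun z => omega (rho z)).
Proof.
rewrite disc_punctured; apply/measurable_funU.
- exact: measurable_punctured_disc.
- exact: measurable_origin.
split; last exact: measurable_fun_set1.
apply: (@measurable_comp _ _ _ T (measurableTypeR R) R `]0, 1[%classic omega D0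
  (fun z : T => rho z)) => //.
  by move=> _ [z [dz z0] <-]; rewrite /= in_itv /= z0; exact: dz.
by apply: measurable_funTS; exact: measurable_rho.
Qed.

Lemma integral_radial_weight (G : T -> R) : measurable_fun D G ->
  (\int[leb2]_(z in D) (omega (rho z) * G z)%:E =
   \int[leb2]_(z in D) (radial_weight z * G z)%:E)%E.
Proof.
move=> mG; apply: ae_eq_integral.
- exact: measurable_disc.
- by apply/measurable_EFinP; apply: measurable_funM => //; exact: measurable_omega_rho.
- by apply/measurable_EFinP; apply: measurable_funM => //; exact: measurable_radial_weight.
exists [set (0, 0)]; split; [exact: measurable_origin|exact: leb2_origin|].
move=> z /= h; apply: contrapT => z0; apply: h => dz.
have : (D0 `|` [set (0, 0)]) z by rewrite -disc_punctured.
by case=> // -[_ zr]; rewrite radial_weightE.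
Qed.

(** Two replacements at once: the weight changes at the origin only, a null set, and the functions
    give way to ones with the same values on the ball, for which measurability is known. *)
Lemma slice_ip_radial_weight (I : quat R) (f g F G : quat R -> quat R) :
  qsphere I -> (forall q, qball q -> f q = F q) -> (forall q, qball q -> g q = G q) ->
  qmeasurable D (fun z => F (slice_pt I z.1 z.2)) ->
  qmeasurable D (fun z => G (slice_pt I z.1 z.2)) ->
  slice_ip omega I f g = weighted_ip I radial_weight F G.
Proof.
move=> hI fF gG mF mG.
have mcF : qmeasurable D (fun z => qconj (F (slice_pt I z.1 z.2))).
  have mN (h : T -> R) : measurable_fun D h -> measurable_fun D (fun z => - h z).
    exact: measurableT_comp.
  by case: mF => m0 m1 m2 m3; split; [apply: eq_measurable_fun m0|
    apply: eq_measurable_fun (mN _ m1)|apply: eq_measurable_fun (mN _ m2)|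
    apply: eq_measurable_fun (mN _ m3)] => z _ /=; rewrite qconjE.
have [m0 m1 m2 m3] := qmeasurableM mcF mG.
have key (h : quat R -> R) : (forall k q, h (k *: q) = k * h q) ->
    measurable_fun D (h \o (fun z => qconj (F (slice_pt I z.1 z.2)) * G (slice_pt I z.1 z.2))) ->
    \int[leb2]_(z in D) h (omega (rho z) *:
      (qconj (f (slice_pt I z.1 z.2)) * g (slice_pt I z.1 z.2))) =
    \int[leb2]_(z in D) h (radial_weight z *:
      (qconj (F (slice_pt I z.1 z.2)) * G (slice_pt I z.1 z.2))).
  move=> hZ mh; rewrite /Rintegral; congr fine.
  transitivity (\int[leb2]_(z in D) (radial_weight z *
    h (qconj (F (slice_pt I z.1 z.2)) * G (slice_pt I z.1 z.2)))%:E)%E; last first.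
    by apply: eq_integral => z _; rewrite hZ.
  rewrite -integral_radial_weight //; apply: eq_integral => z.
  rewrite inE => dz; have qb : qball (slice_pt I z.1 z.2) by exact/qball_slice_pt.
  by rewrite hZ fF ?gG.
by apply: quatP; rewrite /slice_ip /weighted_ip /qintegral !mkquatE; apply: key => // k q;
  rewrite quatZE.
Qed.

End RadialWeight.

Theorem proposition4p3 (R : realType) (alpha y : R) (I : quat R)
    (omega : R -> R)
    (halpha : -1 < alpha) (hy : 0 <= y) (hI : qsphere I)
    (homega_pos : forall t : R, 0 < t < 1 -> 0 < omega t)
    (homega_meas : measurable_fun (`]0, 1[ : set R) omega)
    (homega_fin : (\int[leb]_(t in `]0%R, 1%R[) (omega t)%:E < +oo)%E)
    (hR : (\int[leb2]_(z in disc)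
             (q0 (Rker alpha (qnorm (slice_pt I z.1 z.2) ^+ 2)%:A y y)
                * omega (qnorm (slice_pt I z.1 z.2) ^+ 2))%:E < +oo)%E) :
  cBergman alpha y `<=` slice_Bergman omega I /\
  complete_orthogonal_system (cBergman alpha y) (slice_ip omega I)
    (~` [set n | (laguerre alpha n).[y] = 0]) (fun n q => q ^+ n).
Proof.
(* This restates [hR] for the radial weight; the resulting integrable function is the dominating one
   in all that follows. *)
have w_int : leb2.-integrable disc (EFin \o (fun z : R * R => radial_weight omega z *
    q0 (Rker alpha (z.1 ^+ 2 + z.2 ^+ 2)%:A y y))).
  apply: ge0_integrableR.
  - apply: measurable_funM; first exact: measurable_radial_weight.
    exact: measurable_Rker_diag.
  - move=> z dz; apply: mulr_ge0; first exact: radial_weight_ge0.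
    by apply: Rker_diag_ge0 => //; rewrite rho_ge0.
  rewrite -integral_radial_weight //; last exact: measurable_Rker_diag.
  rewrite (_ : (\int[leb2]_(z in _) _)%E = (\int[leb2]_(z in disc)
     (q0 (Rker alpha (qnorm (slice_pt I z.1 z.2) ^+ 2)%:A y y)
        * omega (qnorm (slice_pt I z.1 z.2) ^+ 2))%:E)%E) //.
  apply: eq_integral => z _; rewrite qnorm_slice_pt // sqr_sqrtr ?rho_ge0 //.
  by rewrite mulrC.
have w_ge0 := radial_weight_ge0 homega_pos.
have w_gt0 (z : R * R) : disc z -> 0 < z.1 ^+ 2 + z.2 ^+ 2 -> 0 < radial_weight omega z.
  by move=> dz z0; rewrite radial_weightE // homega_pos // z0; exact: dz.
have w_meas := measurable_radial_weight homega_meas.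
have w_rot := @radial_weight_rot R omega.
have ipX m n : slice_ip omega I (fun q => q ^+ m) (fun q => q ^+ n) =
    weighted_ip I (radial_weight omega) (fun q => q ^+ m) (fun q => q ^+ n).
  by apply: slice_ip_radial_weight => //; exact: qmeasurable_slice_ptX.
split.
  move=> f [phi phi_L2 fS].
  have mS := qmeasurable_Sop halpha hy phi_L2 hI.
  have fE z : z \in (disc : set (R * R)) ->
      f (slice_pt I z.1 z.2) = Sop alpha y phi (slice_pt I z.1 z.2).
    by rewrite inE => dz; apply: fS; exact/qball_slice_pt.
  split; first exact: (Sop_slice_regular halpha hy phi_L2).
    by case: mS => m0 m1 m2 m3; split; [apply: eq_measurable_fun m0|
      apply: eq_measurable_fun m1|apply: eq_measurable_fun m2|
      apply: eq_measurable_fun m3] => z dz /=; rewrite fE.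
  have mD := @measurable_disc R.
  have Si := integrable_Sop_slice halpha hy hI w_meas w_ge0 w_int phi_L2.
  suff -> : (\int[leb2]_(z in disc) (qnorm (f (slice_pt I z.1 z.2)) ^+ 2 *
      omega (z.1 ^+ 2 + z.2 ^+ 2))%:E = \int[leb2]_(z in disc) (radial_weight omega z *
      qnorm (Sop alpha y phi (slice_pt I z.1 z.2)) ^+ 2)%:E)%E.
    by rewrite (Rintegral_EFin mD Si) ltry.
  rewrite -integral_radial_weight //; last exact: measurable_qnorm_sqr.
  by apply: eq_integral => z dz; rewrite fE // mulrC.
split.
- move=> n /eqP ny; split.
    exists (fun x => ((laguerre alpha n).[y]^-1 * (laguerre alpha n).[x])%:A).
      exact: laguerre_in_L2.
    by move=> q qb; rewrite Sop_laguerre.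
  rewrite ipX; apply/eqP => /(congr1 q0); rewrite quat0E.
  by apply/eqP; rewrite gt_eqF // (weighted_ipX_gt0 halpha hy).
- by move=> m n /eqP my /eqP ny mn; rewrite ipX (weighted_ipX_orth halpha hy).
move=> f eps [phi phi_L2 fS] eps0.
have [s [sN hs]] := weighted_approx halpha hy hI w_meas w_ge0 w_int phi_L2 eps0.
exists s, (lag_coef alpha y phi); split; first by move=> n /sN /eqP.
move=> g; move: hs; rewrite /=.
(* f is S phi on the ball only, and so [g] agrees with [G] there, which is all that the inner
   product sees. *)
pose G q := Sop alpha y phi q - \sum_(n <- s) q ^+ n * lag_coef alpha y phi n.
rewrite (_ : slice_ip omega I g g = weighted_ip I (radial_weight omega) G G) //.
have gG q : qball q -> g q = G q by move=> qb; rewrite /g fS.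
by apply: slice_ip_radial_weight => //; exact: qmeasurable_Sop_sub.
Qed.
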